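(* Let $k$ be an algebraically closed field of characteristic zero and let $r,s$ be positive integers with $r>s$. Put $z=1/t$, $Z=\frac{1}{\sqrt[r]{t}}$ (so $z=Z^r$, $t=Z^{-r}$) and $T'=\sqrt[r-s]{t'}$ (so $t'=T'^{\,r-s}$). Let $\alpha\in k((Z))$ be a formal Laurent series of order $-s$ with respect to $Z$. Consider the system of equations $$\partial_t\Big(\alpha\big(\tfrac{1}{\sqrt[r]{t}}\big)\Big)+t'=0,\qquad \alpha\big(\tfrac{1}{\sqrt[r]{t}}\big)+tt'=\beta(\sqrt[r-s]{t'}).$$ Using the first equation one finds an expression of $Z=\frac{1}{\sqrt[r]{t}}$ as a formal power series (of order $1$) in $T'=\sqrt[r-s]{t'}$; substituting this expression into the second equation gives $\beta=\beta(T')$, which is a formal Laurent series in $k((T'))$ of order $-s$ with respect to $T'$. Then for any regular formal connection $R$ on $k((Z))$ we have an isomorphism of formal connections on $k((t'))$ $$\mathcal F^{(\infty,0)}\Big([r]_*\big([Z\partial_Z(\alpha)]\otimes_{k((Z))}R\big)\Big)\cong[r-s]_*\Big(\big[T'\partial_{T'}(\beta)+\tfrac{s}{2}\big]\otimes_{k((T'))}R\Big),$$ where the $R$ on the right means the formal connection on $k((T'))$ obtained from $R$ by replacing the variable $Z$ with $T'$.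
   Context: A formal connection on $k((z))$ is a pair $(M,z\partial_z)$ with $M$ a finite dimensional $k((z))$-vector space and $z\partial_z:M\to M$ a $k$-linear map with $z\partial_z(fm)=z\partial_z(f)m+f\,z\partial_z(m)$ for $f\in k((z))$, $m\in M$; similarly for any other variable. Equality of connections means isomorphism. For $f\in k((Z))$, $[f]$ is the one dimensional connection $k((Z))e$ with $Z\partial_Z(ge)=(Z\partial_Z(g)+fg)e$. (Same notation for other variables.) A connection is regular if its irregularity is $0$; equivalently, it has a lattice (over the power series ring) stable under $z\partial_z$ (with the analogous meaning in any other variable). Tensor products of connections carry the usual Leibniz action. For the inclusion $[r]:k((z))\hookrightarrow k((Z))$, $z=Z^r$, and a connection $N$ on $k((Z))$, $[r]_*N$ is $N$ regarded as a $k((z))$-vector space with $z\partial_z=\frac1r Z\partial_Z$. Similarly $[r-s]_*$ for $k((t'))\hookrightarrow k((T'))$, $t'=T'^{\,r-s}$, with $t'\partial_{t'}=\frac{1}{r-s}T'\partial_{T'}$. With $t=1/z$, one has $t\partial_t=-z\partial_z=-\frac1r Z\partial_Z$ on $k((Z))$. Local Fourier transform $\mathcal F^{(\infty,0)}$ (Bloch–Esnault). It sends formal connections on $k((z))$ with slopes $<1$, where $z=1/t$, to formal connections on $k((t'))$, where $t'$ is the Fourier dual coordinate of $t$. On a connection $M$ all of whose slopes lie strictly between $0$ and $1$ (as is the case here, the slopes being $s/r$) it is described as follows: $z^2\partial_z:M\to M$ is bijective, and $\mathcal F^{(\infty,0)}(M)$ is the $k$-vector space $M$ on which $t'$ acts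 as $z^2\partial_z$ ($=-\partial_t$) (this extends by continuity for the $z$-adic topology to an action of $k((t'))$, making it finite dimensional over $k((t'))$) and on which $\partial_{t'}$ acts as multiplication by $t=1/z$. *)

(* Defs.v *)
From HB Require Import structures.
From mathcomp Require Import all_boot all_order all_algebra finmap.
From mathcomp Require Import boolp classical_sets fsbigop.
From mathcomp Require Import zify ring lra.

Set Implicit Arguments.
Unset Strict Implicit.
Unset Printing Implicit Defensive.

Import Order.TTheory GRing.Theory Num.Theory.
Local Open Scope ring_scope.

Definition vanish_below (k : fieldType) (c : int -> k) (a : int) : Prop :=
  forall n : int, n < a -> c n = 0.

(* k((z)) as coefficient functions. The name of the variable is not recorded:
   k((z)), k((Z)), k((t')) and k((T')) are all [laurent k]. *)
Record laurent (k : fieldType) := Laurent {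
  lcoef :> int -> k;
  lcoef_below : exists a : int, vanish_below lcoef a }.

HB.instance Definition _ (k : fieldType) := gen_eqMixin (laurent k).
HB.instance Definition _ (k : fieldType) := gen_choiceMixin (laurent k).

Lemma laurentP (k : fieldType) (f g : laurent k) : f =1 g -> f = g.
Proof.
case: f g => f Hf [g Hg] /= /funext E.
by subst g; congr Laurent; apply: Prop_irrelevance.
Qed.

(* The series with coefficients [c]; junk value 0 if [c] has infinitely many
   terms of negative degree. *)
Definition mklaurent (k : fieldType) (c : int -> k) : laurent k :=
  match pselect (exists a, vanish_below c a) with
  | left h => Laurent h
  | right _ => Laurent (ex_intro (fun a => vanish_below (fun=> 0) a) 0 (fun _ _ => erefl))
  end.

Lemma mklaurentE (k : fieldType) (c : int -> k) (a : int) :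
  vanish_below c a -> mklaurent c =1 c.
Proof. by move=> h; rewrite /mklaurent; case: pselect => // -[]; exists a. Qed.

Section LaurentRing.
Variable k : fieldType.
Implicit Types (f g h : laurent k) (a b : int).

Definition lzero : laurent k := mklaurent (fun=> 0).
Definition ladd f g : laurent k := mklaurent (fun n => f n + g n).
Definition lopp f : laurent k := mklaurent (fun n => - f n).
Definition lconst (c : k) : laurent k := mklaurent (fun n => if n == 0 then c else 0).
Definition lmul f g : laurent k :=
  mklaurent (fun n => \sum_(i \in [set: int]) f i * g (n - i)).

Lemma below_le (c : int -> k) a b : b <= a -> vanish_below c a -> vanish_below c b.
Proof. by move=> ba h n nb; apply: h; lia. Qed.

Lemma lzeroE n : lzero n = 0.
Proof. by rewrite (@mklaurentE _ _ 0). Qed.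
Lemma lconstE c n : lconst c n = if n == 0 then c else 0.
Proof. by rewrite (@mklaurentE _ _ 0) // => m; case: eqP => // ->. Qed.
Lemma laddE f g n : ladd f g n = f n + g n.
Proof.
case: (lcoef_below f) (lcoef_below g) => a fa [b gb].
rewrite (@mklaurentE _ _ (Num.min a b)) // => m mab.
by rewrite fa ?gb ?addr0 //; lia.
Qed.
Lemma loppE f n : lopp f n = - f n.
Proof.
by case: (lcoef_below f) => a fa; rewrite (@mklaurentE _ _ a) // => m /fa->; rewrite oppr0.
Qed.

Lemma laddA : associative ladd.
Proof. by move=> f g h; apply: laurentP => n; rewrite !laddE addrA. Qed.
Lemma laddC : commutative ladd.
Proof. by move=> f g; apply: laurentP => n; rewrite !laddE addrC. Qed.
Lemma ladd0 : left_id lzero ladd.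
Proof. by move=> f; apply: laurentP => n; rewrite !laddE lzeroE add0r. Qed.
Lemma laddN : left_inverse lzero lopp ladd.
Proof. by move=> f; apply: laurentP => n; rewrite !laddE lzeroE loppE addNr. Qed.

HB.instance Definition _ := GRing.isZmodule.Build (laurent k) laddA laddC ladd0 laddN.

Lemma lcoefD f g n : (f + g) n = f n + g n. Proof. exact: laddE. Qed.
Lemma lcoefN f n : (- f) n = - f n. Proof. exact: loppE. Qed.
Lemma lcoefB f g n : (f - g) n = f n - g n. Proof. by rewrite lcoefD lcoefN. Qed.
Lemma lcoef0 n : (0 : laurent k) n = 0. Proof. exact: lzeroE. Qed.

(* Polynomial truncations, used to transfer the ring laws from {poly k}. *)
Definition ltrunc (N : nat) (c : int -> k) a : {poly k} := \poly_(j < N) c (a + j%:Z).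

Lemma conv_below (f g : int -> k) a b : vanish_below f a -> vanish_below g b ->
  vanish_below (fun n => \sum_(i \in [set: int]) f i * g (n - i)) (a + b).
Proof.
move=> fa gb n nab; apply: fsbig1 => i _.
case: (ltrP i a) => ia; first by rewrite fa ?mul0r.
by rewrite gb ?mulr0 //; lia.
Qed.

Lemma conv_trunc (f g : int -> k) a b (m N : nat) : vanish_below f a -> vanish_below g b ->
  (m < N)%N ->
  \sum_(i \in [set: int]) f i * g (a + b + m%:Z - i)
    = (ltrunc N f a * ltrunc N g b)`_m.
Proof.
move=> fa gb mN; rewrite coefM.
pose s := [seq a + j%:Z | j <- iota 0 m.+1].
rewrite (fsbigTE [fset x | x in s]%fset) /=; last first.
  move=> i is_; case: (ltrP i a) => ia; first by rewrite fa ?mul0r.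
  case: (ltrP (a + m%:Z) i) => im; first by rewrite gb ?mulr0 //; lia.
  suff s_i : i \in s by move: is_; rewrite in_fset /= s_i.
  apply/mapP; exists (absz (i - a)); last by lia.
  by rewrite mem_iota; lia.
have us : uniq s by rewrite map_inj_uniq ?iota_uniq // => x y; lia.
rewrite (perm_big s) /=; last first.
  by apply: uniq_perm; rewrite ?fset_uniq // => x; rewrite in_fset.
rewrite big_map -[iota 0 m.+1]/(index_iota 0 m.+1) big_mkord.
apply: eq_bigr => j _; rewrite !coef_poly.
have -> : (j < N)%N by case: j => j /=; lia.
have -> : (m - j < N)%N by lia.
by congr (_ * g _); case: j => j /=; lia.
Qed.

Lemma lmulE f g n : lmul f g n = \sum_(i \in [set: int]) f i * g (n - i).
Proof.
case: (lcoef_below f) (lcoef_below g) => a fa [b gb].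
by rewrite (@mklaurentE _ _ (a + b)) //; apply: conv_below.
Qed.

Lemma lmul_below f g a b : vanish_below f a -> vanish_below g b -> vanish_below (lmul f g) (a + b).
Proof. by move=> fa gb n nab; rewrite lmulE (conv_below fa gb). Qed.

Lemma lmul_trunc f g a b (m N : nat) : vanish_below f a -> vanish_below g b -> (m < N)%N ->
  lmul f g (a + b + m%:Z) = (ltrunc N f a * ltrunc N g b)`_m.
Proof. by move=> *; rewrite lmulE (conv_trunc (N := N)). Qed.

Lemma trunc_mul f g a b (N : nat) (j : nat) : vanish_below f a -> vanish_below g b ->
  (j < N)%N -> (ltrunc N (lmul f g) (a + b))`_j = (ltrunc N f a * ltrunc N g b)`_j.
Proof. by move=> fa gb jN; rewrite coef_poly jN (lmul_trunc (N:=N)). Qed.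

Lemma coefM_eq (p p' q q' : {poly k}) (m : nat) :
  (forall j, (j <= m)%N -> p`_j = p'`_j) -> (forall j, (j <= m)%N -> q`_j = q'`_j) ->
  (p * q)`_m = (p' * q')`_m.
Proof.
move=> hp hq; rewrite !coefM; apply: eq_bigr => j _.
by rewrite hp ?hq //; case: j => j /=; lia.
Qed.

Lemma lmulA : associative lmul.
Proof.
move=> f g h; apply: laurentP => n.
case: (lcoef_below f) (lcoef_below g) (lcoef_below h) => a fa [b gb] [c hc].
have fgb := lmul_below fa gb; have ghb := lmul_below gb hc.
case: (ltrP n (a + b + c)) => nabc.
  by rewrite (lmul_below fa ghb) ?(lmul_below fgb hc) //; lia.
have [m ->] : exists m : nat, n = a + b + c + m%:Z by exists (absz (n - (a + b + c))%R); lia.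
rewrite (lmul_trunc (N:=m.+1) fgb hc) // -[a + b + c]addrA (lmul_trunc (N:=m.+1) fa ghb) //.
transitivity ((ltrunc m.+1 f a * (ltrunc m.+1 g b * ltrunc m.+1 h c))`_m).
  by apply: coefM_eq => // j jm; apply: trunc_mul.
rewrite mulrA; apply/esym/coefM_eq => // j jm; exact: trunc_mul.
Qed.

Lemma lmulC : commutative lmul.
Proof.
move=> f g; apply: laurentP => n.
case: (lcoef_below f) (lcoef_below g) => a fa [b gb].
case: (ltrP n (a + b)) => nab.
  by rewrite (lmul_below fa gb) ?(lmul_below gb fa) //; lia.
have [m ->] : exists m : nat, n = a + b + m%:Z by exists (absz (n - (a + b))%R); lia.
by rewrite (lmul_trunc (N:=m.+1) fa gb) //  [a + b]addrC (lmul_trunc (N:=m.+1) gb fa) // mulrC.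
Qed.

Lemma lmul_const c f n : lmul (lconst c) f n = c * f n.
Proof.
rewrite lmulE (fsbigTE [fset 0]%fset) ?big_seq_fset1 ?lconstE ?eqxx ?subr0 //.
by move=> i; rewrite inE lconstE => /negPf->; rewrite mul0r.
Qed.

Lemma lmul1 : left_id (lconst 1) lmul.
Proof. by move=> f; apply: laurentP => n; rewrite lmul_const mul1r. Qed.

Lemma lmulDl : left_distributive lmul ladd.
Proof.
move=> f g h; apply: laurentP => n.
case: (lcoef_below f) (lcoef_below g) (lcoef_below h) => a0 fa0 [b0 gb0] [c hc].
pose a := Num.min a0 b0.
have fa : vanish_below f a by apply: below_le fa0; lia.
have ga : vanish_below g a by apply: below_le gb0; lia.
have fga : vanish_below (ladd f g) a by move=> i ia; rewrite laddE fa ?ga ?addr0.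
rewrite laddE.
case: (ltrP n (a + c)) => nab.
  by rewrite (lmul_below fga hc) // (lmul_below fa hc) // (lmul_below ga hc) // addr0.
have [m ->] : exists m : nat, n = a + c + m%:Z by exists (absz (n - (a + c))%R); lia.
rewrite !(lmul_trunc (N:=m.+1)) // -coefD -mulrDl; apply: coefM_eq => // j jm.
by rewrite coefD !coef_poly ltnS jm laddE.
Qed.

Lemma lone_neq0 : lconst 1 != 0.
Proof.
apply/eqP => /(congr1 (fun f : laurent k => f 0)) /eqP.
by rewrite lconstE lcoef0 /= oner_eq0.
Qed.

HB.instance Definition _ :=
  GRing.Zmodule_isComNzRing.Build (laurent k) lmulA lmulC lmul1 lmulDl lone_neq0.

Lemma lcoefM f g n : (f * g) n = \sum_(i \in [set: int]) f i * g (n - i).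
Proof. exact: lmulE. Qed.
Lemma lcoef1 n : (1 : laurent k) n = (n == 0)%:R.
Proof. by rewrite lconstE; case: eqP. Qed.

Lemma lcoefM_sum f g a b (m : nat) : vanish_below f a -> vanish_below g b ->
  (f * g) (a + b + m%:Z) = \sum_(j < m.+1) f (a + j%:Z) * g (b + (m - j)%N%:Z).
Proof.
move=> fa gb; rewrite [LHS](lmul_trunc (N:=m.+1)) // coefM.
apply: eq_bigr => -[j jm] _ /=; rewrite !coef_poly jm.
by have -> : (m - j < m.+1)%N by lia.
Qed.

Lemma lcoefM_below f g a b : vanish_below f a -> vanish_below g b -> vanish_below (f * g) (a + b).
Proof. exact: lmul_below. Qed.

Lemma lcoef_lconstM c f n : (lconst c * f) n = c * f n.
Proof. exact: lmul_const. Qed.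

Definition has_order f (a : int) : Prop := f a != 0 /\ vanish_below f a.

Lemma has_order_ex f : f != 0 -> exists a, has_order f a.
Proof.
move=> f0; case: (lcoef_below f) => a fa.
have ex : exists j : nat, f (a + j%:Z) != 0.
  apply: contrapT => nex; case/eqP: f0; apply: laurentP => n; rewrite lcoef0.
  case: (ltrP n a) => na; first exact: fa.
  apply: contrapT => /eqP fn; apply: nex; exists (absz (n - a)).
  by have -> : a + `|n - a|%N%:Z = n by lia.
case: (ex_minnP ex) => m fm min_m; exists (a + m%:Z); split => // n nm.
case: (ltrP n a) => na; first exact: fa.
apply/eqP; apply: contraTT isT => fn.
have := min_m (absz (n - a)).
have -> : a + `|n - a|%N%:Z = n by lia.
by move=> /(_ fn); lia.
Qed.

(* First n coefficients of z^a / f, with a the order of f. *)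
Fixpoint invs f (a : int) (n : nat) : seq k :=
  if n is n'.+1 then
    let s := invs f a n' in
    rcons s ((f a)^-1 * ((n' == 0)%:R - \sum_(j < n') s`_j * f (a + (n' - j)%N%:Z)))
  else [::].

Lemma size_invs f a n : size (invs f a n) = n.
Proof. by elim: n => //= n IH; rewrite size_rcons IH. Qed.

Lemma nth_invs f a n j : (j < n)%N -> (invs f a n)`_j = (invs f a j.+1)`_j.
Proof.
elim: n => // n IH; rewrite ltnS leq_eqVlt => /orP[/eqP-> //|jn].
by rewrite -(IH jn) /= nth_rcons size_invs jn.
Qed.

Lemma linv_ex f : f != 0 -> exists g, g * f = 1.
Proof.
move=> /has_order_ex [a [fa0 fa]].
pose u j := (invs f a j.+1)`_j.
have uE n : \sum_(j < n.+1) u j * f (a + (n - j)%N%:Z) = (n == 0)%:R.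
  rewrite big_ord_recr /= subnn addr0 {2}/u /= nth_rcons size_invs ltnn eqxx.
  rewrite [_ * f a]mulrC mulVKf //.
  set S := (X in X + _); set S' := (X in _ - X).
  suff -> : S = S' by rewrite addrCA subrr addr0.
  by apply: eq_bigr => j _; rewrite nth_invs.
pose c (n : int) := if n < - a then 0 else u (absz (n + a)%R).
have ca : vanish_below c (- a) by move=> n h; rewrite /c h.
exists (Laurent (ex_intro _ _ ca)); apply: laurentP => n.
set g := Laurent _.
have ga : vanish_below g (- a) by [].
case: (ltrP n 0) => n0.
  rewrite lcoef1 (lmul_below ga fa) ?addNr //.
  by case: eqP n0 => // ->.
have [m ->] : exists m : nat, n = (- a) + a + m%:Z by exists (absz n); lia.
rewrite [LHS](lmul_trunc (N:=m.+1)) // coefM lcoef1 addNr add0r.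
rewrite -[RHS]/((m == 0)%:R) -uE; apply: eq_bigr => -[j jm] _ /=.
rewrite !coef_poly jm ltnS leq_subr; congr (_ * _).
rewrite /= /c; case: ifP => [|_]; first by lia.
by congr u; lia.
Qed.

Definition linv f : laurent k :=
  match pselect (exists g, g * f = 1) with left h => projT1 (cid h) | right _ => 0 end.

Lemma lmulVf f : f != 0 -> linv f * f = 1.
Proof.
move=> /linv_ex f_inv; rewrite /linv.
by case: pselect => // h; case: (cid h).
Qed.

Lemma linv0 : linv 0 = 0.
Proof.
rewrite /linv; case: pselect => // h; have [g /eqP] := h.
by rewrite mulr0 eq_sym oner_eq0.
Qed.

HB.instance Definition _ := GRing.ComNzRing_isField.Build (laurent k) lmulVf linv0.

End LaurentRing.

Section LaurentCalculus.
Variable k : fieldType.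
Implicit Types (f g h : laurent k) (a b : int).

Definition lvar : laurent k := mklaurent (fun n => (n == 1)%:R).

(* The derivation z d/dz of k((z)). *)
Definition theta f : laurent k := mklaurent (fun n => n%:~R * f n).

(* f(z) |-> f(Z^r), the inclusion k((z)) -> k((Z)) given by z = Z^r. *)
Definition inflate (r : nat) f : laurent k :=
  mklaurent (fun n => if (r%:Z %| n)%Z then f (n %/ r%:Z)%Z else 0).

(* The composite f(u). The sums are finite and the result is a Laurent series as
   soon as u has order >= 1; the definition is only meaningful in that case. *)
Definition lcomp f (u : laurent k) : laurent k :=
  mklaurent (fun n => \sum_(i \in [set: int]) f i * (u ^ i) n).

(* d/dt on k((Z)) for t = Z^-r, from t d/dt = - (1/r) Z d/dZ. *)
Definition deriv_t (r : nat) f : laurent k := - (r%:R^-1 * lvar ^+ r * theta f).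

(* Membership in k[[z]]. *)
Definition integral_series f : Prop := vanish_below f 0.

Lemma lvarE n : lvar n = (n == 1)%:R.
Proof. by rewrite (@mklaurentE _ _ 1) // => m m1; case: eqP => // E; lia. Qed.

Lemma lvar_neq0 : lvar != 0.
Proof.
apply/eqP => /(congr1 (fun f : laurent k => f 1)) /eqP.
by rewrite lvarE lcoef0 oner_eq0.
Qed.

Lemma lcoef_varM f n : (lvar * f) n = f (n - 1).
Proof.
rewrite lcoefM (fsbigTE [fset 1]%fset) ?big_seq_fset1 ?lvarE ?eqxx ?mul1r //.
by move=> i; rewrite inE lvarE => /negPf->; rewrite mul0r.
Qed.

Lemma lcoef_varXM f (j : nat) n : (lvar ^+ j * f) n = f (n - j%:Z).
Proof.
elim: j n => [|j IH] n; first by rewrite expr0 mul1r subr0.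
by rewrite exprS -mulrA lcoef_varM IH; congr (f _); lia.
Qed.

Lemma lcoef_varX (i n : int) : (lvar ^ i) n = (n == i)%:R.
Proof.
have X0 := lvar_neq0; case: i => m.
  by rewrite -exprnP -[_ ^+ _]mulr1 lcoef_varXM lcoef1 subr_eq0.
have := lcoef_varXM (lvar ^ Negz m) m.+1 (n + m.+1%:Z).
rewrite addrK => <-; rewrite NegzE -exprnN divff ?expf_neq0 // lcoef1.
by congr (_%:R); lia.
Qed.

Lemma lconstD (c d : k) : lconst (c + d) = lconst c + lconst d.
Proof.
by apply: laurentP => n; rewrite lcoefD !lconstE; case: eqP; rewrite ?addr0.
Qed.

Lemma lconst_nat (n : nat) : lconst (n%:R : k) = n%:R.
Proof.
elim: n => [|n IH]; first by apply: laurentP => n; rewrite lconstE lcoef0 if_same.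
by rewrite -addn1 !natrD lconstD IH.
Qed.

Lemma thetaE f n : theta f n = n%:~R * f n.
Proof.
by case: (lcoef_below f) => a fa; rewrite (@mklaurentE _ _ a) // => m /fa->; rewrite mulr0.
Qed.

Lemma thetaD f g : theta (f + g) = theta f + theta g.
Proof. by apply: laurentP => n; rewrite thetaE !lcoefD !thetaE mulrDr. Qed.

Lemma theta_const (c : k) : theta (lconst c) = 0.
Proof.
apply: laurentP => n; rewrite thetaE lconstE lcoef0.
by case: eqP => [->|]; rewrite ?mul0r ?mulr0.
Qed.

Lemma theta1 : theta 1 = 0. Proof. exact: theta_const. Qed.

Lemma theta_below f a : vanish_below f a -> vanish_below (theta f) a.
Proof. by move=> fa n na; rewrite thetaE fa ?mulr0. Qed.

Lemma thetaM f g : theta (f * g) = theta f * g + f * theta g.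
Proof.
apply: laurentP => n.
case: (lcoef_below f) (lcoef_below g) => a fa [b gb].
have fta := theta_below fa; have gtb := theta_below gb.
rewrite thetaE lcoefD.
case: (ltrP n (a + b)) => nab.
  by rewrite !(@lcoefM_below _ _ _ a b) ?mulr0 ?addr0.
have [m ->] : exists m : nat, n = a + b + m%:Z by exists (absz (n - (a + b))%R); lia.
rewrite !(@lcoefM_sum _ _ _ a b) // mulr_sumr -big_split; apply: eq_bigr => -[j jm] _ /=.
rewrite !thetaE.
have -> : a + b + m%:Z = (a + j%:Z) + (b + (m - j)%N%:Z) by lia.
by rewrite [in LHS]rmorphD /=; ring.
Qed.

Lemma theta_var : theta lvar = lvar.
Proof.
by apply: laurentP => n; rewrite thetaE lvarE; case: eqP => [->|]; rewrite ?mulr0 ?mulr1.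
Qed.

Lemma thetaV f : f != 0 -> theta f^-1 = - (theta f * f^-1 ^+ 2).
Proof.
move=> f0; apply: (mulfI f0); apply/eqP; rewrite -subr_eq0; apply/eqP.
have := thetaM f f^-1; rewrite divff // theta1 => E.
rewrite mulrN opprK mulrCA expr2 !mulrA mulfK // addrC.
by rewrite -E.
Qed.

Section Inflate.
Variables (r : nat) (r_gt0 : (0 < r)%N).

Lemma inflateE f n :
  inflate r f n = if (r%:Z %| n)%Z then f (n %/ r%:Z)%Z else 0.
Proof.
case: (lcoef_below f) => a fa; rewrite (@mklaurentE _ _ (- `|a|%N%:Z * r%:Z)) // => m mlt.
case: ifP => // /dvdzP [q mq]; rewrite mq mulzK; last by lia.
by apply: fa; subst m; nia.
Qed.

Lemma inflate_mulr f q : inflate r f (q * r%:Z) = f q.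
Proof. by rewrite inflateE dvdz_mull // mulzK //; lia. Qed.

Lemma inflate_ndvd f n : ~~ (r%:Z %| n)%Z -> inflate r f n = 0.
Proof. by rewrite inflateE => /negPf->. Qed.

Lemma inflate_is_additive : zmod_morphism (inflate r).
Proof.
move=> f g; apply: laurentP => n; rewrite lcoefB !inflateE.
by case: ifP; rewrite ?lcoefB ?subr0.
Qed.

Lemma inflateM f g : inflate r (f * g) = inflate r f * inflate r g.
Proof.
apply: laurentP => n; rewrite lcoefM.
have [/dvdzP [q ->]|rn] := boolP (r%:Z %| n)%Z; last first.
  rewrite inflate_ndvd // fsbig1 // => i _.
  have [ri|ri] := boolP (r%:Z %| i)%Z; last by rewrite inflate_ndvd ?mul0r.
  rewrite [X in _ * X]inflate_ndvd ?mulr0 //; apply: contra rn.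
  move: ri => /dvdzP [p ip] /dvdzP [q iq]; apply/dvdzP; exists (p + q); lia.
rewrite inflate_mulr lcoefM.
pose h (j : int) := j * r%:Z.
have hinj : injective h by apply: mulIf; lia.
rewrite -[RHS](fsbig_widen (h @` [set: int])%classic) //; last first.
  move=> i /= [_ ni]; rewrite /preimage /= inflate_ndvd ?mul0r //.
  by apply/negP => /dvdzP [j ij]; apply: ni; exists j.
rewrite fsbig_image; last by move=> x y _ _; apply: hinj.
by apply: eq_fsbigr => j _; rewrite /h -mulrBl !inflate_mulr.
Qed.

Lemma inflate_const (c : k) : inflate r (lconst c) = lconst c.
Proof.
apply: laurentP => n; rewrite inflateE !lconstE.
case: (boolP (r%:Z %| n)%Z) => [/dvdzP [q ->]|].
  rewrite mulzK; last by lia.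
  have rz : r%:Z != 0 by lia.
  by rewrite mulf_eq0 (negPf rz) orbF.
by case: eqP => // ->; rewrite dvdz0.
Qed.

Lemma inflate_is_monoid_morphism : monoid_morphism (inflate r).
Proof. by split; [exact: inflate_const | exact: inflateM]. Qed.

Lemma theta_inflate f : theta (inflate r f) = r%:R * inflate r (theta f).
Proof.
apply: laurentP => n; rewrite -lconst_nat lcoef_lconstM thetaE.
have [/dvdzP [q ->]|rn] := boolP (r%:Z %| n)%Z; last by rewrite !inflate_ndvd ?mulr0.
by rewrite !inflate_mulr thetaE [in LHS]rmorphM /= mulrA [_%:~R * _]mulrC.
Qed.

(* f = sum_(j < r) Z^j * (lsection j f)(Z^r). *)
Definition lsection (j : nat) f : laurent k := mklaurent (fun n => f (n * r%:Z + j%:Z)).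

Lemma lsectionE j f n : lsection j f n = f (n * r%:Z + j%:Z).
Proof.
case: (lcoef_below f) => a fa.
rewrite (@mklaurentE _ _ (- (`|a|%N%:Z + j%:Z))) // => m mlt.
by apply: fa; nia.
Qed.

Lemma inflate_decomp f : f = \sum_(j < r) lvar ^+ j * inflate r (lsection j f).
Proof.
apply: laurentP => n.
have lcoef_sum (F : 'I_r -> laurent k) : (\sum_(j < r) F j) n = \sum_(j < r) F j n.
  by elim/big_ind2: _ => [|x1 x2 y1 y2 <- <-|//]; rewrite ?lcoef0 ?lcoefD.
have rz : r%:Z != 0 by lia.
have jlt : (`|(n %% r%:Z)%Z|%N < r)%N by have := ltz_pmod n (d := r); have := modz_ge0 n rz; lia.
rewrite lcoef_sum (bigD1 (Ordinal jlt)) //= big1 ?addr0.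
  rewrite lcoef_varXM.
  have -> : n - `|(n %% r%:Z)%Z|%N%:Z = (n %/ r%:Z)%Z * r%:Z.
    by have := modz_ge0 n rz; have := divz_eq n r; lia.
  rewrite inflate_mulr lsectionE; congr (f _).
  by have := modz_ge0 n rz; have := divz_eq n r; lia.
move=> [j jr] /eqP /= jn; rewrite lcoef_varXM inflate_ndvd //.
apply/negP => /dvdzP [q nq]; apply: jn; apply: val_inj => /=.
have -> : n = q * r%:Z + j%:Z by lia.
by rewrite modzMDl modz_small //; lia.
Qed.

End Inflate.

End LaurentCalculus.

Arguments lvar {k}.

Definition spanning (K : pzRingType) (V : lmodType K) (I : finType) (e : I -> V) : Prop :=
  forall x, exists c : I -> K, x = \sum_i c i *: e i.

(* A formal connection; [nabla] is the action of z d/dz. The space is an lmodType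
   with a finite spanning family, rather than a vectType, so that restriction of
   scalars and the Fourier transform need no choice of basis. *)
Record connection (k : fieldType) := Connection {
  cspace :> lmodType (laurent k);
  nabla : cspace -> cspace;
  cspace_findim : exists (I : finType) (e : I -> cspace), spanning e;
  nabla_klinear : forall (c : k) (x y : cspace),
    nabla (lconst c *: x + y) = lconst c *: nabla x + nabla y;
  nabla_leibniz : forall (f : laurent k) (x : cspace),
    nabla (f *: x) = theta f *: x + f *: nabla x }.

Definition conn_iso (k : fieldType) (M N : connection k) : Prop :=
  exists phi : {linear M -> N},
    bijective phi /\ forall x, phi (nabla x) = nabla (phi x).

Section ConnectionTheory.
Variables (k : fieldType) (M : connection k).

Lemma nablaD (x y : M) : nabla (x + y) = nabla x + nabla y.
Proof. by have := nabla_klinear 1 x y; rewrite -[lconst 1]/(1 : laurent k) !scale1r. Qed.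

Lemma nabla0 : nabla (0 : M) = 0.
Proof. by apply: (addIr (nabla (0 : M))); rewrite -nablaD !add0r. Qed.

(* L is the k[[z]]-span of a finite family that spans M over k((z)). *)
Definition is_lattice (L : set M) : Prop :=
  exists (I : finType) (e : I -> M), spanning e /\
    L = [set x | exists c : I -> laurent k,
           (forall i, integral_series (c i)) /\ x = \sum_i c i *: e i]%classic.

Definition is_regular : Prop :=
  exists L, is_lattice L /\ forall x, L x -> L (nabla x).

End ConnectionTheory.

Section Line.
Variables (k : fieldType) (f : laurent k).

(* [line f] is the connection [f] = k((z)) e, with g standing for g e. *)
Definition line_nabla (g : (laurent k)^o) : (laurent k)^o := theta g + f * g.

Lemma line_findim : exists (I : finType) (e : I -> (laurent k)^o), spanning e.
Proof.
by exists 'I_1, (fun=> 1) => x; exists (fun=> x); rewrite big_ord1; apply/esym/mulr1.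
Qed.

Lemma line_klinear (c : k) (x y : (laurent k)^o) :
  line_nabla (lconst c *: x + y) = lconst c *: line_nabla x + line_nabla y.
Proof.
have E (u v : laurent k) : theta (lconst c * u + v) + f * (lconst c * u + v)
    = lconst c * (theta u + f * u) + (theta v + f * v).
  by rewrite thetaD thetaM theta_const mul0r add0r !mulrDr [f * (_ * u)]mulrCA addrACA.
exact: E.
Qed.

Lemma line_leibniz (g : laurent k) (x : (laurent k)^o) :
  line_nabla (g *: x) = theta g *: x + g *: line_nabla x.
Proof.
have E (u : laurent k) : theta (g * u) + f * (g * u) = theta g * u + g * (theta u + f * u).
  by rewrite thetaM mulrDr [f * _]mulrCA addrA.
exact: E.
Qed.

Definition line : connection k := Connection line_findim line_klinear line_leibniz.
End Line.

Section Tensor.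
Variables (k : fieldType) (A B : connection k).
Implicit Types s t : seq (A * B).

(* A tensor product over k((z)) by generators and relations: the sequence
   (x1, y1) ... (xn, yn) stands for x1 (x) y1 + ... + xn (x) yn. [TensZero] is
   needed because formal sums are only a monoid. *)
Inductive tens_rel : seq (A * B) -> seq (A * B) -> Prop :=
| TensRefl s : tens_rel s s
| TensSym s t : tens_rel s t -> tens_rel t s
| TensTrans s t u : tens_rel s t -> tens_rel t u -> tens_rel s u
| TensCat s s' t t' : tens_rel s s' -> tens_rel t t' -> tens_rel (s ++ t) (s' ++ t')
| TensComm s t : tens_rel (s ++ t) (t ++ s)
| TensZero y : tens_rel [:: (0, y)] [::]
| TensDl x x' y : tens_rel [:: (x + x', y)] [:: (x, y); (x', y)]
| TensDr x y y' : tens_rel [:: (x, y + y')] [:: (x, y); (x, y')]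
| TensZ (a : laurent k) x y : tens_rel [:: (a *: x, y)] [:: (x, a *: y)].

Definition tens_eqv : rel (seq (A * B)) := fun s t => `[< tens_rel s t >].

Lemma tens_eqv_refl : reflexive tens_eqv.
Proof. by move=> s; apply/asboolP; apply: TensRefl. Qed.
Lemma tens_eqv_sym : symmetric tens_eqv.
Proof. by move=> s t; apply/asboolP/asboolP => /TensSym. Qed.
Lemma tens_eqv_trans : transitive tens_eqv.
Proof.
by move=> t s u /asboolP st /asboolP tu; apply/asboolP; apply: TensTrans st tu.
Qed.

Canonical tens_equiv := EquivRel tens_eqv tens_eqv_refl tens_eqv_sym tens_eqv_trans.

Definition tens_space := {eq_quot tens_equiv}%qT.
HB.instance Definition _ := EqQuotient.on tens_space.
HB.instance Definition _ := Choice.on tens_space.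

Definition tens_class s : tens_space := (\pi_tens_space s)%qT.

Lemma tens_classP s t : tens_class s = tens_class t <-> tens_rel s t.
Proof.
split=> [/eqmodP|st]; first by move/asboolP.
by apply/eqmodP/asboolP.
Qed.

Lemma tens_classW (P : tens_space -> Prop) : (forall s, P (tens_class s)) -> forall x, P x.
Proof. by move=> h; elim/quotW. Qed.

Lemma tens_repr s : tens_rel (repr (tens_class s)) s.
Proof. by apply/tens_classP; rewrite /tens_class reprK. Qed.

Definition tens_smap (a : laurent k) s := [seq (a *: p.1, p.2) | p <- s].
(* Leibniz rule: x (x) y |-> nabla x (x) y + x (x) nabla y. *)
Definition tens_dmap s := flatten [seq [:: (nabla p.1, p.2); (p.1, nabla p.2)] | p <- s].

Lemma tens_rel_smap a s t : tens_rel s t -> tens_rel (tens_smap a s) (tens_smap a t).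
Proof.
elim=> {s t} [s|s t _ IH|s t u _ IH1 _ IH2|s s' t t' _ IH1 _ IH2|s t|y|x x' y|x y y'|b x y].
- exact: TensRefl.
- exact: TensSym.
- exact: TensTrans IH1 IH2.
- by rewrite /tens_smap !map_cat; apply: TensCat.
- by rewrite /tens_smap !map_cat; apply: TensComm.
- by rewrite /= scaler0; apply: TensZero.
- by rewrite /= scalerDr; apply: TensDl.
- exact: TensDr.
- by rewrite /= scalerA mulrC -scalerA; apply: TensZ.
Qed.

Lemma tens_rel_dmap s t : tens_rel s t -> tens_rel (tens_dmap s) (tens_dmap t).
Proof.
elim=> {s t} [s|s t _ IH|s t u _ IH1 _ IH2|s s' t t' _ IH1 _ IH2|s t|y|x x' y|x y y'|b x y].
- exact: TensRefl.
- exact: TensSym.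
- exact: TensTrans IH1 IH2.
- by rewrite /tens_dmap !map_cat !flatten_cat; apply: TensCat.
- by rewrite /tens_dmap !map_cat !flatten_cat; apply: TensComm.
- rewrite /tens_dmap /= nabla0 -[X in tens_rel X]/([:: _] ++ [:: _]) -[[::]]/([::] ++ [::]).
  by apply: TensCat; apply: TensZero.
- rewrite /tens_dmap /= nablaD -[X in tens_rel X]/([:: _] ++ [:: _]).
  apply: TensTrans (TensCat (TensDl _ _ _) (TensDl _ _ _)) _.
  rewrite -[X in tens_rel X]/([:: (nabla x, y)] ++ ([:: (nabla x', y); (x, nabla y)] ++ [:: (x', nabla y)])).
  rewrite -[X in tens_rel _ X]/([:: (nabla x, y)] ++ ([:: (x, nabla y); (nabla x', y)] ++ [:: (x', nabla y)])).
  apply: TensCat; first exact: TensRefl.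
  apply: TensCat; last exact: TensRefl.
  exact: (TensComm [:: _] [:: _]).
- rewrite /tens_dmap /= nablaD -[X in tens_rel X]/([:: _] ++ [:: _]).
  apply: TensTrans (TensCat (TensDr _ _ _) (TensDr _ _ _)) _.
  rewrite -[X in tens_rel X]/([:: (nabla x, y)] ++ ([:: (nabla x, y'); (x, nabla y)] ++ [:: (x, nabla y')])).
  rewrite -[X in tens_rel _ X]/([:: (nabla x, y)] ++ ([:: (x, nabla y); (nabla x, y')] ++ [:: (x, nabla y')])).
  apply: TensCat; first exact: TensRefl.
  apply: TensCat; last exact: TensRefl.
  exact: (TensComm [:: _] [:: _]).
- rewrite /tens_dmap /= !nabla_leibniz.
  apply: (@TensTrans _ (([:: (theta b *: x, y)] ++ [:: (b *: nabla x, y)]) ++ [:: (b *: x, nabla y)])).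
    by rewrite -[X in tens_rel X]/([:: _] ++ [:: _]); apply: TensCat; [exact: TensDl | exact: TensRefl].
  apply: (@TensTrans _ (([:: (x, theta b *: y)] ++ [:: (nabla x, b *: y)]) ++ [:: (x, b *: nabla y)])).
    by apply: TensCat; [apply: TensCat|]; apply: TensZ.
  apply: TensTrans (TensCat (TensComm _ _) (TensRefl _)) _.
  rewrite -catA -[X in tens_rel _ X]/([:: _] ++ [:: _]).
  by apply: TensCat; [exact: TensRefl | apply: TensSym; exact: TensDr].
Qed.

Definition tens_add (u v : tens_space) := tens_class (repr u ++ repr v).
Definition tens_scale (a : laurent k) (u : tens_space) := tens_class (tens_smap a (repr u)).
Definition tens_opp := tens_scale (-1).
Definition tens_nabla (u : tens_space) := tens_class (tens_dmap (repr u)).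

Lemma tens_addE s t : tens_add (tens_class s) (tens_class t) = tens_class (s ++ t).
Proof. by apply/tens_classP; apply: TensCat; apply: tens_repr. Qed.
Lemma tens_scaleE a s : tens_scale a (tens_class s) = tens_class (tens_smap a s).
Proof. by apply/tens_classP; apply: tens_rel_smap; apply: tens_repr. Qed.
Lemma tens_nablaE s : tens_nabla (tens_class s) = tens_class (tens_dmap s).
Proof. by apply/tens_classP; apply: tens_rel_dmap; apply: tens_repr. Qed.

Lemma tens_addA : associative tens_add.
Proof.
by elim/tens_classW=> s; elim/tens_classW=> t; elim/tens_classW=> u; rewrite !tens_addE catA.
Qed.
Lemma tens_addC : commutative tens_add.
Proof.
elim/tens_classW=> s; elim/tens_classW=> t; rewrite !tens_addE.
by apply/tens_classP; apply: TensComm.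
Qed.
Lemma tens_add0 : left_id (tens_class [::]) tens_add.
Proof. by elim/tens_classW=> s; rewrite tens_addE. Qed.

Lemma tens_rel_interleave (F G H : A * B -> seq (A * B)) s :
  (forall p, tens_rel (F p) (G p ++ H p)) ->
  tens_rel (flatten (map F s)) (flatten (map G s) ++ flatten (map H s)).
Proof.
move=> FGH; elim: s => [|p s IH] /=; first exact: TensRefl.
apply: TensTrans (TensCat (FGH p) IH) _.
rewrite -!catA; apply: TensCat; first exact: TensRefl.
rewrite !catA; apply: TensCat; last exact: TensRefl.
exact: TensComm.
Qed.

Lemma tens_scaleDl u a b : tens_scale (a + b) u = tens_add (tens_scale a u) (tens_scale b u).
Proof.
elim/tens_classW: u => s; rewrite !tens_scaleE tens_addE; apply/tens_classP.
pose F c (p : A * B) := [:: (c *: p.1, p.2)].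
have FD p : tens_rel (F (a + b) p) (F a p ++ F b p).
  by rewrite /F scalerDl; apply: TensDl.
by have := tens_rel_interleave s FD; rewrite !flatten_map1.
Qed.

Lemma tens_scaleDr : right_distributive tens_scale tens_add.
Proof.
move=> a; elim/tens_classW=> s; elim/tens_classW=> t.
by rewrite (tens_addE s t) !tens_scaleE tens_addE /tens_smap map_cat.
Qed.

Lemma tens_scaleA a b u : tens_scale a (tens_scale b u) = tens_scale (a * b) u.
Proof.
elim/tens_classW: u => s; rewrite !tens_scaleE /tens_smap -map_comp.
by congr tens_class; apply: eq_map => p /=; rewrite scalerA.
Qed.

Lemma tens_scale1 : left_id 1 tens_scale.
Proof.
elim/tens_classW=> s; rewrite !tens_scaleE /tens_smap.
by congr tens_class; rewrite -[RHS]map_id; apply: eq_map => -[x y] /=; rewrite scale1r.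
Qed.

Lemma tens_scale0 u : tens_scale 0 u = tens_class [::].
Proof.
elim/tens_classW: u => s; rewrite !tens_scaleE; apply/tens_classP.
elim: s => [|p s IH] /=; first exact: TensRefl.
rewrite -[X in tens_rel X]/([:: _] ++ _) -[[::]]/([::] ++ [::]) scale0r.
by apply: TensCat IH; apply: TensZero.
Qed.

Lemma tens_addN : left_inverse (tens_class [::]) tens_opp tens_add.
Proof.
by move=> u; rewrite -{2}[u]tens_scale1 -tens_scaleDl addNr tens_scale0.
Qed.

HB.instance Definition _ :=
  GRing.isZmodule.Build tens_space tens_addA tens_addC tens_add0 tens_addN.

HB.instance Definition _ :=
  GRing.Zmodule_isLmodule.Build (laurent k) tens_space
    tens_scaleA tens_scale1 tens_scaleDr tens_scaleDl.

Definition tens (x : A) (y : B) : tens_space := tens_class [:: (x, y)].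

Lemma tensDl x x' y : tens (x + x') y = tens x y + tens x' y.
Proof. by rewrite /tens [RHS]tens_addE; apply/tens_classP; apply: TensDl. Qed.
Lemma tensDr x y y' : tens x (y + y') = tens x y + tens x y'.
Proof. by rewrite /tens [RHS]tens_addE; apply/tens_classP; apply: TensDr. Qed.
Lemma tensZl (a : laurent k) x y : tens (a *: x) y = a *: tens x y.
Proof. by rewrite /tens [RHS]tens_scaleE. Qed.
Lemma tensZr (a : laurent k) x y : tens x (a *: y) = a *: tens x y.
Proof. by rewrite -tensZl /tens; apply/esym/tens_classP; apply: TensZ. Qed.

Lemma tens_class_sum s : tens_class s = \sum_(p <- s) tens p.1 p.2.
Proof.
elim: s => [|[x y] s IH]; first by rewrite big_nil.
by rewrite big_cons -IH [RHS]tens_addE.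
Qed.

Lemma tens_findim : exists (I : finType) (e : I -> tens_space), spanning e.
Proof.
have [I [e se]] := cspace_findim A; have [J [e' se']] := cspace_findim B.
exists (I * J)%type, (fun ij => tens (e ij.1) (e' ij.2)); elim/tens_classW => s.
rewrite tens_class_sum; elim: s => [|[x y] s [c IH]].
  exists (fun=> 0); rewrite big_nil big1 // => i _; exact: scale0r.
have [a xa] := se x; have [b yb] := se' y.
exists (fun ij => a ij.1 * b ij.2 + c ij).
rewrite big_cons IH /=.
under [RHS]eq_bigr do rewrite scalerDl; rewrite big_split; congr (_ + _).
rewrite -(pair_bigA _ (fun i j => (a i * b j) *: tens (e i) (e' j))) /= xa.
have tens_suml (F : I -> A) z : tens (\sum_i F i) z = \sum_i tens (F i) z.
  apply: (big_morph (fun x => tens x z)) => [u v|]; first exact: tensDl.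
  by rewrite -[X in tens X](scale0r 0) tensZl scale0r.
have tens_sumr (F : J -> B) z : tens z (\sum_i F i) = \sum_i tens z (F i).
  apply: (big_morph (tens z)) => [u v|]; first exact: tensDr.
  by rewrite -[X in tens _ X](scale0r 0) tensZr scale0r.
rewrite tens_suml; apply: eq_bigr => i _; rewrite yb tens_sumr.
by apply: eq_bigr => j _; rewrite tensZl tensZr scalerA.
Qed.

Lemma tens_nablaD u v : tens_nabla (u + v) = tens_nabla u + tens_nabla v.
Proof.
elim/tens_classW: u => s; elim/tens_classW: v => t.
rewrite [_ + _ in LHS]tens_addE !tens_nablaE [RHS]tens_addE.
by rewrite /tens_dmap map_cat flatten_cat.
Qed.

Lemma tens_nabla_tens x y :
  tens_nabla (tens x y) = tens (nabla x) y + tens x (nabla y).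
Proof. by rewrite tens_nablaE [RHS]tens_addE. Qed.

Lemma tens_nabla_leibniz (f : laurent k) (u : tens_space) :
  tens_nabla (f *: u) = theta f *: u + f *: tens_nabla u.
Proof.
have n0 : tens_nabla 0 = 0 by rewrite [LHS]tens_nablaE.
elim/tens_classW: u => s; rewrite tens_class_sum.
elim: s => [|[x y] s IH]; first by rewrite big_nil !scaler0 n0 scaler0 addr0.
rewrite big_cons /= scalerDr !tens_nablaD IH -tensZl !tens_nabla_tens nabla_leibniz.
rewrite !scalerDr tensDl !tensZl -[X in X + _ = _]addrA.
by rewrite [LHS]addrACA.
Qed.

Lemma tens_nabla_klinear (c : k) (u v : tens_space) :
  tens_nabla (lconst c *: u + v) = lconst c *: tens_nabla u + tens_nabla v.
Proof. by rewrite tens_nablaD tens_nabla_leibniz theta_const scale0r add0r. Qed.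

Definition tensor : connection k :=
  Connection tens_findim tens_nabla_klinear tens_nabla_leibniz.

End Tensor.

Section Push.
Variables (k : fieldType) (k_char0 : [pchar k] =i pred0).
Variables (r : nat) (r_gt0 : (0 < r)%N) (N : connection k).

(* [r]_* N : the space N viewed over k((z)) through z = Z^r, with
   z d/dz = (1/r) Z d/dZ. *)
Definition push_space (_ : (0 < r)%N) : Type := N.
Local Notation P := (push_space r_gt0).

HB.instance Definition _ := GRing.Zmodule.on P.

Definition push_scale (f : laurent k) (x : P) : P := inflate r f *: (x : N).

Lemma push_scaleA f g x : push_scale f (push_scale g x) = push_scale (f * g) x.
Proof. by rewrite /push_scale scalerA inflateM. Qed.
Lemma push_scale1 : left_id 1 push_scale.
Proof. by move=> x; rewrite /push_scale [inflate r 1]inflate_const // scale1r. Qed.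
Lemma push_scaleDr : right_distributive push_scale +%R.
Proof. by move=> f x y; apply: scalerDr. Qed.
Lemma inflateD f g : inflate r (f + g) = inflate r f + inflate r g :> laurent k.
Proof.
apply: laurentP => n; rewrite lcoefD !inflateE //.
by case: ifP; rewrite ?lcoefD ?addr0.
Qed.
Lemma push_scaleDl x : {morph push_scale^~ x : f g / f + g}.
Proof. by move=> f g; rewrite /push_scale inflateD scalerDl. Qed.

HB.instance Definition _ :=
  GRing.Zmodule_isLmodule.Build (laurent k) P
    push_scaleA push_scale1 push_scaleDr push_scaleDl.

Definition push_nabla (x : P) : P := (r%:R : laurent k)^-1 *: nabla (x : N).

Lemma lnat_neq0 : (r%:R : laurent k) != 0.
Proof.
rewrite -lconst_nat; apply/eqP => /(congr1 (fun f : laurent k => f 0)) /eqP.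
by move/pcharf0P: k_char0 => char0; rewrite lconstE lcoef0 /= char0 gtn_eqF.
Qed.

Lemma push_findim : exists (I : finType) (e : I -> P), spanning e.
Proof.
have [I [e se]] := cspace_findim N.
exists (I * 'I_r)%type, (fun ij : I * 'I_r => lvar ^+ ij.2 *: e ij.1 : N) => x.
have [c xc] := se x; exists (fun ij : I * 'I_r => lsection r ij.2 (c ij.1)).
rewrite -(pair_bigA _ (fun i (j : 'I_r) =>
  lsection r j (c i) *: (lvar ^+ j *: e i : P))) /= xc.
apply: eq_bigr => i _; rewrite {1}(inflate_decomp r_gt0 (c i)) scaler_suml.
by apply: eq_bigr => j _; rewrite mulrC -scalerA.
Qed.

Lemma push_klinear (c : k) (x y : P) :
  push_nabla (lconst c *: x + y) = lconst c *: push_nabla x + push_nabla y.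
Proof.
have E (u v : N) : (r%:R : laurent k)^-1 *: nabla (inflate r (lconst c) *: u + v)
   = inflate r (lconst c) *: ((r%:R : laurent k)^-1 *: nabla u) + (r%:R : laurent k)^-1 *: nabla v.
  by rewrite inflate_const // nabla_klinear scalerDr !scalerA [_ * lconst c]mulrC.
exact: E.
Qed.

Lemma push_leibniz (f : laurent k) (x : P) :
  push_nabla (f *: x) = theta f *: x + f *: push_nabla x.
Proof.
have E (u : N) : (r%:R : laurent k)^-1 *: nabla (inflate r f *: u)
    = inflate r (theta f) *: u + inflate r f *: ((r%:R : laurent k)^-1 *: nabla u).
  rewrite nabla_leibniz scalerDr theta_inflate // !scalerA mulKf ?lnat_neq0 //.
  by rewrite [_ * inflate r f]mulrC.
exact: E.
Qed.

Definition pushforward : connection k :=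
  Connection push_findim push_klinear push_leibniz.
End Push.

Section Hausdorff.
Variables (k : fieldType) (M : connection k).
Local Open Scope classical_set_scope.

(* [lattice_sub0] : the z-adic topology is Hausdorff. *)
Definition free_family (I : finType) (e : I -> M) :=
  forall c : I -> laurent k, \sum_i c i *: e i = 0 -> forall i, c i = 0.

Lemma basis_ex : exists n (e : 'I_n -> M), spanning e /\ free_family e.
Proof.
pose Q (n : nat) := `[< exists e : 'I_n -> M, spanning e >].
have exQ : exists n, Q n.
  have [I [e se]] := cspace_findim M; exists #|I|; apply/asboolP.
  exists (fun i => e (enum_val i)) => x; have [c ->] := se x.
  exists (fun i => c (enum_val i)); rewrite (reindex (@enum_val I predT)) //=.
  exact/onW_bij/enum_val_bij.
case: (ex_minnP exQ) => n /asboolP[e se] nmin; exists n, e; split => // c c0 j.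
apply: contrapT => /eqP cj.
case: n e se nmin c c0 j cj => [|n] e se nmin c c0 j cj; first by case: (j).
suff /nmin : Q n by rewrite ltnn.
apply/asboolP; exists (fun i => e (lift j i)) => x; have [d ->] := se x.
exists (fun i => d (lift j i) - d j * (c j)^-1 * c (lift j i)).
have ej : e j = - ((c j)^-1 *: \sum_i c (lift j i) *: e (lift j i)).
  move: c0; rewrite (bigD1_ord j) //= => /eqP; rewrite addr_eq0 => /eqP E.
  by rewrite -scalerN -[X in _ *: X]opprK -E opprK scalerA mulVf // scale1r.
rewrite (bigD1_ord j) //= ej scalerN scalerA scaler_sumr addrC -sumrB.
by apply: eq_bigr => i _; rewrite scalerBl !scalerA ?mulrA.
Qed.

Lemma lattice_sub0 (x : M) : (forall L : set M, is_lattice L -> L x) -> x = 0.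
Proof.
have [n [e [se fe]]] := basis_ex; move=> hx.
have [c xc] := se x; rewrite xc big1 // => i _.
suff -> : c i = 0 by rewrite scale0r.
apply: laurentP => m; rewrite lcoef0.
pose e' (i : 'I_n) := lvar ^+ `|m|.+1 *: e i.
have X0 : (lvar : laurent k) ^+ `|m|.+1 != 0 by rewrite expf_neq0 ?lvar_neq0.
have se' : spanning e'.
  move=> y; have [d ->] := se y; exists (fun i => d i * (lvar ^+ `|m|.+1)^-1).
  by apply: eq_bigr => j _; rewrite /e' scalerA mulfVK.
have [d [dint xd]] := hx _ (ex_intro _ _ (ex_intro _ e' (conj se' erefl))).
have : \sum_i (c i - lvar ^+ `|m|.+1 * d i) *: e i = 0.
  under eq_bigr do rewrite scalerBl; rewrite sumrB -xc {1}xd; apply/eqP.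
  by rewrite subr_eq0; apply/eqP/eq_bigr => j _; rewrite /e' scalerA mulrC.
move=> /fe /(_ i) /eqP; rewrite subr_eq0 => /eqP->.
by rewrite lcoef_varXM dint //; lia.
Qed.

Lemma lattice_addr (L : set M) x y : is_lattice L -> L x -> L y -> L (x + y).
Proof.
move=> [I [e [_ ->]]] [c [ci ->]] [d [di ->]]; exists (fun i => c i + d i); split.
  by move=> i n n0; rewrite lcoefD ci ?di ?addr0.
by rewrite -big_split; apply: eq_bigr => i _; rewrite scalerDl.
Qed.

Lemma lattice_oppr (L : set M) x : is_lattice L -> L x -> L (- x).
Proof.
move=> [I [e [_ ->]]] [c [ci ->]]; exists (fun i => - c i); split.
  by move=> i n n0; rewrite lcoefN ci ?oppr0.
by rewrite -sumrN; apply: eq_bigr => i _; rewrite scaleNr.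
Qed.

Lemma lattice_scale (L : set M) (f : laurent k) : f != 0 -> is_lattice L ->
  exists2 L', is_lattice L' & forall x, L' x -> L (f *: x).
Proof.
move=> f0 [I [e [se ->]]].
pose e' i := f^-1 *: e i.
exists [set x | exists c : I -> laurent k,
           (forall i, integral_series (c i)) /\ x = \sum_i c i *: e' i].
  exists I, e'; split => // x; have [c ->] := se x; exists (fun i => c i * f).
  by apply: eq_bigr => i _; rewrite /e' scalerA mulfK.
move=> x [c [ci ->]]; exists c; split => //; rewrite scaler_sumr.
by apply: eq_bigr => i _; rewrite /e' !scalerA mulrAC mulfV // mul1r.
Qed.
End Hausdorff.

(* A k((t'))-vector space structure on M, finite dimensional, compatible with the
   structure over k, where t' acts as z^2 d/dz and f |-> f . x is continuous from
   the t'-adic to the z-adic topology (the lattices form a basis of neighbourhoods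
   of 0 in M). By continuity there is at most one; it exists in particular when all
   the slopes of M lie strictly between 0 and 1. *)
Record dual_action (k : fieldType) (M : connection k) := DualAction {
  dact :> laurent k -> M -> M;
  dactA : forall f g x, dact f (dact g x) = dact (f * g) x;
  dactDl : forall f g x, dact (f + g) x = dact f x + dact g x;
  dactDr : forall f x y, dact f (x + y) = dact f x + dact f y;
  dact_const : forall (c : k) x, dact (lconst c) x = lconst c *: x;
  dact_var : forall x, dact lvar x = lvar *: nabla x;
  dact_cont : forall x (L : set M), is_lattice L ->
    exists a : int, forall f : laurent k, vanish_below f a -> L (dact f x);
  dact_findim : exists (I : finType) (e : I -> M),
    forall x, exists c : I -> laurent k, x = \sum_i dact (c i) (e i) }.

Section LocalFourier.
Variables (k : fieldType) (M : connection k) (A : dual_action M).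

(* F^(oo,0)(M): the k-space M with that action of k((t')), where d/dt' acts as
   multiplication by t = 1/z, that is, t' d/dt' acts as x |-> t' . (z^-1 x). *)
Definition fourier_space (_ : dual_action M) : Type := M.
Local Notation F := (fourier_space A).

HB.instance Definition _ := GRing.Zmodule.on F.

Lemma dact1 : left_id 1 A.
Proof. by move=> x; rewrite -[1]/(lconst 1) dact_const; apply: scale1r. Qed.
Lemma dactDr_distr : right_distributive (A : laurent k -> F -> F) +%R.
Proof. by move=> f x y; apply: dactDr. Qed.
Lemma dactDl_morph x : {morph (A : laurent k -> F -> F)^~ x : f g / f + g}.
Proof. by move=> f g; apply: dactDl. Qed.

HB.instance Definition _ :=
  @GRing.Zmodule_isLmodule.Build (laurent k) F (A : laurent k -> F -> F)
    (@dactA _ _ A) dact1 dactDr_distr dactDl_morph.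

Definition fourier_nabla (x : F) : F := lvar *: (lvar^-1 *: (x : M) : F).

Lemma fourier_findim : exists (I : finType) (e : I -> F), spanning e.
Proof. exact: (dact_findim A). Qed.

Lemma dact0l x : A 0 x = 0.
Proof. by apply: (addIr (A 0 x)); rewrite -dactDl !add0r. Qed.
Lemma dact0r f : A f 0 = 0.
Proof. by apply: (addIr (A f 0)); rewrite -dactDr !add0r. Qed.
Lemma dactNl f x : A (- f) x = - A f x.
Proof. by apply: (addIr (A f x)); rewrite -dactDl !addNr dact0l. Qed.
Lemma dactNr f x : A f (- x) = - A f x.
Proof. by apply: (addIr (A f x)); rewrite -dactDr !addNr dact0r. Qed.

(* Defect of the Leibniz rule: it vanishes on k[t', 1/t'], hence everywhere by
   continuity. *)
Let E f x : M := lvar^-1 *: A f x - A f (lvar^-1 *: x) - A (lvar^-1 * theta f) x.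

Let E_add f g x : E (f + g) x = E f x + E g x.
Proof.
rewrite /E thetaD mulrDr !dactDl scalerDr !opprD.
by rewrite [X in X + _ = _]addrACA [LHS]addrACA.
Qed.

Let E_mul f g x : E (f * g) x = E f (A g x) + A f (E g x).
Proof.
rewrite /E thetaM mulrDr dactDl !dactDr !dactNr !dactA.
have -> : lvar^-1 * (theta f * g) = lvar^-1 * theta f * g by rewrite mulrA.
have -> : lvar^-1 * (f * theta g) = f * (lvar^-1 * theta g) by rewrite mulrCA.
rewrite [X in _ = X + _]addrAC -[X in _ = _ + X]addrA [RHS]addrA subrK.
by rewrite opprD addrACA.
Qed.

Let E_const c x : E (lconst c) x = 0.
Proof.
by rewrite /E theta_const mulr0 dact0l subr0 !dact_const !scalerA mulrC subrr.
Qed.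

Let E_var x : E lvar x = 0.
Proof.
have X0 := lvar_neq0 k.
rewrite /E theta_var mulVf // dact1 !dact_var scalerA mulVf // scale1r.
rewrite nabla_leibniz thetaV // theta_var scalerDr !scalerA mulfV // scale1r.
have -> : lvar * - (lvar * lvar^-1 ^+ 2) = -1 :> laurent k.
  by rewrite mulrN mulrA -expr2 -exprMn divff // expr1n.
by rewrite scaleN1r opprD opprK addrCA subrr addr0 subrr.
Qed.

Let E_varV x : E lvar^-1 x = 0.
Proof.
have X0 := lvar_neq0 k.
have : E (lvar * lvar^-1) x = 0 by rewrite mulfV // -[1]/(lconst 1) E_const.
rewrite E_mul E_var add0r => /(congr1 (A lvar^-1)).
by rewrite dactA mulVf // dact1 dact0r.
Qed.

Let E_exp (u : laurent k) : (forall x, E u x = 0) -> forall n x, E (u ^+ n) x = 0.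
Proof.
move=> u0; elim=> [|n IH] x; first by rewrite expr0 -[1]/(lconst 1) E_const.
by rewrite exprS E_mul u0 IH dact0r addr0.
Qed.

Let E_varX (i : int) x : E (lvar ^ i) x = 0.
Proof.
case: i => n; first exact: (E_exp E_var).
by rewrite NegzE -exprnN -exprVn; apply: (E_exp E_varV).
Qed.

Let E_trunc (f : laurent k) a x (N : nat) : vanish_below f a ->
  exists2 g : laurent k, vanish_below g (a + N%:Z) & E f x = E g x.
Proof.
move=> fa; elim: N => [|N [g ga Eg]]; first by exists f; rewrite ?addr0.
pose b := a + N%:Z.
exists (g - lconst (g b) * lvar ^ b).
  move=> n nb; rewrite lcoefB lcoef_lconstM lcoef_varX.
  case: eqP => [->|nb']; first by rewrite mulr1 subrr.
  by rewrite mulr0 subr0 ga // /b; rewrite /b in nb'; lia.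
rewrite Eg; have <- : E (g - lconst (g b) * lvar ^ b) x + E (lconst (g b) * lvar ^ b) x = E g x.
  by rewrite -E_add subrK.
by rewrite [X in _ + X]E_mul E_const E_varX dact0r !addr0.
Qed.

Let E_eq0 f x : E f x = 0.
Proof.
apply: lattice_sub0 => L latL.
have [|L' latL' LL'] := lattice_scale (f := lvar^-1) _ latL.
  by rewrite invr_eq0 lvar_neq0.
have [p1 h1] := dact_cont A x latL'.
have [p2 h2] := dact_cont A (lvar^-1 *: x) latL.
have [p3 h3] := dact_cont A x latL.
have [a fa] := lcoef_below f.
pose N := (`|a| + `|p1| + `|p2| + `|p3| + 1)%N.
have [g ga ->] := E_trunc x N fa.
rewrite /E; apply: lattice_addr => //; first apply: lattice_addr => //.
- by apply: LL'; apply: h1; apply: below_le ga; rewrite /N; lia.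
- by apply: lattice_oppr => //; apply: h2; apply: below_le ga; rewrite /N; lia.
- apply: lattice_oppr => //; apply: h3.
  have Xb : vanish_below (lvar^-1 : laurent k) (-1).
    by move=> n n1; rewrite -exprN1 lcoef_varX; case: eqP => // E1; lia.
  by apply: below_le (lcoefM_below Xb (theta_below ga)); rewrite /N; lia.
Qed.

Lemma fourier_leibniz (f : laurent k) (x : F) :
  fourier_nabla (f *: x) = theta f *: x + f *: fourier_nabla x.
Proof.
have H (y : M) : A lvar (lvar^-1 *: A f y) = A (theta f) y + A f (A lvar (lvar^-1 *: y)).
  have := E_eq0 f y; rewrite /E => /eqP; rewrite subr_eq0 subr_eq addrC => /eqP->.
  by rewrite dactDr !dactA mulrA mulfV ?lvar_neq0 // mul1r addrC mulrC.
exact: H.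
Qed.

Lemma fourier_klinear (c : k) (x y : F) :
  fourier_nabla (lconst c *: x + y) = lconst c *: fourier_nabla x + fourier_nabla y.
Proof.
have H (u v : M) : A lvar (lvar^-1 *: (A (lconst c) u + v))
    = A (lconst c) (A lvar (lvar^-1 *: u)) + A lvar (lvar^-1 *: v).
  rewrite dact_const scalerDr dactDr; congr (_ + _).
  by rewrite scalerA mulrC -scalerA -(dact_const A) !dactA mulrC.
exact: H.
Qed.

Definition local_fourier : connection k :=
  Connection fourier_findim fourier_klinear fourier_leibniz.
End LocalFourier.

Lemma subn_pos (r s : nat) : (s < r)%N -> (0 < r - s)%N.
Proof. by rewrite subn_gt0. Qed.

(* Main.v *)
(* Put m = r - s and let D be the connection of R. Twisting by a line only adds a series
   to D, so everything takes place on R: M is R with t' acting as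
   X = (z^r / r)(D + theta alpha), and the target is R with t' acting as z^m and t' d/dt'
   as (D + theta beta + s/2) / m. One needs a continuous bijection Theta of R with
   Theta z^m = X Theta and m z^-r Theta = Theta z^-m (D + theta beta + s/2); it carries
   the action of k((z^m)) to a dual action on M, and the dual action is unique because it
   is determined on k[t', 1/t'] and continuous.

   Theta is made of operators sum_i z^i phi_i(D) with polynomials phi_i, which converge on
   a D-stable lattice, and of c^D, the limit of q(D) for polynomials q interpolating
   a function chi with chi(nu + 1) = c chi(nu) near the eigenvalues of D. There are two
   steps.
   - The substitution Z = zeta(T) extends to R; it carries X to T^m + w D, where
     t = zeta^-r and w = - 1 / theta t.
   - Formal stationary phase. The equation Phi T^m = (T^m + w D) Phi is a difference
     equation for the phi_i, which has a polynomial solution with phi_0 = 1. The operators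
     intertwining T^m and T^m + w D are the Phi H with H in k((T)), and m t Phi T^m -
     Phi (D + m) is one of them. Its H is theta beta - s/2 - m modulo T k[[T]], where
     - s/2 - m = s/2 - r. The integer r and the terms of positive degree are absorbed by
     a factor g with theta g / g = theta beta + s/2 - H. *)
Require Import Defs.
From HB Require Import structures.
From mathcomp Require Import all_boot all_order all_algebra finmap.
From mathcomp Require Import boolp classical_sets fsbigop.
From mathcomp Require Import zify ring.

Set Implicit Arguments.
Unset Strict Implicit.
Unset Printing Implicit Defensive.

Import Order.TTheory GRing.Theory Num.Theory.
Local Open Scope ring_scope.

(** [F n] tabulates the first [n] values, and by [FE] later tables agree with it. The coefficient
    recursions below are solved this way. *)
Lemma course_of_values (T : Type) (x0 : T) (G : nat -> (nat -> T) -> T) :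
  (forall n f g, (forall i, (i < n)%N -> f i = g i) -> G n f = G n g) ->
  exists f : nat -> T, forall n, f n = G n f.
Proof.
move=> Gloc.
pose F := fix F n : nat -> T :=
  if n is n'.+1 then fun i => if (i < n')%N then F n' i else G n' (F n') else fun=> x0.
have FE n i : (i < n)%N -> F n i = F i.+1 i.
  elim: n => // n IH; rewrite ltnS leq_eqVlt => /orP[/eqP-> //|lt_in].
  by rewrite -(IH lt_in) /= lt_in.
exists (fun i => F i.+1 i) => n; rewrite [LHS]/= ltnn.
by apply: Gloc => i lt_in; apply: FE.
Qed.

Lemma int_ind_le (P : int -> Prop) (a : int) :
  P a -> (forall n, a <= n -> P n -> P (n + 1)) -> forall n, a <= n -> P n.
Proof.
move=> Pa PS n an; have -> : n = a + `|(n - a)%R|%N%:Z by lia.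
elim: `|_|%N => [|j IH]; first by rewrite addr0.
have -> : a + j.+1%:Z = a + j%:Z + 1 by lia.
by apply: PS => //; lia.
Qed.

(** * Polynomials over a field of characteristic zero *)

Section PolyChar0.
Variables (k : fieldType) (k_char0 : [pchar k] =i pred0).
Implicit Types p q : {poly k}.

Lemma natr_eq0_char0 n : (n%:R == 0 :> k) = (n == 0)%N.
Proof. by move/pcharf0P: k_char0. Qed.

Lemma intr_eq0_char0 (n : int) : (n%:~R == 0 :> k) = (n == 0).
Proof.
by case: n => n; rewrite ?NegzE ?mulrNz ?oppr_eq0 -pmulrn natr_eq0_char0.
Qed.

Lemma intr_inj_char0 : injective (fun n : int => n%:~R : k).
Proof. by move=> i j /eqP; rewrite -subr_eq0 -rmorphB intr_eq0_char0 subr_eq0 => /eqP. Qed.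

(** In characteristic zero the multiples of [c] are pairwise distinct, and [size p] roots are too
    many for a nonzero [p]. *)
Lemma poly_eq0_natmul (c : k) p : c != 0 -> (forall n : nat, p.[c *+ n] = 0) -> p = 0.
Proof.
move=> c0 p0; apply: (@roots_geq_poly_eq0 _ p [seq c *+ n | n <- iota 0 (size p)]).
- by apply/allP => _ /mapP[n _ ->]; rewrite /root p0.
- rewrite map_inj_in_uniq ?iota_uniq // => i j _ _.
  rewrite -[c *+ i]mulr_natr -[c *+ j]mulr_natr => /(mulfI c0).
  by rewrite !pmulrn => /intr_inj_char0 [].
- by rewrite size_map size_iota.
Qed.

Lemma poly_ext p q : (forall x, p.[x] = q.[x]) -> p = q.
Proof.
move=> pq; apply/eqP; rewrite -subr_eq0; apply/eqP.
by apply: (poly_eq0_natmul (oner_neq0 k)) => n; rewrite hornerD hornerN pq subrr.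
Qed.

(** [p - p(0)] vanishes at every multiple of [c]. *)
Lemma poly_periodic (c : k) p :
  c != 0 -> (forall x, p.[x + c] = p.[x]) -> forall x, p.[x] = p.[0].
Proof.
move=> c0 pc; have : p - p.[0]%:P = 0.
  apply: (poly_eq0_natmul c0) => n; rewrite hornerD hornerN hornerC.
  elim: n => [|n IH]; first by rewrite mulr0n subrr.
  by rewrite mulrSr pc.
by move=> /eqP; rewrite subr_eq0 => /eqP E x; rewrite {1}E hornerC.
Qed.

(* The antidifference of the rising-step product (X - 0)(X - c)...(X - (n-1)c) is the
   next such product divided by (n+1)c; these products form a basis. *)
Lemma poly_antidifference (c : k) q : c != 0 ->
  exists p, p.[0] = 0 /\ forall x, p.[x + c] - p.[x] = q.[x].
Proof.
move=> c0; pose b n : {poly k} := \prod_(j < n) ('X - (c *+ j)%:P).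
have bS n x : (b n.+1).[x] = (b n).[x] * (x - c *+ n).
  by rewrite /b big_ord_recr hornerM hornerXsubC.
have bS' n x : (b n.+1).[x + c] = (x + c) * (b n).[x].
  rewrite /b big_ord_recl hornerM hornerXsubC mulr0n subr0; congr (_ * _).
  rewrite !horner_prod; apply: eq_bigr => i _; rewrite !hornerXsubC /= /bump /=.
  by rewrite add1n mulrSr opprD addrACA subrr addr0.
have b_monic n : b n \is monic by apply: monic_prod => i _; apply: monicXsubC.
have size_b n : size (b n) = n.+1 by rewrite /b -(big_mkord xpredT (fun j => _ - (c *+ j)%:P)) size_prod_XsubC size_iota subn0.
elim: (size q) {-2}q (leqnn (size q)) => [|n IH] {}q.
  rewrite leqn0 size_poly_eq0 => /eqP ->; exists 0.
  by rewrite horner0; split=> // x; rewrite !horner0 subrr.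
(* [b n] is monic of degree [n], so removing the right multiple of it lowers the size bound. *)
move=> le_q; have [|p [p0 pq]] := IH (q - q`_n *: b n).
  apply/leq_sizeP => j le_nj; rewrite coefB coefZ.
  have [<-|ne_nj] := eqVneq n j.
    have := monicP (b_monic n); rewrite /lead_coef size_b /= => ->.
    by rewrite mulr1 subrr.
  have lt_nj : (n < j)%N by rewrite ltn_neqAle ne_nj.
  rewrite [q`_j]nth_default ?(leq_trans le_q) // [(b n)`_j]nth_default ?size_b //.
  by rewrite mulr0 subrr.
exists (p + (q`_n / (c *+ n.+1)) *: b n.+1); split.
  rewrite hornerD p0 hornerZ /b big_ord_recl hornerM hornerXsubC.
  by rewrite mulr0n subrr mul0r mulr0 add0r.
move=> x; rewrite !hornerD !hornerZ opprD addrACA pq hornerD hornerN hornerZ.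
have cn : c *+ n.+1 != 0 by rewrite -mulr_natr mulf_neq0 // natr_eq0_char0.
rewrite bS' bS -mulrBr [(x + c) * _]mulrC -mulrBr.
have -> : x + c - (x - c *+ n) = c *+ n.+1 by rewrite mulrSr; ring.
by rewrite mulrCA mulfVK // [(b n).[x] * _]mulrC subrK.
Qed.

End PolyChar0.

(** * Orders and truncations of Laurent series *)

Section LaurentFiltration.
Variable k : fieldType.
Implicit Types (f g : laurent k) (a b n : int).

Lemma vanish_belowD f g a : vanish_below f a -> vanish_below g a -> vanish_below (f + g) a.
Proof. by move=> fa ga n na; rewrite lcoefD fa ?ga ?addr0. Qed.

Lemma vanish_belowN f a : vanish_below f a -> vanish_below (- f) a.
Proof. by move=> fa n na; rewrite lcoefN fa ?oppr0. Qed.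

Lemma vanish_belowB f g a : vanish_below f a -> vanish_below g a -> vanish_below (f - g) a.
Proof. by move=> fa ga; apply: vanish_belowD => //; apply: vanish_belowN. Qed.

Lemma vanish_below0 a : vanish_below (0 : laurent k) a.
Proof. by move=> n _; apply: lcoef0. Qed.

Lemma vanish_below_const (c : k) : vanish_below (lconst c) 0.
Proof. by move=> n n0; rewrite lconstE; case: eqP n0 => // ->. Qed.

Lemma vanish_below_varz a : vanish_below (lvar ^ a : laurent k) a.
Proof. by move=> n na; rewrite lcoef_varX; case: eqP na => // ->; rewrite ltxx. Qed.

Lemma vanish_below_sum (I : Type) (s : seq I) (P : pred I) (F : I -> laurent k) a :
  (forall i, P i -> vanish_below (F i) a) -> vanish_below (\sum_(i <- s | P i) F i) a.
Proof.
by move=> Fa; elim/big_rec: _ => [|i f /Fa Pi fa]; [exact: vanish_below0|exact: vanish_belowD].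
Qed.

Lemma vanish_below_eq0 f : (forall a, vanish_below f a) -> f = 0.
Proof. by move=> f0; apply: laurentP => n; rewrite lcoef0 (f0 (n + 1)) //; lia. Qed.

Lemma lcoef_varzM f a n : (lvar ^ a * f) n = f (n - a).
Proof.
case: a => a; first exact: lcoef_varXM.
have := lcoef_varXM (lvar ^ Negz a * f) a.+1 (n + a.+1%:Z).
rewrite addrK mulrA NegzE -exprnN mulfV ?expf_neq0 ?lvar_neq0 // mul1r => <-.
by rewrite opprK.
Qed.

Lemma lcoef_sum (I : Type) (s : seq I) (P : pred I) (F : I -> laurent k) n :
  (\sum_(i <- s | P i) F i) n = \sum_(i <- s | P i) F i n.
Proof.
by elim/big_ind2: _ => [|x1 x2 y1 y2 <- <-|//]; rewrite ?lcoef0 ?lcoefD.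
Qed.

Lemma vanish_below_trunc f a (N : nat) : vanish_below f a ->
  vanish_below (f - \sum_(i < N) lconst (f (a + i%:Z)) * lvar ^ (a + i%:Z)) (a + N%:Z).
Proof.
move=> fa; elim: N => [|N IH]; first by rewrite big_ord0 subr0 addr0.
move=> n nN; rewrite big_ord_recr /= opprD addrA lcoefB lcoef_lconstM lcoef_varX.
case: eqP => [E|nE]; last by rewrite mulr0 subr0 IH //; lia.
rewrite mulr1 lcoefB -E lcoef_sum big1 ?subr0 ?subrr // => i _.
by rewrite lcoef_lconstM lcoef_varX; case: eqP => [E'|]; rewrite ?mulr0 //; case: i E' => i /=; lia.
Qed.

(** A series differs from a finite sum of monomials by a term of arbitrarily high order, which [H]
    sends into any given [B j]. Identities additive and continuous in a series thus reduce to
    monomials. *)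
Lemma laurent_density (V : zmodType) (J : Type) (B : J -> V -> Prop) (H : laurent k -> V) :
  (forall x, (forall j, B j x) -> x = 0) ->
  (forall f g, H (f + g) = H f + H g) ->
  (forall c i, H (lconst c * lvar ^ i) = 0) ->
  (forall j, exists a, forall f, vanish_below f a -> B j (H f)) ->
  forall f, H f = 0.
Proof.
move=> sep HD Hmon Hcont f; apply: sep => j.
have [a Ha] := Hcont j; have [b fb] := lcoef_below f.
pose N := `|(a - b)%R|%N.
pose g := \sum_(i < N) lconst (f (b + i%:Z)) * lvar ^ (b + i%:Z).
have H0 : H 0 = 0 by apply: (addIr (H 0)); rewrite -HD !add0r.
have Hg : H g = 0.
  by rewrite /g; elim/big_rec: _ => // i x _ Hx; rewrite HD Hmon Hx addr0.
have -> : H f = H (f - g) by have := HD (f - g) g; rewrite subrK Hg addr0.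
apply: Ha; have fg := vanish_below_trunc (N := N) fb; rewrite -/g in fg.
by apply: (below_le _ fg); rewrite /N; lia.
Qed.

Lemma lconstM (c d : k) : lconst (c * d) = lconst c * lconst d.
Proof. by apply: laurentP => n; rewrite lcoef_lconstM !lconstE; case: eqP; rewrite ?mulr0. Qed.

Lemma lconstN (c : k) : lconst (- c) = - lconst c.
Proof. by apply: laurentP => n; rewrite lcoefN !lconstE; case: eqP; rewrite ?oppr0. Qed.

Lemma lconst1 : lconst (1 : k) = 1. Proof. by []. Qed.

Lemma lconst0 : lconst (0 : k) = 0.
Proof. by apply: laurentP => n; rewrite lconstE lcoef0 if_same. Qed.

Lemma lconst_int (n : int) : lconst (n%:~R : k) = n%:~R.
Proof.
by case: n => n; rewrite ?NegzE ?mulrNz ?lconstN -!pmulrn lconst_nat.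
Qed.

Lemma lconst_eq0 (c : k) : (lconst c == 0) = (c == 0).
Proof.
apply/eqP/eqP => [/(congr1 (fun f : laurent k => f 0))|->]; last exact: lconst0.
by rewrite lconstE lcoef0.
Qed.

Lemma lconstV (c : k) : lconst c^-1 = (lconst c)^-1.
Proof.
have [->|c0] := eqVneq c 0; first by rewrite invr0 lconst0 invr0.
have lc : lconst c != 0 by rewrite lconst_eq0.
by apply: (mulfI lc); rewrite -lconstM !mulfV.
Qed.

Lemma thetaN f : theta (- f) = - theta f.
Proof. by apply: laurentP => n; rewrite !(thetaE, lcoefN) mulrN. Qed.

Lemma theta_varz a : theta (lvar ^ a) = a%:~R * lvar ^ a :> laurent k.
Proof.
apply: laurentP => n; rewrite thetaE -lconst_int lcoef_lconstM lcoef_varX.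
by case: eqP => [->|]; rewrite ?mulr0.
Qed.

Lemma thetaX f (n : nat) : theta (f ^+ n) = n%:R * f ^+ n.-1 * theta f.
Proof.
elim: n => [|[|n] IH]; first by rewrite expr0 theta1 !mul0r.
  by rewrite expr1 expr0 !mul1r.
rewrite exprS thetaM IH /= !exprS -natr1; ring.
Qed.

Lemma has_order_neq0 f a : has_order f a -> f != 0.
Proof. by case=> fa _; apply: contraNneq fa => ->; rewrite lcoef0. Qed.

Lemma lcoefM_lead f g a b : vanish_below f a -> vanish_below g b ->
  (f * g) (a + b) = f a * g b.
Proof.
move=> fa gb; have := lcoefM_sum 0 fa gb.
by rewrite big_ord_recl big_ord0 !addr0.
Qed.

Lemma has_orderM f g a b : has_order f a -> has_order g b -> has_order (f * g) (a + b).
Proof.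
move=> [f0 fa] [g0 gb]; split; last exact: lcoefM_below.
by rewrite lcoefM_lead // mulf_neq0.
Qed.

Lemma has_order_uniq f a b : has_order f a -> has_order f b -> a = b.
Proof.
move=> [f0 fa] [g0 gb]; case: (ltgtP a b) => // [lt_ab|lt_ba].
  by rewrite gb ?eqxx in f0.
by rewrite fa ?eqxx in g0.
Qed.

Lemma has_orderV f a : has_order f a -> has_order f^-1 (- a).
Proof.
move=> fa; have f0 := has_order_neq0 fa.
have [b fb] : exists b, has_order f^-1 b by apply: has_order_ex; rewrite invr_eq0.
have o1 : has_order (1 : laurent k) 0.
  by split; [rewrite lcoef1 oner_eq0|exact: vanish_below_const].
have := has_order_uniq (has_orderM fa fb); rewrite mulfV // => /(_ _ o1).
by move=> E; have -> : - a = b by lia.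
Qed.

Lemma lcoefV_lead f a : has_order f a -> f^-1 (- a) = (f a)^-1.
Proof.
move=> fa; have f0 := has_order_neq0 fa; have [fa0 _] := fa.
have := lcoefM_lead (proj2 fa) (proj2 (has_orderV fa)).
rewrite mulfV // subrr lcoef1 eqxx => E.
by apply: (mulfI fa0); rewrite mulfV.
Qed.

Lemma lcoefX_lead f a (n : nat) : vanish_below f a ->
  vanish_below (f ^+ n) (a * n%:Z) /\ (f ^+ n) (a * n%:Z) = (f a) ^+ n.
Proof.
move=> fa; elim: n => [|n [IH1 IH2]].
  by rewrite mulr0 !expr0 lcoef1; split => //; exact: vanish_below_const.
have -> : a * n.+1%:Z = a + a * n%:Z by rewrite intS mulrDr mulr1.
by rewrite !exprS lcoefM_lead // IH2; split => //; apply: lcoefM_below.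
Qed.

Lemma has_orderX f a (n : nat) : has_order f a -> has_order (f ^+ n) (a * n%:Z).
Proof.
move=> [f0 fa]; have [h1 h2] := lcoefX_lead n fa.
by split => //; rewrite h2 expf_neq0.
Qed.

Lemma has_order_expz f (i : int) : has_order f 1 -> has_order (f ^ i) i.
Proof.
move=> f1; case: i => n; first by have := has_orderX n f1; rewrite mul1r.
rewrite NegzE -exprnN; apply: has_orderV.
by have := has_orderX n.+1 f1; rewrite mul1r.
Qed.

Lemma has_order_lvar : has_order (lvar : laurent k) 1.
Proof.
split; first by rewrite lvarE eqxx oner_eq0.
by move=> n n1; rewrite lvarE; case: eqP n1 => // ->.
Qed.

End LaurentFiltration.

(** * Lattice filtrations *)

Lemma uniform_below (k : fieldType) (J : finType) (f : J -> laurent k) :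
  exists a : int, forall j, vanish_below (f j) a.
Proof.
have [b fb] := choice (fun j => lcoef_below (f j)).
exists (- (\sum_j `|b j|)%N%:Z) => j; apply: (below_le _ (fb j)).
by rewrite (bigD1 j) //=; lia.
Qed.

(* [filt e n] is z^n L for the lattice L spanned by e over k[[z]]. *)
Definition filt (k : fieldType) (R : connection k) (I : finType) (e : I -> R)
    (n : int) (x : R) : Prop :=
  exists c : I -> laurent k, (forall i, vanish_below (c i) n) /\ x = \sum_i c i *: e i.

Section Filtration.
Variables (k : fieldType) (R : connection k) (I : finType) (e : I -> R).
Implicit Types (x y : R) (f g : laurent k) (a b n : int).

Lemma filt_le n n' x : n' <= n -> filt e n x -> filt e n' x.
Proof. by move=> le_n [c [cn ->]]; exists c; split => // i; apply: below_le (cn i). Qed.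

Lemma filt0 n : filt e n 0.
Proof.
exists (fun=> 0); split => [i|]; first exact: vanish_below0.
by rewrite big1 // => i _; rewrite scale0r.
Qed.

Lemma filtD n x y : filt e n x -> filt e n y -> filt e n (x + y).
Proof.
move=> [c [cn ->]] [d [dn ->]]; exists (fun i => c i + d i); split => [i|].
  exact: vanish_belowD.
by rewrite -big_split; apply: eq_bigr => i _; rewrite scalerDl.
Qed.

Lemma filtZ f a n x : vanish_below f a -> filt e n x -> filt e (a + n) (f *: x).
Proof.
move=> fa [c [cn ->]]; exists (fun i => f * c i); split => [i|]; first exact: lcoefM_below.
by rewrite scaler_sumr; apply: eq_bigr => i _; rewrite scalerA.
Qed.

Lemma filt_const (c : k) n x : filt e n x -> filt e n (lconst c *: x).
Proof. by move=> xn; have := filtZ (@vanish_below_const _ c) xn; rewrite add0r. Qed.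

Lemma filtN n x : filt e n x -> filt e n (- x).
Proof. by move=> /(filt_const (- 1)); rewrite lconstN lconst1 scaleN1r. Qed.

Lemma filtB n x y : filt e n x -> filt e n y -> filt e n (x - y).
Proof. by move=> xn yn; apply: filtD => //; apply: filtN. Qed.

Lemma filt_sub n x y : filt e n x -> filt e n (y - x) -> filt e n y.
Proof. by move=> xn yxn; rewrite -[y](subrK x); apply: filtD. Qed.

Lemma filt_sum (J : Type) (s : seq J) (P : pred J) (F : J -> R) n :
  (forall j, P j -> filt e n (F j)) -> filt e n (\sum_(j <- s | P j) F j).
Proof. by move=> Fn; elim/big_ind: _ => //; [exact: filt0 | move=> *; exact: filtD]. Qed.

(** The coordinates of the [e i] in another spanning family have bounded poles, which a power of z
    clears. Hence convergence may be tested on [filt e] alone. *)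
Lemma lattice_filt L : spanning e -> is_lattice L -> exists n, forall x, filt e n x -> L x.
Proof.
move=> se [J [e' [se' ->]]]; have [d eE] := choice (fun i => se' (e i)).
have [a da] := uniform_below (fun ij : I * J => d ij.1 ij.2).
exists (- a) => x [c [cn ->]]; exists (fun j => \sum_i c i * d i j); split => [j|].
  apply: vanish_below_sum => i _; rewrite -(addNr a).
  by apply: lcoefM_below => //; apply: (da (i, j)).
transitivity (\sum_i \sum_j (c i * d i j) *: e' j).
  by apply: eq_bigr => i _; rewrite eE scaler_sumr; apply: eq_bigr => j _; rewrite scalerA.
by rewrite exchange_big; apply: eq_bigr => j _; rewrite scaler_suml.
Qed.

Lemma filt_ex x : spanning e -> exists n, filt e n x.
Proof.
by move=> se; have [c xc] := se x; have [n cn] := uniform_below c; exists n, c.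
Qed.

Lemma filt_sep x : spanning e -> (forall n, filt e n x) -> x = 0.
Proof.
move=> se xn; apply: lattice_sub0 => L /(lattice_filt se)[n]; exact.
Qed.

(** Completeness: in each coordinate a given degree meets only finitely many terms of the series. *)
Lemma filt_complete (d : int) (u : nat -> R) : (forall i, filt e (d + i%:Z) (u i)) ->
  exists S, forall N : nat, filt e (d + N%:Z) (S - \sum_(i < N) u i).
Proof.
move=> /choice[c /all_and2[cd uE]].
(* Only terms with [d + i <= n] reach degree [n]; [vE] allows any larger range. *)
pose v j n := \sum_(i < `|(n - d)%R|.+1) c i j n.
have vE j (N : nat) n : n < d + N%:Z -> v j n = \sum_(i < N) c i j n.
  move=> lt_n; case: (ltrP n d) => nd.
    by rewrite /v !big1 // => i _; apply: cd; lia.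
  rewrite -(big_mkord xpredT (fun i => c i j n)) (@big_cat_nat _ _ _ `|(n - d)%R|.+1) //=; try lia.
  rewrite big_mkord [X in _ + X]big_nat [X in _ + X]big1 ?addr0 // => i /andP[i1 i2].
  by apply: cd; lia.
have vb j : vanish_below (v j) d by move=> n nd; rewrite (vE j 0) ?big_ord0 ?addr0.
pose w j := Laurent (ex_intro _ d (vb j)).
exists (\sum_j w j *: e j) => N; exists (fun j => w j - \sum_(i < N) c i j); split => [j n nN|].
  by rewrite lcoefB lcoef_sum /= (vE j N) // subrr.
under [RHS]eq_bigr do rewrite scalerBl scaler_suml; rewrite sumrB; congr (_ - _).
by rewrite exchange_big; apply: eq_bigr => i _; rewrite uE.
Qed.

End Filtration.

(** * Polynomials in the derivation *)

Section PolyAction.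
Variables (k : fieldType) (R : connection k).
Implicit Types (x y : R) (f g : laurent k) (p q : {poly k}) (c : k).

Lemma nablaZ c x : nabla (lconst c *: x) = lconst c *: nabla x.
Proof. by rewrite nabla_leibniz theta_const scale0r add0r. Qed.

Lemma nablaN x : nabla (- x) = - nabla x.
Proof. by have := nablaZ (- 1) x; rewrite lconstN lconst1 !scaleN1r. Qed.

Lemma nablaB x y : nabla (x - y) = nabla x - nabla y.
Proof. by rewrite nablaD nablaN. Qed.

Lemma nabla_sum (J : Type) (s : seq J) (P : pred J) (F : J -> R) :
  nabla (\sum_(j <- s | P j) F j) = \sum_(j <- s | P j) nabla (F j).
Proof. exact: (big_morph _ (@nablaD _ R) (nabla0 R)). Qed.

Lemma nabla_varz (j : int) x :
  nabla (lvar ^ j *: x) = lvar ^ j *: (lconst j%:~R *: x + nabla x).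
Proof. by rewrite nabla_leibniz theta_varz scalerDr scalerA lconst_int [_ * _%:~R]mulrC. Qed.

(** Horner's scheme for [p(D) x], with [D = nabla]. *)
Definition polyact p x : R := foldr (fun c y => lconst c *: x + nabla y) 0 p.

Lemma polyact0 x : polyact 0 x = 0.
Proof. by rewrite /polyact polyseq0. Qed.

Lemma polyact_cons p c x : polyact (p * 'X + c%:P) x = lconst c *: x + nabla (polyact p x).
Proof.
rewrite -cons_poly_def /polyact polyseq_cons; case: (altP nilP) => //= p0.
rewrite p0 /= nabla0 addr0 polyseqC; case: eqP => [->|_] /=; first by rewrite lconst0 scale0r.
by rewrite nabla0 addr0.
Qed.

Lemma polyactC c x : polyact c%:P x = lconst c *: x.
Proof. by have := polyact_cons 0 c x; rewrite mul0r add0r polyact0 nabla0 addr0. Qed.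

Lemma polyactMX p x : polyact (p * 'X) x = nabla (polyact p x).
Proof. by have := polyact_cons p 0 x; rewrite addr0 lconst0 scale0r add0r. Qed.

Lemma polyactDl p q x : polyact (p + q) x = polyact p x + polyact q x.
Proof.
elim/poly_ind: p q => [|p c IH] q; first by rewrite polyact0 !add0r.
elim/poly_ind: q => [|q d _]; first by rewrite polyact0 !addr0.
rewrite addrACA -mulrDl -polyCD !polyact_cons IH nablaD lconstD scalerDl.
by rewrite addrACA.
Qed.

Lemma polyactM p q x : polyact (p * q) x = polyact p (polyact q x).
Proof.
elim/poly_ind: p => [|p c IH]; first by rewrite mul0r !polyact0.
rewrite mulrDl mulrAC polyactDl polyactMX IH polyact_cons addrC; congr (_ + _).
elim/poly_ind: q {IH} => [|q d IHq]; first by rewrite mulr0 polyact0 scaler0.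
rewrite mulrDr mulrA -polyCM !polyact_cons IHq scalerDr scalerA -lconstM.
by rewrite nablaZ.
Qed.

Lemma polyactDr p x y : polyact p (x + y) = polyact p x + polyact p y.
Proof.
elim/poly_ind: p => [|p c IH]; first by rewrite !polyact0 addr0.
by rewrite !polyact_cons IH nablaD scalerDr addrACA.
Qed.

Lemma polyact_lconst p c x : polyact p (lconst c *: x) = lconst c *: polyact p x.
Proof. by rewrite -!polyactC -!polyactM mulrC. Qed.

Lemma polyactNl p x : polyact (- p) x = - polyact p x.
Proof. by apply: (addIr (polyact p x)); rewrite -polyactDl !addNr polyact0. Qed.

Lemma polyactBl p q x : polyact (p - q) x = polyact p x - polyact q x.
Proof. by rewrite polyactDl polyactNl. Qed.

Lemma polyactBr p x y : polyact p (x - y) = polyact p x - polyact p y.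
Proof. by apply: (addIr (polyact p y)); rewrite -polyactDr !subrK. Qed.

Lemma polyact1 x : polyact 1 x = x.
Proof. by rewrite polyactC scale1r. Qed.

Lemma polyactX x : polyact 'X x = nabla x.
Proof. by rewrite -['X]mul1r polyactMX polyact1. Qed.

Lemma polyact_nabla p x : polyact p (nabla x) = nabla (polyact p x).
Proof. by rewrite -!polyactX -!polyactM mulrC. Qed.

(** From [D z^j = z^j (D + j)]. *)
Lemma polyact_varz p (j : int) x :
  polyact p (lvar ^ j *: x) = lvar ^ j *: polyact (p \Po ('X + j%:~R%:P)) x.
Proof.
elim/poly_ind: p => [|p c IH]; first by rewrite comp_poly0 !polyact0 scaler0.
rewrite polyact_cons IH comp_polyD comp_polyM comp_polyX comp_polyC.
rewrite polyactDl polyactC scalerDr [RHS]addrC; congr (_ + _).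
  by rewrite !scalerA mulrC.
rewrite mulrDr polyactDl polyactMX [_ * _%:P]mulrC polyactM polyactC.
by rewrite nabla_varz addrC.
Qed.

End PolyAction.

(** * Operators given by symbols *)

(* A symbol phi stands for the operator sum_i z^i phi_i(D) on connections, where
   phi_i(nu) is the coefficient of z^i in phi(nu); on z^nu it is multiplication by
   phi(nu). *)
Definition symbol (k : fieldType) (phi : k -> laurent k) (a : int) : Prop :=
  (forall nu, vanish_below (phi nu) a) /\
  (forall i, exists p : {poly k}, forall nu, phi nu i = p.[nu]).

(** The polynomial [phi_i], determined by its values in characteristic zero; the default is 0 when
    there is none. *)
Definition scoef (k : fieldType) (phi : k -> laurent k) (i : int) : {poly k} :=
  match pselect (exists p : {poly k}, forall nu, phi nu i = p.[nu]) with
  | left h => projT1 (cid h) | right _ => 0 end.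

Section Symbols.
Variables (k : fieldType) (k_char0 : [pchar k] =i pred0).
Implicit Types (f : laurent k) (phi psi : k -> laurent k) (a b : int).

Lemma scoefE phi a i nu : symbol phi a -> phi nu i = (scoef phi i).[nu].
Proof. by case=> _ /(_ i) h; rewrite /scoef; case: pselect => // h'; case: (cid h'). Qed.

Lemma scoef_eq phi i p : (forall nu, phi nu i = p.[nu]) -> scoef phi i = p.
Proof.
move=> E; apply: (poly_ext k_char0) => nu; rewrite -E /scoef.
by case: pselect => [h|[]]; [case: (cid h)|exists p].
Qed.

Lemma scoef_below phi a i : symbol phi a -> i < a -> scoef phi i = 0.
Proof.
by move=> [pa _] ia; apply: scoef_eq => nu; rewrite horner0 (pa nu).
Qed.

Lemma symbol_le phi a b : b <= a -> symbol phi a -> symbol phi b.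
Proof. by move=> ba [h1 h2]; split => // nu; apply: below_le (h1 nu). Qed.

Lemma symbolD phi psi a : symbol phi a -> symbol psi a -> symbol (fun nu => phi nu + psi nu) a.
Proof.
move=> sp sq; split=> [nu|i]; first by apply: vanish_belowD; [case: sp | case: sq].
by exists (scoef phi i + scoef psi i) => nu; rewrite lcoefD hornerD -(scoefE _ _ sp) -(scoefE _ _ sq).
Qed.

Lemma symbolN phi a : symbol phi a -> symbol (fun nu => - phi nu) a.
Proof.
move=> sp; split=> [nu|i]; first by apply: vanish_belowN; case: sp.
by exists (- scoef phi i) => nu; rewrite lcoefN hornerN -(scoefE _ _ sp).
Qed.

Lemma symbolM f phi a b : vanish_below f b -> symbol phi a ->
  symbol (fun nu => f * phi nu) (b + a).
Proof.
move=> fb sp; have [pa _] := sp; split=> [nu|i]; first exact: lcoefM_below.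
case: (ltrP i (b + a)) => ia.
  by exists 0 => nu; rewrite horner0; apply: (@lcoefM_below _ _ _ b a).
have -> : i = b + a + `|(i - (b + a))%R|%N%:Z by lia.
set m := `|_|%N; exists (\sum_(j < m.+1) f (b + j%:Z) *: scoef phi (a + (m - j)%N%:Z)) => nu.
rewrite (lcoefM_sum m fb (pa nu)) horner_sum; apply: eq_bigr => j _.
by rewrite hornerZ -(scoefE _ nu sp).
Qed.

Lemma symbol_theta phi a : symbol phi a -> symbol (fun nu => theta (phi nu)) a.
Proof.
move=> sp; split=> [nu|i]; first by apply: theta_below; case: sp.
by exists (i%:~R *: scoef phi i) => nu; rewrite thetaE hornerZ -(scoefE _ nu sp).
Qed.

Lemma symbol_nu phi a : symbol phi a -> symbol (fun nu => lconst nu * phi nu) a.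
Proof.
move=> sp; split=> [nu|i].
  rewrite -[a]add0r; apply: lcoefM_below; [exact: vanish_below_const | by case: sp].
by exists ('X * scoef phi i) => nu; rewrite lcoef_lconstM hornerM hornerX -(scoefE _ nu sp).
Qed.

Lemma symbol_shift phi a c : symbol phi a -> symbol (fun nu => phi (nu + c)) a.
Proof.
move=> sp; split=> [nu|i]; first by case: sp.
exists (scoef phi i \Po ('X + c%:P)) => nu.
by rewrite horner_comp hornerD hornerX hornerC -(scoefE _ _ sp).
Qed.

End Symbols.

(** * The operator of a symbol on a connection with a stable lattice *)

Section Rho.
Variables (k : fieldType) (k_char0 : [pchar k] =i pred0).
Variables (R : connection k) (I : finType) (e : I -> R) (e_span : spanning e).
Hypothesis e_stable : forall i, filt e 0 (nabla (e i)).
Implicit Types (x y : R) (f g : laurent k) (a b n : int) (phi psi : k -> laurent k).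

Lemma filt_nabla n x : filt e n x -> filt e n (nabla x).
Proof.
move=> [c [cn ->]]; rewrite nabla_sum; apply: filt_sum => i _; rewrite nabla_leibniz.
apply: filtD; last by rewrite -[n]addr0; apply: filtZ.
exists (fun j => if j == i then theta (c i) else 0); split => [j|].
  by case: eqP => _; [exact: theta_below | exact: vanish_below0].
by rewrite (bigD1 i) //= eqxx big1 ?addr0 // => j /negPf->; rewrite scale0r.
Qed.

Lemma filt_polyact p n x : filt e n x -> filt e n (polyact p x).
Proof.
move=> xn; elim/poly_ind: p => [|p c IH]; first by rewrite polyact0; apply: filt0.
by rewrite polyact_cons; apply: filtD; [exact: filt_const | exact: filt_nabla].
Qed.

Definition rho_term phi x (i : int) : R := lvar ^ i *: polyact (scoef phi i) x.

Lemma filt_rho_term phi x n i : filt e n x -> filt e (i + n) (rho_term phi x i).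
Proof. by move=> xn; apply: filtZ; [exact: vanish_below_varz | exact: filt_polyact]. Qed.

(** Convergence of [sum_i z^i phi_i(D) x] to [y], tested on all windows of indices that contain
    [[-b, b)]. Letting both ends vary makes the notion insensitive to shifts of the index. *)
Definition rho_spec phi x y : Prop := forall n : int, exists b : int,
  forall a (N : nat), a <= - b -> b <= a + N%:Z ->
    filt e n (y - \sum_(i < N) rho_term phi x (a + i%:Z)).

Lemma rho_spec_uniq phi x y y' : rho_spec phi x y -> rho_spec phi x y' -> y = y'.
Proof.
move=> hy hy'; apply/eqP; rewrite -subr_eq0; apply/eqP.
apply: (filt_sep e_span) => n; have [b hb] := hy n; have [b' hb'] := hy' n.
pose a := - (`|b|%N%:Z + `|b'|%N%:Z).
pose N := ((`|b| + `|b'|).*2)%N.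
have := filtB (hb a N _ _) (hb' a N _ _).
rewrite opprB addrA subrK; apply; rewrite /a /N; lia.
Qed.

(** Polynomials in [D] preserve the filtration, so the terms tend to 0 and completeness gives the
    sum. *)
Lemma rho_spec_ex phi a x : symbol phi a -> exists y, rho_spec phi x y.
Proof.
move=> sp; have [d xd] := filt_ex x e_span.
have [|y hy] := @filt_complete _ _ _ e (a + d) (fun i => rho_term phi x (a + i%:Z)).
  by move=> i; rewrite addrAC; apply: filt_rho_term.
exists y => n; exists (`|a|%N%:Z + `|(n - a - d)%R|%N%:Z) => a' N le_a' le_N.
(* The first [a - a'] terms of the window vanish, because the symbol has no coefficient below
   [a]. *)
have [M NE] : exists M : nat, N = (`|(a - a')%R| + M)%N.
  by exists (N - `|(a - a')%R|)%N; lia.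
subst N.
rewrite big_split_ord /= big1 ?add0r => [|i _]; last first.
  by rewrite /rho_term (scoef_below k_char0 sp) ?polyact0 ?scaler0 //; case: i => i /=; lia.
have -> : \sum_(i < M) rho_term phi x (a' + (`|(a - a')%R| + i)%N%:Z)
          = \sum_(i < M) rho_term phi x (a + i%:Z).
  by apply: eq_bigr => i _; congr rho_term; lia.
by apply: filt_le (hy M); lia.
Qed.

Definition rho phi x : R :=
  match pselect (exists y, rho_spec phi x y) with
  | left h => projT1 (cid h) | right _ => 0 end.

Lemma rhoP phi a x : symbol phi a -> rho_spec phi x (rho phi x).
Proof.
by move=> /(rho_spec_ex x) h; rewrite /rho; case: pselect => // h'; case: (cid h').
Qed.

Lemma rhoE phi x y : rho_spec phi x y -> rho phi x = y.
Proof.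
move=> hy; apply: (rho_spec_uniq _ hy); rewrite /rho.
by case: pselect => [h|[]]; [case: (cid h)|exists y].
Qed.

Lemma rho_ext phi psi x : phi =1 psi -> rho phi x = rho psi x.
Proof. by move=> /funext ->. Qed.

Lemma rho_filt phi a n x : symbol phi a -> filt e n x -> filt e (a + n) (rho phi x).
Proof.
move=> sp xn; have [b hb] := rhoP x sp (a + n).
have := hb (- `|b|%N%:Z) (`|b|.*2) _ _; move/(_ ltac:(lia) ltac:(lia)).
apply: filt_sub; apply: filt_sum => i _; set j := _ + i%:Z.
case: (ltrP j a) => ja.
  by rewrite /rho_term (scoef_below k_char0 sp) // polyact0 scaler0; apply: filt0.
by apply: filt_le (filt_rho_term phi j xn); lia.
Qed.

Lemma rhoDr phi a x y : symbol phi a -> rho phi (x + y) = rho phi x + rho phi y.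
Proof.
move=> sp; apply: rhoE => n; have [b hb] := rhoP x sp n; have [b' hb'] := rhoP y sp n.
exists (`|b|%N%:Z + `|b'|%N%:Z) => a' N h1 h2.
have := filtD (hb a' N ltac:(lia) ltac:(lia)) (hb' a' N ltac:(lia) ltac:(lia)).
rewrite addrACA -opprD -big_split /=; set s := \sum_(i < N) _; set s' := \sum_(i < N) _.
suff -> : s = s' by [].
by apply: eq_bigr => i _; rewrite /rho_term polyactDr scalerDr.
Qed.

Lemma rhoDl phi psi a b x : symbol phi a -> symbol psi b ->
  rho (fun nu => phi nu + psi nu) x = rho phi x + rho psi x.
Proof.
move=> sp sq; apply: rhoE => n; have [b1 hb] := rhoP x sp n; have [b' hb'] := rhoP x sq n.
exists (`|b1|%N%:Z + `|b'|%N%:Z) => a' N h1 h2.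
have := filtD (hb a' N ltac:(lia) ltac:(lia)) (hb' a' N ltac:(lia) ltac:(lia)).
rewrite addrACA -opprD -big_split /=; set s := \sum_(i < N) _; set s' := \sum_(i < N) _.
suff -> : s = s' by [].
apply: eq_bigr => i _; rewrite /rho_term -scalerDr -polyactDl; congr (_ *: polyact _ _).
apply/esym/(scoef_eq k_char0) => nu.
by rewrite lcoefD hornerD -(scoefE _ _ sp) -(scoefE _ _ sq).
Qed.

(** An additive continuous [F] passes through the limit, so an identity of operators need only be
    checked on single terms. *)
Lemma rho_termwise phi psi a (F : R -> R) x y :
  symbol phi a -> {morph F : u v / u - v} ->
  (forall n, exists n', forall u, filt e n' u -> filt e n (F u)) ->
  (forall i, F (rho_term phi x i) = rho_term psi y i) ->
  rho psi y = F (rho phi x).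
Proof.
move=> sp FB Fcont Fterm; apply: rhoE => n; have [n' Fn] := Fcont n.
have [b hb] := rhoP x sp n'; exists b => a' N h1 h2.
have F0 : F 0 = 0 by have := FB 0 0; rewrite !subrr.
have FN u : F (- u) = - F u by rewrite -[- u]sub0r FB F0 sub0r.
have FD : {morph F : u v / u + v} by move=> u v; rewrite -[in LHS](opprK v) FB FN opprK.
have := Fn _ (hb a' N h1 h2); rewrite FB (big_morph _ FD F0).
by rewrite (eq_bigr _ (fun i _ => Fterm _)).
Qed.

Lemma rho_lconst phi a c x : symbol phi a -> rho phi (lconst c *: x) = lconst c *: rho phi x.
Proof.
move=> sp; apply: (rho_termwise (F := fun u => lconst c *: u) sp).
- by move=> u v; rewrite scalerBr.
- by move=> n; exists n => u; apply: filt_const.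
- by move=> i; rewrite /rho_term polyact_lconst !scalerA mulrC.
Qed.

(** [z^i phi_i(D) z^j = z^(i+j) phi_i(D + j)], so the terms agree once the window has moved by
    [j]. *)
Lemma rho_mulr phi a j x : symbol phi a ->
  rho phi (lvar ^ j *: x) = rho (fun nu => lvar ^ j * phi (nu + j%:~R)) x.
Proof.
move=> sp; apply/esym/rhoE => n.
have [b hb] := rhoP (lvar ^ j *: x) sp n; exists (`|b|%N%:Z + `|j|%N%:Z) => a' N h1 h2.
have := hb (a' - j) N ltac:(lia) ltac:(lia).
set s := \sum_(i < N) _; set s' := \sum_(i < N) _; suff -> : s = s' by [].
apply: eq_bigr => i _; rewrite /rho_term polyact_varz scalerA -expfzDr ?lvar_neq0 //.
have -> : a' - j + i%:Z + j = a' + i%:Z by lia.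
congr (_ *: polyact _ _); apply/esym/(scoef_eq k_char0) => nu.
rewrite lcoef_varzM horner_comp hornerD hornerX hornerC -(scoefE _ _ sp).
by congr (lcoef _ _); lia.
Qed.

Lemma rho_monomial phi a c j x : symbol phi a ->
  rho (fun nu => lconst c * lvar ^ j * phi nu) x = (lconst c * lvar ^ j) *: rho phi x.
Proof.
move=> sp; apply: rhoE => n.
have [b hb] := rhoP x sp (n - j); exists (`|b|%N%:Z + `|j|%N%:Z) => a' N h1 h2.
have := filt_const c (filtZ (@vanish_below_varz _ j) (hb (a' - j) N ltac:(lia) ltac:(lia))).
rewrite [j + _]addrC subrK scalerA scalerBr scaler_sumr.
set s := \sum_(i < N) _; set s' := \sum_(i < N) _; suff -> : s = s' by [].
apply: eq_bigr => i _; rewrite /rho_term scalerA mulrAC -mulrA -expfzDr ?lvar_neq0 //.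
have -> : a' - j + i%:Z + j = a' + i%:Z by lia.
rewrite [_ * lvar ^ _]mulrC -scalerA -polyactC -polyactM; congr (_ *: polyact _ _).
apply/esym/(scoef_eq k_char0) => nu.
rewrite -mulrA lcoef_lconstM lcoef_varzM hornerM hornerC -(scoefE _ _ sp).
by congr (_ * lcoef _ _); lia.
Qed.

(** Both sides are additive and continuous in [f], and [rho_monomial] settles monomials. *)
Lemma rho_mull phi a f x : symbol phi a -> rho (fun nu => f * phi nu) x = f *: rho phi x.
Proof.
move=> sp; apply/eqP; rewrite -subr_eq0; apply/eqP; move: f.
apply: (laurent_density (B := filt e)) => [y|f g|c i|n].
- exact: filt_sep.
- have [b fb] := lcoef_below f; have [b' gb] := lcoef_below g.
  rewrite scalerDl opprD addrACA; congr (_ + _).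
  rewrite -(rhoDl x (symbolM fb sp) (symbolM gb sp)); apply: rho_ext => nu.
  by rewrite mulrDl.
- by rewrite (rho_monomial _ _ _ sp) subrr.
- have [d xd] := filt_ex x e_span; exists (n - a - d) => f fb.
  apply: filtB.
    by have := rho_filt (symbolM fb sp) xd; apply: filt_le; lia.
  by have := filtZ fb (rho_filt sp xd); apply: filt_le; lia.
Qed.

Lemma rho_nabla phi a x : symbol phi a -> rho phi (nabla x) = rho (fun nu => lconst nu * phi nu) x.
Proof.
move=> sp; apply/esym; apply: (rho_termwise (F := id) sp) => // [n|i]; first by exists n.
rewrite /rho_term -polyactX -polyactM; congr (_ *: polyact _ _).
apply/esym/(scoef_eq k_char0) => nu.
by rewrite lcoef_lconstM hornerM hornerX mulrC -(scoefE _ _ sp).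
Qed.

(** [D z^i phi_i(D) = z^i (D + i) phi_i(D)]; the summand [i] produces [theta]. *)
Lemma nabla_rho phi a x : symbol phi a ->
  nabla (rho phi x) = rho (fun nu => lconst nu * phi nu + theta (phi nu)) x.
Proof.
move=> sp; apply/esym; apply: (rho_termwise sp) => [u v|n|i]; first exact: nablaB.
  by exists n => u; apply: filt_nabla.
rewrite /rho_term nabla_varz -polyactC -polyactX -!polyactM -polyactDl.
congr (_ *: polyact _ _); apply/esym/(scoef_eq k_char0) => nu.
by rewrite lcoefD lcoef_lconstM thetaE hornerD !hornerM hornerC hornerX -(scoefE _ _ sp) addrC.
Qed.

(** [1 - F] raises the filtration. An element of the kernel of [F] therefore lies in every step, and
    the Neumann series of [1 - F] converges to a preimage. *)
Lemma unipotent_bijective (F : R -> R) : {morph F : x y / x + y} ->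
  (forall n x, filt e n x -> filt e (n + 1) (F x - x)) ->
  injective F /\ (forall n y, filt e n y -> exists2 x, filt e n x & F x = y).
Proof.
move=> FD F1.
have F0 : F 0 = 0 by apply: (addIr (F 0)); rewrite -FD !add0r.
have FN u : F (- u) = - F u by apply: (addIr (F u)); rewrite -FD !addNr.
have Ffilt n x : filt e n x -> filt e n (F x).
  by move=> xn; apply: (filt_sub xn); apply: filt_le (F1 _ _ xn); lia.
split=> [x y Fxy|d y yd].
  apply/eqP; rewrite -subr_eq0; apply/eqP; set u := x - y.
  have Fu : F u = 0 by rewrite FD FN Fxy subrr.
  have [d ud] := filt_ex u e_span; apply: (filt_sep e_span) => n.
  case: (ltrP n d) => [nd|]; first by apply: filt_le ud; lia.
  elim/int_ind_le => // {}n _ un; have := F1 _ _ un.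
  by rewrite Fu sub0r => /filtN; rewrite opprK.
pose v i := iter i (fun z => z - F z) y.
have vd i : filt e (d + i%:Z) (v i).
  elim: i => [|i IH]; first by rewrite addr0.
  rewrite /v iterS -/(v i) -opprB; apply: filtN.
  by rewrite (_ : d + i.+1%:Z = d + i%:Z + 1); [exact: F1 | lia].
have [x hx] := filt_complete vd; exists x.
  by have := hx 0; rewrite addr0 big_ord0 subr0.
apply/eqP; rewrite -subr_eq0; apply/eqP; apply: (filt_sep e_span) => n.
pose N := `|(n - d)%R|%N.
have E : F (\sum_(i < N) v i) = y - v N.
  elim: N => [|N IH]; first by rewrite big_ord0 F0 subrr.
  have vS : v N.+1 = v N - F (v N) by [].
  by rewrite big_ord_recr FD IH vS opprB addrA addrAC.
have -> : F x - y = F (x - \sum_(i < N) v i) - v N.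
  rewrite FD FN E opprB -[RHS]addrA; congr (_ + _).
  by rewrite [v N - y]addrC addrK.
apply: (@filt_le _ _ _ _ (d + N%:Z)); first by rewrite /N; lia.
by apply: filtB => //; apply: Ffilt.
Qed.

End Rho.

(** * The operator c^D *)

Section Interpolation.
Variable k : fieldType.
Implicit Types (p q u : {poly k}) (S T : seq k).

Lemma coprimep_XsubC_exp_prod S mu n : mu \notin S ->
  coprimep (\prod_(l <- S) ('X - l%:P) ^+ n) (('X - mu%:P) ^+ n).
Proof.
move=> muS; apply: coprimep_expr; rewrite coprimep_XsubC; apply/rootP/eqP.
rewrite horner_prod prodf_seq_neq0; apply/allP => l lS /=.
rewrite horner_exp hornerXsubC expf_neq0 // subr_eq0.
by apply: contraNneq muS => ->.
Qed.

Lemma prod_XsubC_exp_dvdp S n u : uniq S ->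
  (forall mu, mu \in S -> ('X - mu%:P) ^+ n %| u) -> \prod_(l <- S) ('X - l%:P) ^+ n %| u.
Proof.
elim: S => [_ _|mu S IH /= /andP[muS uS] hu]; first by rewrite big_nil dvd1p.
rewrite big_cons Gauss_dvdp; last by rewrite coprimep_sym coprimep_XsubC_exp_prod.
rewrite hu ?mem_head //= IH // => l lS; apply: hu; exact: mem_behead.
Qed.

(** Multiplicities in [S] are at most [size S], so one common exponent suffices. *)
Lemma prod_XsubC_dvdp S u : (forall mu, mu \in S -> ('X - mu%:P) ^+ size S %| u) ->
  \prod_(l <- S) ('X - l%:P) %| u.
Proof.
move=> hu; apply: (@dvdp_trans _ (\prod_(l <- undup S) ('X - l%:P) ^+ size S)).
  rewrite -[X in X %| _]prodr_undup_exp_count.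
  elim/big_ind2: _ => // [p p' q q' pp' qq'|l _]; first exact: dvdp_mul.
  by apply: dvdp_exp2l; apply: count_size.
by apply: prod_XsubC_exp_dvdp; rewrite ?undup_uniq // => l; rewrite mem_undup => /hu.
Qed.

(* For such q, q(D) is multiplication by chi mu on the part of the generalized
   eigenspace of D for mu killed by (D - mu)^n. *)
Definition close_to (chi : k -> k) S (n : nat) q : Prop :=
  forall mu, mu \in S -> ('X - mu%:P) ^+ n %| q - (chi mu)%:P.

(** Chinese remainder theorem, one point at a time; a repeated point imposes the same condition
    again. *)
Lemma close_to_ex chi S n : exists q, close_to chi S n q.
Proof.
elim: S => [|mu S [q hq]]; first by exists 0.
have [muS|muS] := boolP (mu \in S).
  by exists q => l; rewrite inE => /orP[/eqP->|]; apply: hq.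
set G := \prod_(l <- S) ('X - l%:P) ^+ n.
have /Bezout_eq1_coprimepP[[a b] /= ab] := coprimep_XsubC_exp_prod n muS.
(* By Bezout [a * G] is 1 modulo [(X - mu)^n], and it is 0 modulo [(X - l)^n] for [l] in [S], so the
   correction changes only the value at [mu]. *)
rewrite -/G in ab; exists (q + ((chi mu)%:P - q) * (a * G)) => l.
rewrite inE => /orP[/eqP->|lS].
  have -> : q + ((chi mu)%:P - q) * (a * G) - (chi mu)%:P
            = (q - (chi mu)%:P) * b * ('X - mu%:P) ^+ n.
    have -> : a * G = 1 - b * ('X - mu%:P) ^+ n by rewrite -ab addrK.
    ring.
  exact: dvdp_mulIr.
rewrite addrAC dvdp_add ?hq // mulrA dvdp_mull // /G (big_rem l) //=.
exact: dvdp_mulIl.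
Qed.

Lemma close_toS chi S S' n n' q : {subset S <= S'} -> (n <= n')%N ->
  close_to chi S' n' q -> close_to chi S n q.
Proof.
by move=> SS' nn' hq mu /SS' /hq; apply: dvdp_trans; apply: dvdp_exp2l.
Qed.

Lemma close_to_sub chi S n q q' : close_to chi S n q -> close_to chi S n q' ->
  forall mu, mu \in S -> ('X - mu%:P) ^+ n %| q - q'.
Proof.
move=> hq hq' mu muS; have -> : q - q' = (q - (chi mu)%:P) - (q' - (chi mu)%:P).
  by rewrite opprB addrA subrK.
by rewrite dvdp_sub ?hq ?hq'.
Qed.

(** Choose a representative in each coset of the integers in [k], and let [chi mu = c^n] when [mu]
    is its representative plus [n]; in characteristic zero [n] is unique. *)
Lemma equivariant_function (k_char0 : [pchar k] =i pred0) (c : k) : c != 0 ->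
  exists chi : k -> k, (forall mu, chi mu != 0) /\ (forall mu, chi (mu + 1) = c * chi mu).
Proof.
move=> c0; pose cls (mu : k) : set k := [set l | exists n : int, mu = l + n%:~R]%classic.
pose rep mu := xget 0 (cls mu).
have repP mu : exists n : int, mu = rep mu + n%:~R.
  by apply: (@xgetI _ 0 (cls mu) mu); exists 0; rewrite addr0.
have [deg degE] := choice repP.
have repS mu : rep (mu + 1) = rep mu.
  rewrite /rep; congr (xget 0 _); apply/seteqP; split => l [n nE]; [exists (n - 1)|exists (n + 1)].
    by rewrite intrB addrA -nE addrK.
  by rewrite intrD addrA -nE.
exists (fun mu => c ^ deg mu); split=> mu; first exact: expfz_neq0.
have -> : deg (mu + 1) = deg mu + 1; last by rewrite expfzDr // mulrC.
apply: (intr_inj_char0 k_char0); rewrite intrD; apply: (addrI (rep mu)).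
by rewrite addrA -degE -{1}(repS mu) -degE.
Qed.

End Interpolation.

(* Algebraic closedness, as a property of a bare fieldType. *)
Definition monic_split (k : fieldType) : Prop :=
  forall p : {poly k}, p \is monic -> exists s : seq k, p = \prod_(l <- s) ('X - l%:P).

(** * Local finiteness of the derivation and limits of polynomials in it *)

Section Scaling.
Variables (k : fieldType) (k_char0 : [pchar k] =i pred0) (k_split : monic_split k).
Variables (R : connection k) (I : finType) (e : I -> R) (e_span : spanning e).
Hypothesis e_stable : forall i, filt e 0 (nabla (e i)).
Implicit Types (x y : R) (f g : laurent k) (a b n : int) (p q u : {poly k}) (S : seq k).

(** [D] acts [k]-linearly on the finite dimensional space [L / zL]. Cayley-Hamilton for a matrix of
    this action gives a monic polynomial, which splits over [k]. *)
Lemma residue_annihilator :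
  exists s : seq k, forall x, filt e 0 x -> filt e 1 (polyact (\prod_(l <- s) ('X - l%:P)) x).
Proof.
(* The extra generator 0 keeps the matrix size positive when [I] is empty, as the ring of matrices
   requires. *)
pose e' (j : 'I_#|I|.+1) : R := oapp (fun i => e (enum_val i)) 0 (unlift ord0 j).
have filt_e' j : filt e 0 (e' j).
  rewrite /e'; case: (unlift ord0 j) => [i|] /=; last exact: filt0.
  exists (fun j => if j == enum_val i then 1 else 0); split => [j'|].
    by case: eqP => _; [exact: vanish_below_const | exact: vanish_below0].
  by rewrite (bigD1 (enum_val i)) //= eqxx scale1r big1 ?addr0 // => j' /negPf->; rewrite scale0r.
pose val (v : 'rV[k]_#|I|.+1) : R := \sum_j lconst (v 0 j) *: e' j.
have red x : filt e 0 x -> exists v, filt e 1 (x - val v).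
  move=> [c [c0 ->]].
  exists (\row_j oapp (fun i => c (enum_val i) 0) 0 (unlift ord0 j)).
  exists (fun i => c i - lconst (c i 0)); split => [i n n1|].
    by rewrite lcoefB lconstE; case: eqP => [->|/eqP n0]; rewrite ?subrr // c0 ?subr0 //; lia.
  rewrite /val big_ord_recl /e' unlift_none /= scaler0 add0r.
  under [RHS]eq_bigr do rewrite scalerBl; rewrite sumrB; congr (_ - _).
  rewrite [RHS](reindex (@enum_val I predT)) /=; last exact/onW_bij/enum_val_bij.
  by apply: eq_bigr => i _; rewrite mxE liftK.
(* The [e' j] may be dependent modulo [zL], so [M] is one choice among the matrices that describe
   [D] there. *)
have [A hA] := choice (fun j => red _ (filt_nabla e_stable (filt_e' j))).
pose M : 'M[k]_#|I|.+1 := \matrix_(i, j) A i 0 j.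
have valD v w : val (v + w) = val v + val w.
  rewrite /val -big_split; apply: eq_bigr => j _.
  by rewrite mxE lconstD scalerDl.
have valZ c v : val (c *: v) = lconst c *: val v.
  rewrite /val scaler_sumr; apply: eq_bigr => j _.
  by rewrite mxE lconstM scalerA.
have val0 : val 0 = 0.
  by rewrite /val big1 // => j _; rewrite mxE lconst0 scale0r.
have nabla_val v : filt e 1 (nabla (val v) - val (v *m M)).
  have -> : val (v *m M) = \sum_j lconst (v 0 j) *: val (A j).
    rewrite /val; under [RHS]eq_bigr do rewrite scaler_sumr.
    rewrite exchange_big; apply: eq_bigr => j _ /=; rewrite mxE.
    rewrite (big_morph _ (@lconstD k) (lconst0 k)) scaler_suml.
    by apply: eq_bigr => i _; rewrite mxE lconstM scalerA.
  rewrite nabla_sum -sumrB; apply: filt_sum => j _.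
  by rewrite nablaZ -scalerBr; apply: filt_const.
have poly_val p v : filt e 1 (polyact p (val v) - val (v *m horner_mx M p)).
  elim/poly_ind: p => [|p c IH].
    rewrite polyact0 rmorph0 mulmx0 sub0r; apply: filtN.
    by rewrite val0; apply: filt0.
  rewrite polyact_cons rmorphD rmorphM /= horner_mx_X horner_mx_C mulmxDr.
  rewrite -mulmxE mulmxA mul_mx_scalar valD valZ [X in X - _]addrC opprD addrACA subrr addr0.
  have := filtD (nabla_val (v *m horner_mx M p)) (filt_nabla e_stable IH).
  by rewrite nablaB [X in filt _ _ X -> _]addrC addrA subrK.
have [s Es] := k_split (char_poly_monic M).
exists s => x x0; have [v hv] := red x x0.
have := poly_val (char_poly M) v.
rewrite Cayley_Hamilton mulmx0 val0 subr0.
rewrite Es; set P := \prod_(l <- s) _ => h.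
have := filtD h (filt_polyact e_stable P hv).
by rewrite polyactBr [X in filt _ _ X -> _]addrC subrK.
Qed.

(** On [z^j L / z^(j+1) L] the annihilator of the residue acts with its roots shifted by [j].
    Finitely many such factors bring [x] into [z^n L]. *)
Lemma locally_finite x n : exists S (m : nat),
  forall u, (forall mu, mu \in S -> ('X - mu%:P) ^+ m %| u) -> filt e n (polyact u x).
Proof.
have [d xd] := filt_ex x e_span; have [s hs] := residue_annihilator.
have step j y : filt e j y ->
    filt e (j + 1) (polyact (\prod_(l <- [seq l + j%:~R | l <- s]) ('X - l%:P)) y).
  move=> yj; have -> : y = lvar ^ j *: (lvar ^ (- j) *: y).
    by rewrite scalerA -expfzDr ?lvar_neq0 // subrr expr0z scale1r.
  rewrite polyact_varz rmorph_prod big_map.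
  under eq_bigr do rewrite /= comp_polyB comp_polyX comp_polyC polyCD opprD addrACA subrr addr0.
  apply: filtZ; first exact: vanish_below_varz.
  by apply: hs; have := filtZ (@vanish_below_varz _ (- j)) yj; rewrite addNr.
have [T hT] : exists T, filt e (d + `|(n - d)%R|%N%:Z) (polyact (\prod_(l <- T) ('X - l%:P)) x).
  elim: `|_|%N => [|N [T IH]]; first by exists [::]; rewrite big_nil polyact1 addr0.
  exists ([seq l + (d + N%:Z)%:~R | l <- s] ++ T); rewrite big_cat polyactM.
  by have := step _ _ IH; apply: filt_le; lia.
exists T, (size T) => u /prod_XsubC_dvdp /dvdpP [q ->]; rewrite polyactM.
by apply: filt_polyact => //; apply: filt_le hT; lia.
Qed.

(* y = chi(D) x, the limit of q(D) x as q gets close to chi on larger and larger S. *)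
Definition sigma_spec chi x y : Prop :=
  forall n, exists S m, forall q, close_to chi S m q -> filt e n (y - polyact q x).

Lemma close_to2 chi S1 S2 m1 m2 q : close_to chi (S1 ++ S2) (m1 + m2)%N q ->
  close_to chi S1 m1 q /\ close_to chi S2 m2 q.
Proof.
move=> hq; split; apply: close_toS hq; rewrite ?leq_addr ?leq_addl // => l lS.
  by rewrite mem_cat lS.
by rewrite mem_cat lS orbT.
Qed.

Lemma sigma_uniq chi x y y' : sigma_spec chi x y -> sigma_spec chi x y' -> y = y'.
Proof.
move=> hy hy'; apply/eqP; rewrite -subr_eq0; apply/eqP; apply: (filt_sep e_span) => n.
have [S [m h]] := hy n; have [S' [m' h']] := hy' n.
have [q /close_to2[/h hq /h' hq']] := close_to_ex chi (S ++ S') (m + m').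
by have := filtB hq hq'; rewrite opprB addrA subrK.
Qed.

(** The [q i] give a Cauchy sequence: consecutive ones agree well enough near [S i] for local
    finiteness to put the difference in [z^i L]. *)
Lemma sigma_ex chi x : exists y, sigma_spec chi x y.
Proof.
have [S /choice[m kill]] := choice (fun i : nat => locally_finite x i%:Z).
(* [T i] and [M i] collect the requirements of all levels up to [i], so that [q i] meets each of
   them. *)
pose T i := flatten [seq S j | j <- iota 0 i.+1]; pose M i := (\sum_(j < i.+1) m j)%N.
have [q hq] := choice (fun i => close_to_ex chi (T i) (M i)).
have close_q i j : (j <= i)%N -> close_to chi (S j) (m j) (q i).
  move=> le_ji; apply: close_toS (hq i) => [l lS|].
    by apply/flattenP; exists (S j) => //; apply: map_f; rewrite mem_iota.
  by rewrite /M (bigD1 (inord j)) //= inordK // leq_addr.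
have [|y hy] := @filt_complete _ _ _ e 0 (fun i => polyact (q i.+1 - q i) x).
  by move=> i; rewrite add0r; apply: kill; apply: close_to_sub; apply: close_q.
exists (y + polyact (q 0) x) => n; exists (S `|n|%N), (m `|n|%N) => q' hq'.
have := hy `|n|%N; rewrite add0r => hyn.
have tele N : \sum_(i < N) polyact (q i.+1 - q i) x = polyact (q N) x - polyact (q 0) x.
  elim: N => [|N IH]; first by rewrite big_ord0 subrr.
  by rewrite big_ord_recr IH /= polyactBl addrC addrA subrK.
apply: (@filt_le _ _ _ _ `|n|%N%:Z); first lia.
have := filtD hyn (kill _ _ (close_to_sub (close_q _ _ (leqnn _)) hq')).
by rewrite tele polyactBl opprB addrA addrA subrK.
Qed.

(* sigma = c^D. It exists for every regular connection, whose structure need not be known. *)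
Lemma scaling_operator (c : k) : c != 0 ->
  exists sigma : R -> R,
  [/\ {morph sigma : x y / x + y}, forall (a : k) x, sigma (lconst a *: x) = lconst a *: sigma x,
      forall x, sigma (lvar *: x) = (lconst c * lvar) *: sigma x,
      forall x, sigma (nabla x) = nabla (sigma x) &
      injective sigma /\ forall n y, filt e n y -> exists2 x, filt e n x & sigma x = y]
  /\ forall n x, filt e n x -> filt e n (sigma x).
Proof.
move=> c0; have [chi [chi0 chiS]] := equivariant_function k_char0 c0.
have [sigma hs] := choice (sigma_ex chi).
have [sigma' hs'] := choice (sigma_ex (fun mu => (chi mu)^-1)).
have filt_spec ch x y n : sigma_spec ch x y -> filt e n x -> filt e n y.
  move=> h xn; have [S [m hm]] := h n; have [q /hm hq] := close_to_ex ch S m.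
  by apply: filt_sub hq; apply: filt_polyact.
(* If [q] approximates [ch] and [q'] its inverse, then [q' q - 1] is divisible by high powers of the
   relevant factors, and local finiteness sends [x] into [z^n L]. *)
have inv_spec ch ch' x y z : (forall mu, ch' mu * ch mu = 1) ->
    sigma_spec ch x y -> sigma_spec ch' y z -> z = x.
  move=> chK hxy hyz; apply/eqP; rewrite -subr_eq0; apply/eqP; apply: (filt_sep e_span) => n.
  have [S1 [m1 h1]] := hxy n; have [S2 [m2 h2]] := hyz n.
  have [S3 [m3 h3]] := locally_finite x n.
  have [q /close_to2[/h1 hq1 hq3]] := close_to_ex ch (S1 ++ S3) (m1 + m3).
  have [q' /close_to2[/h2 hq2 hq3']] := close_to_ex ch' (S2 ++ S3) (m2 + m3).
  have h : filt e n (polyact (q' * q - 1) x).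
    apply: h3 => mu muS.
    have -> : q' * q - 1 = q' * (q - (ch mu)%:P) + (ch mu)%:P * (q' - (ch' mu)%:P).
      have -> : 1 = (ch' mu)%:P * (ch mu)%:P by rewrite -polyCM chK.
      ring.
    by rewrite dvdp_add // dvdp_mull ?hq3 ?hq3'.
  have := filtD (filtD hq2 (filt_polyact e_stable q' hq1)) h.
  by rewrite polyactBr polyactBl polyactM polyact1 !addrA !subrK.
exists sigma; split; first split.
- move=> x y; apply: (sigma_uniq (hs _)) => n.
  have [S [m h]] := hs x n; have [S' [m' h']] := hs y n.
  exists (S ++ S'), (m + m')%N => q /close_to2[/h hq /h' hq'].
  by have := filtD hq hq'; rewrite addrACA -opprD polyactDr.
- move=> a x; apply: (sigma_uniq (hs _)) => n; have [S [m h]] := hs x n.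
  by exists S, m => q /h /(filt_const a); rewrite scalerBr polyact_lconst.
- move=> x; apply: (sigma_uniq (hs _)) => n; have [S [m h]] := hs x n.
  exists [seq l + 1 | l <- S], m => q hq.
  (* Since [chi (mu + 1) = c * chi mu], a [q] close to [chi] at [mu + 1] yields [c^-1 q(X + 1)]
     close to it at [mu]. This matches [q(D) z = z q(D + 1)]. *)
  have hq' : close_to chi S m (c^-1 *: (q \Po ('X + 1%:P))).
    move=> mu muS; have := hq (mu + 1) (map_f _ muS).
    move=> /(dvdp_comp_poly ('X + 1%:P)); rewrite rmorphXn /= !comp_polyB !comp_polyC comp_polyX.
    rewrite polyCD opprD addrACA subrr addr0 chiS => hd.
    have -> : c^-1 *: (q \Po ('X + 1%:P)) - (chi mu)%:P
            = c^-1 *: (q \Po ('X + 1%:P) - (c * chi mu)%:P).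
      by rewrite scalerBr -[X in _ = _ - X]mul_polyC -polyCM mulKf.
    by rewrite dvdpZr ?invr_eq0.
  have := filtZ (@vanish_below_varz _ 1) (filt_const c (h _ hq')).
  move=> /(filt_le (_ : n <= 1 + n)) -/(_ ltac:(lia)).
  rewrite !scalerBr -[lvar in polyact _ (lvar *: _)]expr1z.
  rewrite polyact_varz !expr1z scalerA [lvar * _]mulrC.
  by rewrite -[lconst c *: polyact _ _]polyactC -polyactM mul_polyC scalerA mulfV // scale1r.
- move=> x; apply: (sigma_uniq (hs _)) => n; have [S [m h]] := hs x n.
  by exists S, m => q /h /(filt_nabla e_stable); rewrite nablaB polyact_nabla.
- split=> [x y Exy|n y yn].
    rewrite -(inv_spec _ _ _ _ _ (fun mu => mulVf (chi0 mu)) (hs x) (hs' _)) Exy.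
    exact: (inv_spec _ _ _ _ _ (fun mu => mulVf (chi0 mu)) (hs y) (hs' _)).
  exists (sigma' y); first exact: filt_spec (hs' y) yn.
  exact: (inv_spec _ _ _ _ _ (fun mu => mulfV (chi0 mu)) (hs' y) (hs _)).
- by move=> n x; apply: filt_spec (hs x).
Qed.

End Scaling.

(** * Changes of coordinate *)

Section Substitution.
Variable k : fieldType.
Implicit Types (f g u : laurent k) (a n i : int).

(** [u^i] has order [i], so degree [n] meets only exponents [i <= n]. The bound [N] is left free so
    that several series can share one range. *)
Lemma lcomp_sum f u a (N : nat) n : has_order u 1 -> vanish_below f a -> n < a + N%:Z ->
  lcomp f u n = \sum_(i < N) f (a + i%:Z) * (u ^ (a + i%:Z)) n.
Proof.
move=> u1 fa lt_n.
have vb i m : m < i -> (u ^ i) m = 0 by move=> lt_m; have [_ ->] := has_order_expz i u1.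
rewrite /lcomp (@mklaurentE _ _ a); last first.
  move=> m ma; apply: fsbig1 => i _; case: (ltrP i a) => ia; first by rewrite fa ?mul0r.
  by rewrite vb ?mulr0 //; lia.
pose s := [seq a + j%:Z | j <- iota 0 N].
rewrite (fsbigTE [fset x | x in s]%fset) /=; last first.
  move=> i is_; case: (ltrP i a) => ia; first by rewrite fa ?mul0r.
  case: (ltrP n i) => im; first by rewrite vb ?mulr0.
  suff s_i : i \in s by move: is_; rewrite in_fset /= s_i.
  apply/mapP; exists (absz (i - a)); last by lia.
  by rewrite mem_iota; lia.
have us : uniq s by rewrite map_inj_uniq ?iota_uniq // => x y; lia.
rewrite (perm_big s) /=; last first.
  by apply: uniq_perm; rewrite ?fset_uniq // => x; rewrite in_fset.
rewrite big_map -[RHS](big_mkord xpredT (fun i : nat => f (a + i%:Z) * (u ^ (a + i%:Z)) n)).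
by rewrite /index_iota subn0.
Qed.

Lemma lcomp_below f u a : has_order u 1 -> vanish_below f a -> vanish_below (lcomp f u) a.
Proof. by move=> u1 fa n na; rewrite (lcomp_sum (N := 0) u1 fa) ?big_ord0 ?addr0. Qed.

Lemma lcomp_lead f u a : has_order u 1 -> vanish_below f a -> lcomp f u a = f a * (u ^ a) a.
Proof.
move=> u1 fa; rewrite (lcomp_sum (N := 1) u1 fa); last lia.
by rewrite big_ord_recl big_ord0 /= !addr0.
Qed.

Lemma lcomp_order f u a : has_order u 1 -> has_order f a -> has_order (lcomp f u) a.
Proof.
move=> u1 [f0 fa]; split; last exact: lcomp_below.
by rewrite lcomp_lead // mulf_neq0 //; have [] := has_order_expz a u1.
Qed.

Lemma lcompD f g u : has_order u 1 -> lcomp (f + g) u = lcomp f u + lcomp g u.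
Proof.
move=> u1; apply: laurentP => n; rewrite lcoefD.
have [a fa] := lcoef_below f; have [b gb] := lcoef_below g.
pose c := - (`|a|%N%:Z + `|b|%N%:Z).
have fc : vanish_below f c by apply: below_le fa; rewrite /c; lia.
have gc : vanish_below g c by apply: below_le gb; rewrite /c; lia.
have nN : n < c + `|(n - c)%R|.+1%:Z by lia.
rewrite (lcomp_sum u1 fc nN) (lcomp_sum u1 gc nN) (lcomp_sum u1 (vanish_belowD fc gc) nN).
by rewrite -big_split; apply: eq_bigr => i _; rewrite lcoefD mulrDl.
Qed.

Lemma lcomp_monomial (c : k) i u : has_order u 1 ->
  lcomp (lconst c * lvar ^ i) u = lconst c * u ^ i.
Proof.
move=> u1; apply: laurentP => n; rewrite lcoef_lconstM.
have ME m : (lconst c * lvar ^ i) m = if m == i then c else 0.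
  by rewrite lcoef_lconstM lcoef_varX; case: eqP; rewrite ?mulr1 ?mulr0.
move: (lconst c * lvar ^ i) ME => M ME.
have vb : vanish_below M i by move=> m mi; rewrite ME; case: eqP mi => // ->; rewrite ltxx.
case: (ltrP n i) => ni.
  by rewrite (lcomp_below u1 vb) // (proj2 (has_order_expz i u1)) ?mulr0.
rewrite (lcomp_sum (N := `|(n - i)%R|.+1) u1 vb); last lia.
rewrite big_ord_recl big1 => [|j _]; last first.
  rewrite ME; case: eqP => [E|_]; last by rewrite mul0r.
  by move: E; rewrite /= /bump /=; lia.
have -> : i + (ord0 : 'I_`|(n - i)%R|.+1)%:Z = i by rewrite addr0.
by rewrite ME eqxx addr0.
Qed.

Lemma lcomp_lvar f : lcomp f lvar = f.
Proof.
apply: laurentP => n; have [a fa] := lcoef_below f.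
case: (ltrP n a) => na; first by rewrite (lcomp_below (has_order_lvar k) fa) ?fa.
rewrite (lcomp_sum (N := `|(n - a)%R|.+1) (has_order_lvar k) fa); last lia.
rewrite big_ord_recr big1 => [|j _]; last first.
  by rewrite lcoef_varX; case: eqP; rewrite ?mulr0 //; case: j => j /=; lia.
rewrite /= add0r lcoef_varX; have -> : a + `|(n - a)%R|%N%:Z = n by lia.
by rewrite eqxx mulr1.
Qed.

End Substitution.

(** * First-order linear equations and powers of a series *)

Section LinearODE.
Variables (k : fieldType) (k_char0 : [pchar k] =i pred0).
Implicit Types (f g h u : laurent k).

(** In the lowest degree [a] of a nonzero difference [d] the equation reads [a * d_a = 0], so
    [a = 0], against [f 0 = g 0]. *)
Lemma ode_unique h f g : vanish_below h 1 -> vanish_below f 0 -> vanish_below g 0 ->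
  f 0 = g 0 -> theta f = h * f -> theta g = h * g -> f = g.
Proof.
move=> h1 f0 g0 fg0 fE gE; apply/eqP; rewrite -subr_eq0; apply/negPn/negP => d0.
have [a [da0 da]] := has_order_ex d0.
have dE : theta (f - g) = h * (f - g) by rewrite thetaD thetaN fE gE mulrBr.
have := lcoefM_below h1 da; rewrite -dE => /(_ a) /(_ ltac:(lia)) /eqP.
rewrite thetaE mulf_eq0 (negPf da0) orbF (intr_eq0_char0 k_char0) => /eqP a0.
by move: da0; rewrite a0 lcoefB fg0 subrr eqxx.
Qed.

(* psi(nu) = u^nu for the series u with u(0) = 1 and theta u = h u. *)
Lemma power_symbol h : vanish_below h 1 -> exists psi : k -> laurent k,
  [/\ symbol psi 0, forall nu, psi nu 0 = 1 &
      forall nu, theta (psi nu) = lconst nu * h * psi nu].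
Proof.
move=> h1.
(* Degree [n] of the equation is [n P_n = nu * sum_(j < n) h_(n-j) P_j], whence [P_n] is a
   polynomial in [nu]. *)
pose G n (P : nat -> {poly k}) : {poly k} := if n is 0 then 1 else
  n%:R^-1 *: ('X * \sum_(j < n) h (n - j)%N%:Z *: P j).
have [|P PE] := @course_of_values _ 0 G.
  move=> [|n] P Q PQ //=; congr (_ *: (_ * _)); apply: eq_bigr => j _; by rewrite PQ.
have vb nu : vanish_below (fun n : int => if n < 0 then 0 else (P `|n|%N).[nu]) 0.
  by move=> n n0; rewrite n0.
pose psi nu := Laurent (ex_intro _ _ (vb nu)).
have psi0 nu : vanish_below (psi nu) 0 := vb nu.
exists psi; split.
- split=> // i; case: (ltrP i 0) => i0.
    by exists 0 => nu; rewrite horner0; apply: psi0.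
  by exists (P `|i|%N) => nu; rewrite /= ltNge i0.
- by move=> nu; rewrite /= PE /= hornerC.
move=> nu; rewrite -mulrA [h * _]mulrC; apply: laurentP => n.
rewrite thetaE lcoef_lconstM; have h0 : vanish_below h 0 by apply: below_le h1.
case: (ltrP n 0) => n0.
  by rewrite (psi0 nu) // (@lcoefM_below _ _ _ 0 0) ?mulr0.
have -> : n = 0 + 0 + `|n|%N%:Z by lia.
rewrite (lcoefM_sum _ (psi0 nu) h0) !add0r big_ord_recr /= subnn [h _]h1 // mulr0 addr0.
case: `|n|%N => [|m]; first by rewrite mul0r big_ord0 mulr0.
rewrite PE /= hornerZ hornerM hornerX horner_sum mulrA mulfV ?mul1r; last first.
  by rewrite -pmulrn (natr_eq0_char0 k_char0).
by congr (_ * _); apply: eq_bigr => j _; rewrite hornerZ add0r mulrC.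
Qed.

Lemma logder_below u : has_order u 0 -> vanish_below (theta u / u) 1.
Proof.
move=> u0; rewrite -[1]subr0; apply: lcoefM_below; last by have [] := has_orderV u0.
move=> n n1; rewrite thetaE; case: (ltrP n 0) => n0; first by rewrite (proj2 u0) ?mulr0.
have -> : n = 0 by lia.
by rewrite mul0r.
Qed.

(** The root is [v^(1/m)] from [power_symbol]: its [m]-th power solves the same equation as [v],
    with the same constant term. *)
Lemma root_series (m : nat) (v : laurent k) : (0 < m)%N -> vanish_below v 0 -> v 0 = 1 ->
  exists g, [/\ vanish_below g 0, g 0 = 1 & g ^+ m = v].
Proof.
move=> m0 vb v1; have v0 : has_order v 0 by split; rewrite ?v1 ?oner_eq0.
have h1 := logder_below v0; have [psi [[psib _] psi1 psiE]] := power_symbol h1.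
exists (psi m%:R^-1); split => //.
have [gb g1] := lcoefX_lead m (psib m%:R^-1); rewrite mul0r in gb g1.
apply: (@ode_unique (theta v / v)) => //; first by rewrite g1 psi1 expr1n.
  rewrite thetaX psiE lconstV lconst_nat.
  have mz : (m%:R : laurent k) != 0.
    by rewrite -lconst_nat lconst_eq0 (natr_eq0_char0 k_char0) -lt0n.
  case: m m0 mz {gb g1} => // m _ mz; rewrite exprS /=; field.
  by rewrite (has_order_neq0 v0) -mulrS.
by rewrite divfK // (has_order_neq0 v0).
Qed.

End LinearODE.

Definition filt_iso (k : fieldType) (R : connection k) (I : finType) (e : I -> R)
    (F : R -> R) : Prop :=
  [/\ {morph F : x y / x + y}, injective F,
      forall n x, filt e n x -> filt e n (F x) &
      forall n y, filt e n y -> exists2 x, filt e n x & F x = y].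

(** * Extension of a substitution to a regular connection *)

Section CoordinateChange.
Variables (k : fieldType) (k_char0 : [pchar k] =i pred0) (k_split : monic_split k).
Variables (R : connection k) (I : finType) (e : I -> R) (e_span : spanning e).
Hypothesis e_stable : forall i, filt e 0 (nabla (e i)).
Implicit Types (x y : R) (f g u : laurent k) (a n : int).

Lemma filt_iso_comp F G : filt_iso e F -> filt_iso e G -> filt_iso e (F \o G).
Proof.
move=> [FD Finj Ff Fs] [GD Ginj Gf Gs]; split => [x y|x y|n x xn|n z zn] /=.
- by rewrite GD FD.
- by move=> /Finj /Ginj.
- by apply: Ff; apply: Gf.
- by have [y yn <-] := Fs _ _ zn; have [x xn <-] := Gs _ _ yn; exists x.
Qed.

(** With [phi_0 = 1] and no negative degrees, the operator is the identity plus terms that raise the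
    filtration. *)
Lemma rho_filt_iso phi : symbol phi 0 -> (forall nu, phi nu 0 = 1) -> filt_iso e (rho e phi).
Proof.
move=> sp phi1; have FD x y : rho e phi (x + y) = rho e phi x + rho e phi y.
  exact: (rhoDr k_char0 e_span e_stable _ _ sp).
have unip n x : filt e n x -> filt e (n + 1) (rho e phi x - x).
  move=> xn; have [b hb] := rhoP k_char0 e_span e_stable x sp (n + 1).
  (* The window splits into negative indices, where the symbol vanishes, the index 0, which gives
     [x], and positive indices. *)
  have := hb (- `|b|%N%:Z) (`|b| + (1 + `|b|))%N ltac:(lia) ltac:(lia).
  rewrite !big_split_ord /= big1 ?add0r => [|i _]; last first.
    by rewrite /rho_term (scoef_below k_char0 sp) ?polyact0 ?scaler0 //; case: i => i /=; lia.
  rewrite big_ord_recl big_ord0 addr0 /=.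
  have -> : - `|b|%N%:Z + (`|b| + 0)%N%:Z = 0 by lia.
  rewrite {1}/rho_term expr0z scale1r (scoef_eq k_char0 (p := 1)); last first.
    by move=> nu; rewrite hornerC.
  rewrite polyact1 opprD addrA => h; apply: filt_sub _ h.
  apply: filt_sum => i _; set j := _ + _%:Z.
  have := filt_rho_term e_stable phi j xn; apply: filt_le; rewrite /j.
  by case: i {j} => i /=; lia.
have [Finj Fsurj] := unipotent_bijective e_span FD unip.
split=> // n x xn; rewrite -[n]add0r; exact: (rho_filt k_char0 e_span e_stable sp xn).
Qed.

(** Write [u = c z v] with [v(0) = 1] and take [C = v^D c^D]: the scaling operator replaces z by
    [c z], and the operator with symbol [v^nu] replaces z by [z v]. *)
Lemma coordinate_change u : has_order u 1 -> exists C : R -> R,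
  [/\ filt_iso e C, forall f x, C (f *: x) = lcomp f u *: C x &
      forall x, nabla (C x) = (theta u / u) *: C (nabla x)].
Proof.
move=> u1; have [c0 ub] := u1; set c := u 1 in c0.
have [sigma [[sD sc sv sn [sinj ss]] sf]] := scaling_operator k_char0 k_split e_span e_stable c0.
have X0 := lvar_neq0 k; have cc0 : lconst c != 0 by rewrite lconst_eq0.
pose v := u / (lconst c * lvar).
have uE : u = lconst c * lvar * v by rewrite /v mulrC divfK // mulf_neq0.
have ocX : has_order (lconst c * lvar) 1.
  split; first by rewrite lcoef_lconstM lvarE eqxx mulr1.
  by rewrite -[1]add0r; apply: lcoefM_below; [exact: vanish_below_const|have [] := has_order_lvar k].
have v0 : has_order v 0 by rewrite -(subrr 1); apply: has_orderM => //; apply: has_orderV.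
have vz := has_order_neq0 v0.
have v1 : v 0 = 1.
  have := lcoefM_lead (proj2 ocX) (proj2 v0); rewrite -uE addr0 lcoef_lconstM lvarE eqxx mulr1.
  by move=> E; apply: (mulfI c0); rewrite mulr1 -E.
clearbody v; pose h := theta v / v; have h1 : vanish_below h 1 := logder_below v0.
have thetav : theta v = h * v by rewrite divfK.
clearbody h.
have [psi [sp psi1 psiE]] := power_symbol k_char0 h1.
(* Both sides solve [theta y = (nu + 1) h y] with constant term 1. *)
have psiS nu : psi (nu + 1) = v * psi nu.
  have [pb _] := sp.
  have nuh mu : vanish_below (lconst mu * h) 1.
    by rewrite -[1]add0r; apply: lcoefM_below => //; exact: vanish_below_const.
  apply: (ode_unique k_char0 (nuh (nu + 1))) => //.
  - by rewrite -[0]add0r; apply: lcoefM_below => //; case: v0.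
  - rewrite psi1 -[0 in RHS]addr0 lcoefM_lead ?v1 ?psi1 ?mulr1 //; by case: v0.
  - by rewrite thetaM thetav psiE lconstD lconst1; ring.
have [rD rinj rf rs] := rho_filt_iso sp psi1.
pose C x := rho e psi (sigma x).
have Ciso : filt_iso e C by apply: (filt_iso_comp (F := rho e psi)) => //.
have CD x y : C (x + y) = C x + C y by rewrite /C sD rD.
have Cc (a : k) x : C (lconst a *: x) = lconst a *: C x.
  by rewrite /C sc (rho_lconst k_char0 e_span e_stable _ _ sp).
have CX x : C (lvar *: x) = u *: C x.
  rewrite /C sv -scalerA (rho_lconst k_char0 e_span e_stable _ _ sp) -[lvar]expr1z.
  rewrite (rho_mulr k_char0 e_span e_stable _ _ sp) expr1z.
  rewrite (rho_ext e _ (psi := fun nu => lvar * v * psi nu)); last first.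
    by move=> nu; rewrite psiS mulrA.
  by rewrite (rho_mull k_char0 e_span e_stable _ _ sp) scalerA mulrA -uE.
have CXn (j : nat) x : C (lvar ^+ j *: x) = u ^+ j *: C x.
  elim: j x => [|j IH] y; first by rewrite !expr0 !scale1r.
  by rewrite !exprSr -!scalerA -CX IH.
have Cvarz i x : C (lvar ^ i *: x) = u ^ i *: C x.
  case: i => [i|i]; first exact: CXn.
  rewrite NegzE -!exprnN; move: (expf_neq0 i.+1 X0) (expf_neq0 i.+1 (has_order_neq0 u1)) (CXn i.+1 (lvar ^- i.+1 *: x)).
  move: (lvar ^+ i.+1) (u ^+ i.+1) => p q p0 q0 E; apply: (scalerI q0).
  by rewrite -E !scalerA !mulfV // !scale1r.
exists C; split => // [f x|x].
  apply/eqP; rewrite -subr_eq0; apply/eqP; move: f.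
  apply: (laurent_density (B := filt e)) => [y|f g|a i|n].
  - exact: filt_sep.
  - by rewrite scalerDl CD lcompD // scalerDl opprD addrACA.
  - have -> : C ((lconst a * lvar ^ i) *: x) = (lconst a * u ^ i) *: C x.
      have := Cc a (lvar ^ i *: x); rewrite Cvarz (scalerA (lconst a) (lvar ^ i) x).
      by rewrite (scalerA (lconst a) (u ^ i)).
    by rewrite lcomp_monomial //; exact: subrr.
  - have [d xd] := filt_ex x e_span; exists (n - d) => f fb.
    have [_ _ Cf _] := Ciso.
    apply: filtB.
      by apply: Cf; have := filtZ fb xd; rewrite subrK.
    by have := filtZ (lcomp_below u1 fb) (Cf _ _ xd); rewrite subrK.
(* Here [theta u / u = 1 + h], and [D] on the left of the symbol [v^nu] gives [nu (1 + h) v^nu]. *)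
rewrite /C sn (nabla_rho k_char0 e_span e_stable _ sp) (rho_nabla k_char0 e_span e_stable _ sp).
rewrite -(rho_mull k_char0 e_span e_stable _ _ (symbol_nu sp)); apply: rho_ext => nu.
rewrite psiE uE !thetaM theta_const theta_var mul0r add0r thetav.
by field; rewrite vz X0 cc0.
Qed.

End CoordinateChange.

(** * Substitution as an automorphism of Laurent series *)

Section SubstitutionMorphism.
Variables (k : fieldType) (k_char0 : [pchar k] =i pred0) (k_split : monic_split k).
Implicit Types (f g u v : laurent k).

(* A coordinate change of the trivial connection is, up to its value at 1, the
   substitution f |-> f(u); this makes the latter a bijective ring morphism. *)
Lemma trivial_coordinate_change u : has_order u 1 -> exists C : laurent k -> laurent k,
  [/\ injective C, forall g, exists f, C f = g,
      forall f g, C (f * g) = lcomp f u * C g &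
      forall f, theta (C f) = theta u / u * C (theta f)].
Proof.
move=> u1; pose e (_ : 'I_1) : line (0 : laurent k) := (1 : laurent k).
have nablaE (x : line (0 : laurent k)) : nabla x = theta (x : laurent k).
  by rewrite /nabla /= /line_nabla mul0r addr0.
have e_span : spanning e.
  by move=> x; exists (fun=> x); rewrite big_ord1; apply/esym/mulr1.
have e_stable i : filt e 0 (nabla (e i)).
  by rewrite nablaE /e theta1; exact: filt0.
have [C [[_ Cinj _ Csurj] CM Ctheta]] := coordinate_change k_char0 k_split e_span e_stable u1.
exists C; split=> // [g|f].
  have [n gn] := filt_ex (g : line 0) e_span.
  by have [f _ fE] := Csurj n g gn; exists f.
by have := Ctheta f; rewrite !nablaE.
Qed.

Lemma lcomp_const (c : k) u : has_order u 1 -> lcomp (lconst c) u = lconst c.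
Proof. by move=> u1; have := lcomp_monomial c 0 u1; rewrite !expr0z !mulr1. Qed.

Lemma lcomp_varz (i : int) u : has_order u 1 -> lcomp (lvar ^ i) u = u ^ i.
Proof.
move=> u1; have := lcomp_monomial 1 i u1; rewrite lconst1.
by move: (lvar ^ i) (u ^ i) => p q; rewrite !mul1r.
Qed.

(** [C (f g)] is both [(f g)(u) C 1] and [f(u) g(u) C 1], and [C 1] is nonzero by surjectivity. *)
Lemma lcompM f g u : has_order u 1 -> lcomp (f * g) u = lcomp f u * lcomp g u.
Proof.
move=> u1; have [C [Cinj Csurj CM _]] := trivial_coordinate_change u1.
have C1 : C 1 != 0.
  have [f' Cf] := Csurj 1; have := CM f' 1; rewrite mulr1 Cf => E.
  by apply: contraNneq (oner_neq0 (laurent k)) => C10; rewrite E C10 mulr0.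
by apply: (mulIf C1); rewrite -CM -mulrA CM -[g]mulr1 CM mulr1 mulrA.
Qed.

Lemma lcomp_bij u : has_order u 1 ->
  injective (fun f => lcomp f u) /\ (forall g, exists f, lcomp f u = g).
Proof.
move=> u1; have [C [Cinj Csurj CM _]] := trivial_coordinate_change u1.
split=> [f g fg|g]; first by apply: Cinj; rewrite -[f]mulr1 -[g]mulr1 !CM fg.
have [f1 C1] := Csurj 1; have C10 : C 1 != 0.
  by apply: contraNneq (oner_neq0 (laurent k)) => C10; rewrite -C1 -[f1]mulr1 CM C10 mulr0.
have [f Cf] := Csurj (g * C 1); exists f; apply: (mulIf C10).
by rewrite -CM mulr1.
Qed.

(** [theta (C 1) = 0] because [theta 1 = 0]; differentiate [C f = f(u) C 1]. *)
Lemma theta_lcomp f u : has_order u 1 ->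
  theta (lcomp f u) = theta u / u * lcomp (theta f) u.
Proof.
move=> u1; have [C [Cinj Csurj CM Ctheta]] := trivial_coordinate_change u1.
have C0 : C 0 = 0 by have := CM 0 0; rewrite mulr0 -lconst0 lcomp_const // lconst0 mul0r.
have C10 : C 1 != 0.
  by apply: contraNneq (oner_neq0 (laurent k)) => C10; apply/eqP/Cinj; rewrite C10 C0.
have theta_C1 : theta (C 1) = 0 by rewrite Ctheta theta1 C0 mulr0.
have := Ctheta f; have := CM (theta f) 1; have := CM f 1.
by rewrite !mulr1 => -> ->; rewrite thetaM theta_C1 mulr0 addr0 mulrA => /(mulIf C10).
Qed.

Lemma lcompX f u (n : nat) : has_order u 1 -> lcomp (f ^+ n) u = lcomp f u ^+ n.
Proof.
move=> u1; elim: n => [|n IH]; first by rewrite !expr0 -lconst1 lcomp_const.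
by rewrite !exprS lcompM // IH.
Qed.

Lemma lcompz f u (i : int) : has_order u 1 -> f != 0 -> lcomp (f ^ i) u = lcomp f u ^ i.
Proof.
move=> u1 f0; case: i => n; first by rewrite -!exprnP lcompX.
rewrite NegzE -!exprnN -lcompX //; move: (expf_neq0 n.+1 f0).
move: (f ^+ n.+1) => g g0.
have E : lcomp g u * lcomp g^-1 u = 1 by rewrite -lcompM // mulfV // -lconst1 lcomp_const.
have lg0 : lcomp g u != 0.
  by apply: contraNneq (oner_neq0 (laurent k)) => lg; rewrite -E lg mul0r.
by apply: (mulfI lg0); rewrite E mulfV.
Qed.

Lemma lcompA f u v : has_order u 1 -> has_order v 1 -> lcomp (lcomp f u) v = lcomp f (lcomp u v).
Proof.
move=> u1 v1; have uv1 := lcomp_order v1 u1.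
apply/eqP; rewrite -subr_eq0; apply/eqP; move: f.
apply: (laurent_density (B := fun n f => vanish_below f n)) => [f|f g|c i|n].
- exact: vanish_below_eq0.
- by rewrite !lcompD // opprD addrACA.
- have E : lcomp (lconst c * u ^ i) v = lconst c * lcomp u v ^ i.
    by rewrite lcompM // lcomp_const // lcompz // (has_order_neq0 u1).
  by rewrite (lcomp_monomial c i uv1) (lcomp_monomial c i u1) E; exact: subrr.
- by exists n => f fn; apply: vanish_belowB; do ?apply: lcomp_below.
Qed.

(** An [m]-th root [tau] of [a] has order 1, and [zeta] is its compositional inverse. *)
Lemma compositional_root (a : laurent k) (m : nat) : (0 < m)%N -> has_order a m%:Z ->
  exists zeta, has_order zeta 1 /\ lcomp a zeta = lvar ^+ m.
Proof.
move=> m0 am; have [c0 ab] := am; set c := a m%:Z in c0.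
have X0 := lvar_neq0 k.
(* [d] is a root of [X^m - c]; the list of roots is nonempty since the degree is positive. *)
have [d dm] : exists d, d ^+ m = c.
  have [[|d s] sE] := k_split (monicXnsubC c m0).
    by have := size_XnsubC c m0; rewrite sE big_nil size_poly1; case: (m) m0.
  exists d; have := congr1 (horner^~ d) sE; rewrite /= big_cons hornerM hornerXsubC.
  by rewrite subrr mul0r !hornerE => /eqP; rewrite subr_eq0 => /eqP.
have d0 : d != 0 by apply: contraNneq c0 => d0; rewrite -dm d0 expr0n gtn_eqF.
have cX : has_order (lconst c * lvar ^+ m) m%:Z.
  split; first by rewrite lcoef_lconstM exprnP lcoef_varX eqxx mulr1.
  rewrite -[m%:Z]add0r; apply: lcoefM_below; first exact: vanish_below_const.
  exact: (@vanish_below_varz _ m%:Z).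
have [v [v0 aE]] : exists v, has_order v 0 /\ a = lconst c * lvar ^+ m * v.
  exists (a / (lconst c * lvar ^+ m)); split.
    by rewrite -(subrr m%:Z); apply: has_orderM => //; apply: has_orderV.
  by rewrite mulrC divfK // (has_order_neq0 cX).
have v1 : v 0 = 1.
  have := lcoefM_lead (proj2 cX) (proj2 v0).
  rewrite -aE addr0 lcoef_lconstM exprnP lcoef_varX eqxx mulr1.
  by move=> E; apply: (mulfI c0); rewrite mulr1 -E.
have [g [gb g1 gm]] := root_series k_char0 m0 (proj2 v0) v1.
have lX : lconst (d ^+ m) = lconst d ^+ m.
  by elim: (m) => [|n IH]; rewrite ?expr0 // !exprS -IH lconstM.
clearbody c; have [tau [tau1 taum]] : exists tau, has_order tau 1 /\ tau ^+ m = a.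
  exists (lconst d * lvar * g); split.
    rewrite -[1]addr0; apply: has_orderM; last by split; rewrite ?g1 ?oner_eq0.
    split; first by rewrite lcoef_lconstM lvarE eqxx mulr1.
    by rewrite -[1]add0r; apply: lcoefM_below; [exact: vanish_below_const|have [] := has_order_lvar k].
  have -> : a = lconst d ^+ m * lvar ^+ m * g ^+ m.
    by rewrite aE gm -dm lX.
  by rewrite (exprMn _ (lconst d * lvar)) (exprMn _ (lconst d)).
have [inj surj] := lcomp_bij tau1; have [zeta zE] := surj lvar.
have zeta1 : has_order zeta 1.
  have z0 : zeta != 0.
    by apply: contraNneq X0 => z0; rewrite -zE z0 -lconst0 lcomp_const // lconst0.
  have [n zn] := has_order_ex z0; have := lcomp_order tau1 zn.
  by rewrite zE => /(has_order_uniq (has_order_lvar k)) ->.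
have lv : lcomp lvar tau = tau by have := lcomp_varz 1 tau1; rewrite !expr1z.
exists zeta; split; first exact: zeta1.
by apply: inj; rewrite (lcompA _ zeta1 tau1) zE lcomp_lvar (lcompX _ _ tau1) lv taum.
Qed.

End SubstitutionMorphism.

(** * Formal stationary phase *)

Section PhaseSymbol.
Variables (k : fieldType) (k_char0 : [pchar k] =i pred0).
Variables (m s : nat) (m_gt0 : (0 < m)%N) (s_gt0 : (0 < s)%N).
Local Notation r := (m + s)%N.
Variables (w : laurent k) (wr : vanish_below w r%:Z).
Implicit Types (phi psi : k -> laurent k).

Let m_neq0 : (m%:R : k) != 0.
Proof. by rewrite natr_eq0_char0 // -lt0n. Qed.

(* phi z^m = (z^m + w D) phi as operators. *)
Definition intertwines phi := forall nu : k,
  lvar ^+ m * phi (nu + m%:R) =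
  lvar ^+ m * phi nu + w * (lconst nu * phi nu + theta (phi nu)).

Lemma intertwinesB phi psi : intertwines phi -> intertwines psi ->
  intertwines (fun nu => phi nu - psi nu).
Proof.
move=> hp hq nu; rewrite mulrBr hp hq thetaD thetaN; ring.
Qed.

(** Composing on the right with [c z^j], which commutes with [z^m], keeps the relation;
    [z^j phi(nu + j)] is the symbol of [phi z^j]. *)
Lemma intertwines_shift phi (c : k) (j : int) : intertwines phi ->
  intertwines (fun nu => lconst c * (lvar ^ j * phi (nu + j%:~R))).
Proof.
move=> hp nu; rewrite thetaM theta_const mul0r add0r thetaM theta_varz.
have := hp (nu + j%:~R); rewrite addrAC lconstD lconst_int.
move: (lvar ^ j) (lvar ^+ m) (phi (nu + m%:R + j%:~R)) (phi (nu + j%:~R)) => p q a b.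
move: (theta b) (lconst nu) (lconst c) => b' n c' E.
transitivity (c' * p * (q * a)); first by ring.
rewrite E; ring.
Qed.

(** In degree [m + i] the relation expresses [phi_i(nu + m) - phi_i(nu)] through the [phi_j] with
    [j <= i - s], because [w] starts in degree [m + s]. Antidifferences of step [m] solve it, and 0
    is a solution for [0 < i < s]. *)
Lemma phase_symbol : exists phi : k -> laurent k,
  [/\ symbol phi 0, intertwines phi, forall nu, phi nu 0 = 1,
      forall nu i, 0 < i -> i < s%:Z -> phi nu i = 0 &
      forall nu, phi nu s%:Z = (nu ^+ 2 - m%:R * nu) / (2%:R * m%:R) * w r%:Z].
Proof.
have [AD hAD] := choice (fun q => poly_antidifference k_char0 q m_neq0).
pose G n (P : nat -> {poly k}) : {poly k} :=
  if n is 0 then 1 else if (n < s)%N then 0 else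
  AD (\sum_(j < (n - s).+1) w (r%:Z + j%:Z) *: (('X + (n - s - j)%N%:R%:P) * P (n - s - j)%N)).
have [|P PE] := @course_of_values _ 0 G.
  move=> [|n] P Q PQ //=; case: ltnP => // sn; congr AD.
  by apply: eq_bigr => j _; rewrite PQ //; lia.
have vb nu : vanish_below (fun n : int => if n < 0 then 0 else (P `|n|%N).[nu]) 0.
  by move=> n n0; rewrite n0.
pose phi nu := Laurent (ex_intro _ _ (vb nu)).
have phi0 nu : vanish_below (phi nu) 0 := vb nu.
have phiE nu (i : nat) : phi nu i%:Z = (P i).[nu] by [].
have sphi : symbol phi 0.
  split=> // i; case: (ltrP i 0) => i0; first by exists 0 => nu; rewrite horner0; apply: phi0.
  by exists (P `|i|%N) => nu; rewrite -phiE gez0_abs.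
have phi1 nu : phi nu 0 = 1 by rewrite phiE PE hornerC.
have phi_small nu i : 0 < i -> i < s%:Z -> phi nu i = 0.
  case: i => // [[|i]] // _ lt_is; rewrite phiE PE /= ifT ?horner0 //; lia.
have ADs n nu : (s <= n)%N -> (P n).[nu + m%:R] - (P n).[nu] =
    \sum_(j < (n - s).+1) w (r%:Z + j%:Z) * ((nu + (n - s - j)%N%:R) * (P (n - s - j)%N).[nu]).
  move=> sn; rewrite (PE n) /G; case: n sn => [|n] sn; first by lia.
  rewrite ltnNge sn /= (proj2 (hAD _)) horner_sum; apply: eq_bigr => j _.
  by rewrite hornerZ hornerM hornerD hornerX hornerC.
exists phi; split=> // [nu|nu].
  (* With [i = n - m]: everything vanishes for [n < m], the [w]-term vanishes for [i < s], and the
     remaining degrees are the recursion. *)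
  apply: laurentP => n; rewrite lcoefD (lcoef_varXM _ m) (lcoef_varXM (phi nu) m).
  have db : vanish_below (lconst nu * phi nu + theta (phi nu)) 0.
    apply: vanish_belowD; last exact: theta_below.
    by rewrite -[0]add0r; apply: lcoefM_below => //; exact: vanish_below_const.
  case: (ltrP n m%:Z) => nm.
    by rewrite !phi0 ?(lcoefM_below wr db) ?addr0 //; lia.
  have -> : n - m%:Z = `|(n - m%:Z)%R|%N%:Z by lia.
  set i := `|(n - m%:Z)%R|%N; case: (ltnP i s) => is_.
    rewrite (lcoefM_below wr db) ?addr0; last by rewrite /i in is_; lia.
    case: (posnP i) => [-> |i0]; first by rewrite !phi1.
    by rewrite !phi_small.
  have -> : n = r%:Z + 0 + (i - s)%N%:Z by rewrite /i in is_ *; lia.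
  rewrite (lcoefM_sum _ wr db) !phiE.
  transitivity ((P i).[nu] + ((P i).[nu + m%:R] - (P i).[nu])); first by rewrite [RHS]addrC subrK.
  congr (_ + _); rewrite ADs //; apply: eq_bigr => j _; rewrite lcoefD lcoef_lconstM thetaE add0r phiE.
  by rewrite mulrDl.
have Ps0 : (P s).[0] = 0.
  by rewrite PE /G; case: (s) s_gt0 => // n _; rewrite ltnn (proj1 (hAD _)).
(* [q] solves [q(nu + m) - q(nu) = w_r nu], so [P s - q] is [m]-periodic; it vanishes at 0 by the
   normalization of the antidifference. *)
pose q : {poly k} := (w r%:Z / (2%:R * m%:R)) *: ('X ^+ 2 - m%:R *: 'X).
have two0 : (2%:R : k) != 0 by rewrite natr_eq0_char0.
have qE x : q.[x] = (x ^+ 2 - m%:R * x) / (2%:R * m%:R) * w r%:Z.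
  by rewrite /q !hornerE; ring.
have per x : (P s - q).[x + m%:R] = (P s - q).[x].
  apply/eqP; rewrite !hornerD !hornerN !qE -subr_eq0; apply/eqP.
  have := ADs s x (leqnn s); rewrite subnn big_ord_recl big_ord0 /= subnn (PE 0) hornerC.
  rewrite !addr0 mulr1 => /eqP; rewrite subr_eq => /eqP ->.
  by field; rewrite m_neq0 two0.
rewrite phiE -qE; apply/eqP; rewrite -subr_eq0 -hornerN -hornerD.
rewrite (poly_periodic k_char0 m_neq0 per) hornerD hornerN Ps0 qE.
by rewrite expr0n mulr0 subrr !mul0r subrr.
Qed.

Variables (phi : k -> laurent k) (sphi : symbol phi 0) (iphi : intertwines phi).
Hypothesis phi1 : forall nu, phi nu 0 = 1.

(** The [w]-term starts in degree [r + a > m + a], so degree [m + a] of the relation says that the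
    coefficient of degree [a] is an [m]-periodic polynomial. *)
Lemma intertwines_lead G a : symbol G a -> intertwines G -> forall nu, G nu a = G 0 a.
Proof.
move=> sG iG nu; rewrite !(scoefE _ _ sG).
apply: (poly_periodic k_char0 m_neq0) => x; rewrite -!(scoefE _ _ sG).
have [Gb _] := sG; have := congr1 (fun f : laurent k => f (m%:Z + a)) (iG x).
rewrite lcoefD (lcoef_varXM _ m) (lcoef_varXM (G x) m) (_ : m%:Z + a - m%:Z = a); last lia.
move=> ->.
rewrite (@lcoefM_below _ _ _ r%:Z a) ?addr0 //; last by lia.
apply: vanish_belowD; last exact: theta_below.
by rewrite -[a]add0r; apply: lcoefM_below => //; exact: vanish_below_const.
Qed.

Lemma symbol_mono (c : k) (j : int) : symbol (fun nu => lconst c * (lvar ^ j * phi (nu + j%:~R))) j.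
Proof.
rewrite -[X in symbol _ X]add0r; apply: symbolM; first exact: vanish_below_const.
rewrite -[X in symbol _ X]addr0; apply: symbolM; first exact: vanish_below_varz.
exact: symbol_shift.
Qed.

(** The symbol of [Phi H], with [H] cut to [N] terms from degree [a] on. *)
Definition phase_sum (a : int) (H : int -> k) (N : nat) (nu : k) : laurent k :=
  \sum_(i < N) lconst (H (a + i%:Z)) * (lvar ^ (a + i%:Z) * phi (nu + (a + i%:Z)%:~R)).

(** The lowest coefficient of an intertwining symbol is a constant [c]; subtracting [Phi c z^a]
    leaves an intertwining symbol that starts one degree later. *)
Lemma phase_factor G a : symbol G a -> intertwines G ->
  exists H : laurent k, vanish_below H a /\
    forall N : nat, symbol (fun nu => G nu - phase_sum a H N nu) (a + N%:Z).
Proof.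
move=> sG iG.
(* The next coefficient of [H] is the lowest one of the remainder, read at [nu = 0] because it does
   not depend on [nu]. *)
pose F n (h : nat -> k) := (G 0 - \sum_(i < n) lconst (h i) *
   (lvar ^ (a + i%:Z) * phi (0 + (a + i%:Z)%:~R))) (a + n%:Z).
have [|h hE] := @course_of_values _ 0 F.
  move=> n f g fg; rewrite /F; congr (lcoef _ _); congr (_ - _).
  by apply: eq_bigr => i _; rewrite fg.
have Hb : vanish_below (fun n : int => if n < a then 0 else h `|(n - a)%R|%N) a.
  by move=> n na; rewrite na.
pose H := Laurent (ex_intro _ _ Hb).
have HE (i : nat) : H (a + i%:Z) = h i by rewrite /= ltNge lerDl /= [a + _]addrC addrK.
exists H; split=> // N.
suff [] : symbol (fun nu => G nu - phase_sum a H N nu) (a + N%:Z) /\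
  intertwines (fun nu => G nu - phase_sum a H N nu) by [].
elim: N => [|N [sN iN]].
  rewrite addr0 (_ : (fun nu => _) = G) //.
  by apply/funext => nu; rewrite /phase_sum big_ord0 subr0.
have E : (fun nu => G nu - phase_sum a H N.+1 nu) = (fun nu => (G nu - phase_sum a H N nu) -
     lconst (H (a + N%:Z)) * (lvar ^ (a + N%:Z) * phi (nu + (a + N%:Z)%:~R))).
  by apply/funext => nu; rewrite /phase_sum big_ord_recr opprD addrA.
rewrite E; split; last first.
  by apply: intertwinesB => //; apply: intertwines_shift.
have sM := symbol_mono (H (a + N%:Z)) (a + N%:Z).
have [_ sP] := symbolD sN (symbolN sM).
split=> // nu n nN; rewrite lcoefB lcoef_lconstM lcoef_varzM.
have [phib _] := sphi.
have [nE|nE] := eqVneq n (a + N%:Z); last first.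
  by rewrite (proj1 sN) ?phib ?mulr0 ?subr0 //; lia.
rewrite nE subrr phi1 mulr1 (intertwines_lead sN iN) HE hE /F.
suff -> : phase_sum a H N 0 = \sum_(i < N) lconst (h i) *
   (lvar ^ (a + i%:Z) * phi (0 + (a + i%:Z)%:~R)) by rewrite subrr.
by apply: eq_bigr => i _; rewrite HE.
Qed.

End PhaseSymbol.

(** * The stationary phase operator *)

Section StationaryPhase.
Variables (k : fieldType) (k_char0 : [pchar k] =i pred0).
Variables (m s : nat) (m_gt0 : (0 < m)%N) (s_gt0 : (0 < s)%N).
Local Notation r := (m + s)%N.
Variables (t : laurent k) (tr : has_order t (- r%:Z)).
Local Notation w := (- (theta t)^-1).
Local Notation A := (m%:R * t * lvar ^+ m).

Let m_neq0 : (m%:R : k) != 0.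
Proof. by rewrite natr_eq0_char0 // -lt0n. Qed.

Let r_neq0 : (r%:R : k) != 0.
Proof. by rewrite natr_eq0_char0 //; lia. Qed.

Let theta_t_order : has_order (theta t) (- r%:Z).
Proof.
have [t0 tb] := tr; split; last exact: theta_below.
by rewrite thetaE mulf_neq0 // mulrNz oppr_eq0 -pmulrn.
Qed.

Let wr : vanish_below w r%:Z.
Proof.
by apply: vanish_belowN; have [_] := has_orderV theta_t_order; rewrite opprK.
Qed.

Let w_lead : w r%:Z = (r%:R * t (- r%:Z))^-1.
Proof.
rewrite lcoefN; have := lcoefV_lead theta_t_order; rewrite opprK => ->.
by rewrite thetaE mulrNz -pmulrn mulNr invrN opprK.
Qed.

Let w_theta : w * theta t = - 1.
Proof. by rewrite mulNr mulVf // (has_order_neq0 theta_t_order). Qed.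

Let A_below : vanish_below A (- s%:Z).
Proof.
rewrite (_ : - s%:Z = 0 + (- r%:Z) + m%:Z); last by lia.
apply: lcoefM_below; last exact: (@vanish_below_varz _ m%:Z).
by apply: lcoefM_below; [rewrite -lconst_nat; exact: vanish_below_const | case: tr].
Qed.

Let A_lead : A (- s%:Z) = m%:R * t (- r%:Z).
Proof.
rewrite mulrC (lcoef_varXM _ m) -lconst_nat lcoef_lconstM.
by rewrite (_ : - s%:Z - m%:Z = - r%:Z) //; lia.
Qed.

Section WithSymbol.
Variables (phi : k -> laurent k) (sphi : symbol phi 0) (iphi : intertwines m w phi).
Hypothesis phi1 : forall nu, phi nu 0 = 1.

(* [m t phi z^m - phi (D + m)] as operators. *)
Definition phase_defect (nu : k) : laurent k :=
  m%:R * t * (lvar ^+ m * phi (nu + m%:R)) - (lconst nu + m%:R) * phi nu.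

Lemma symbol_phase_defect : symbol phase_defect (- s%:Z).
Proof.
apply: symbolD => //.
  rewrite (_ : - s%:Z = (0 + (- r%:Z)) + (m%:Z + 0)); last by lia.
  apply: symbolM.
    by apply: lcoefM_below; [rewrite -lconst_nat; exact: vanish_below_const | case: tr].
  apply: symbolM; first exact: (@vanish_below_varz _ m%:Z).
  exact: symbol_shift.
apply: symbolN; apply: (@symbol_le _ _ 0); first lia.
rewrite (_ : (fun nu => _) = (fun nu => lconst nu * phi nu + m%:R * phi nu)); last first.
  by apply/funext => nu; rewrite mulrDl.
apply: symbolD => //; first exact: symbol_nu.
rewrite -[X in symbol _ X]add0r; apply: symbolM => //.
by rewrite -lconst_nat; exact: vanish_below_const.
Qed.

(** For [X = z^m + w D], the identity [w theta t = -1] gives [X t = t X - 1], while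
    [(D + m) z^m = z^m (D + 2m)]. Each produces an extra term [m X Phi], and the two cancel. *)
Lemma intertwines_phase_defect : intertwines m w phase_defect.
Proof.
move=> nu; rewrite /phase_defect; have I1 := iphi nu; have I2 := iphi (nu + m%:R).
have thetaX' : theta (lvar ^+ m : laurent k) = m%:R * lvar ^+ m.
  by rewrite exprnP theta_varz.
have thetaM' : theta (m%:R : laurent k) = 0 by rewrite -lconst_nat theta_const.
rewrite lconstD lconst_nat in I2 *.
rewrite !(thetaD, thetaN, thetaM, theta_const, thetaX', thetaM').
have w_theta' := w_theta; move: I1 I2 w_theta'.
move: (phi (nu + m%:R + m%:R)) (phi (nu + m%:R)) (phi nu) => p2 p1 p0.
move: (t) (m%:R : laurent k) (lconst nu) (lvar ^+ m) (theta t) (theta p0) (theta p1) (w).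
move=> t' M n X dt q0 q1 w' I1 I2 wdt; apply/eqP; rewrite -subr_eq0; apply/eqP.
move/eqP: I1; rewrite -subr_eq0 => /eqP I1; move/eqP: I2; rewrite -subr_eq0 => /eqP I2.
(* A combination of the relation at [nu + m], the relation at [nu] and [w theta t = -1]. *)
transitivity (M * t' * X * (X * p2 - (X * p1 + w' * ((n + M) * p1 + q1)))
   - (n + M) * (X * p1 - (X * p0 + w' * (n * p0 + q0))) - M * X * p1 * (1 + w' * dt)); first by ring.
by rewrite I1 I2 wdt; ring.
Qed.

Hypothesis phi_small : forall nu i, 0 < i -> i < s%:Z -> phi nu i = 0.
Hypothesis phi_s : forall nu, phi nu s%:Z = (nu ^+ 2 - m%:R * nu) / (2%:R * m%:R) * w r%:Z.

Let phi_sub1 nu : vanish_below (phi nu - 1) s%:Z.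
Proof.
move=> i is_; rewrite lcoefB lcoef1; case: eqP => [->|i0]; first by rewrite phi1 subrr.
rewrite subr0; case: (ltrP i 0) => i0'; first by rewrite (proj1 sphi).
by apply: phi_small => //; lia.
Qed.

Let phi_sub1S nu : phi nu s%:Z = 0 -> vanish_below (phi nu - 1) (s%:Z + 1).
Proof.
move=> ps i is_; case: (ltrP i s%:Z) => is'; first exact: phi_sub1.
have -> : i = s%:Z by lia.
by rewrite lcoefB ps lcoef1 (_ : (s%:Z == 0) = false) ?subrr //; lia.
Qed.

Let half : (s%:R / 2%:R : laurent k) = lconst (s%:R / 2%:R).
Proof. by rewrite lconstM lconstV !lconst_nat. Qed.

(** [phi_s] vanishes at 0 and at [m], so [phi 0] and [phi m] equal 1 through degree [s], while [A]
    starts in degree [-s]. *)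
Let defect0 : vanish_below (phase_defect 0 - A + m%:R) 1.
Proof.
have E : phase_defect 0 - A + m%:R = A * (phi m%:R - 1) - m%:R * (phi 0 - 1).
  by rewrite /phase_defect lconst0 !add0r; ring.
rewrite E; apply: vanish_belowB.
  rewrite (_ : 1 = - s%:Z + (s%:Z + 1)); last lia.
  apply: lcoefM_below => //; apply: phi_sub1S.
  by rewrite phi_s expr2 subrr !mul0r.
apply: (@below_le _ _ (0 + (s%:Z + 1))); first lia.
apply: lcoefM_below; first by rewrite -lconst_nat; exact: vanish_below_const.
by apply: phi_sub1S; rewrite phi_s expr0n mulr0 subrr !mul0r.
Qed.

(** Evaluate at [nu = 0]. Modulo positive degrees the defect is [A - m], and [Phi H] is [H] plus the
    constant [H_(-s) phi_s(-s) = s/2]. *)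
Lemma phase_leading (H : laurent k) : vanish_below H (- s%:Z) ->
  (forall N : nat, symbol (fun nu => phase_defect nu - phase_sum phi (- s%:Z) H N nu)
     (- s%:Z + N%:Z)) ->
  vanish_below (H - A + (s%:R / 2%:R + m%:R)) 1.
Proof.
move=> Hb rem; pose c (i : nat) := H (- s%:Z + i%:Z).
have c0E : H (- s%:Z) = m%:R * t (- r%:Z).
  have [/(_ 0) h _] := rem 1%N; have := h (- s%:Z) ltac:(lia).
  rewrite lcoefB /phase_sum big_ord_recl big_ord0 addr0 /= addr0 lcoef_lconstM lcoef_varzM subrr.
  rewrite phi1 mulr1 => /eqP; rewrite subr_eq0 => /eqP <-.
  have := defect0 (_ : - s%:Z < 1); rewrite lcoefD lcoefB A_lead -lconst_nat lconstE.
  rewrite (_ : (- s%:Z == 0) = false) ?addr0; last lia.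
  by move=> /(_ ltac:(lia)) /eqP; rewrite subr_eq0 => /eqP.
have s1 : - s%:Z + s.+1%:Z = 1 by lia.
have h1 := vanish_below_trunc (N := s.+1) Hb.
have [/(_ 0) h2 _] := rem s.+1; rewrite s1 in h1 h2.
set Htr := \sum_(i < _) _ in h1; set P := phase_sum _ _ _ _ _ in h2.
(* Since [phi - 1] starts in degree [s], only the lowest term of [H] contributes a correction in
   degree at most 0. *)
have h3 : vanish_below (P - Htr - lconst (s%:R / 2%:R)) 1.
  rewrite /P /Htr /phase_sum -sumrB big_ord_recl /= addr0 addrAC.
  apply: vanish_belowD; last first.
    apply: vanish_below_sum => i _; rewrite -mulrBr; apply: (@below_le _ _ (0 + 1)) => //.
    apply: lcoefM_below; first exact: vanish_below_const.
    set j := - s%:Z + _; rewrite -[X in _ - X]mulr1 -mulrBr.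
    apply: (@below_le _ _ (j + s%:Z)); first by rewrite /j /bump /=; lia.
    by apply: lcoefM_below; [exact: vanish_below_varz | exact: phi_sub1].
  rewrite -mulrBr -[X in _ * (_ - X)]mulr1 -mulrBr => n n1.
  rewrite lcoefB lcoef_lconstM lcoef_varzM lconstE opprK.
  case: eqP => [->|n0]; last by rewrite phi_sub1 ?mulr0 ?subr0 //; lia.
  rewrite !add0r lcoefB lcoef1 (_ : (s%:Z == 0) = false) ?subr0; last lia.
  rewrite phi_s c0E w_lead rmorphN /= -pmulrn natrD.
  have := proj1 tr; have := r_neq0; rewrite natrD => rz t0.
  have two0 : (2%:R : k) != 0 by rewrite natr_eq0_char0.
  by field; rewrite rz t0 two0 m_neq0.
rewrite -half in h3.
have -> : H - A + (s%:R / 2%:R + m%:R) =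
    (H - Htr) - (P - Htr - s%:R / 2%:R) - (phase_defect 0 - P) + (phase_defect 0 - A + m%:R).
  by ring.
apply: vanish_belowD => //; apply: vanish_belowB => //; exact: vanish_belowB.
Qed.

End WithSymbol.

(** [Psi = Phi g], where [theta g = (A + s/2 - H) g]. The defect is [Phi H], and moving [D] past [g]
    turns [H] into [A + s/2]. *)
Lemma stationary_phase (R : connection k) (I : finType) (e : I -> R) :
  spanning e -> (forall i, filt e 0 (nabla (e i))) -> exists Psi : R -> R,
  [/\ {morph Psi : x y / x + y} /\ bijective Psi,
      forall (c : k) x, Psi (lconst c *: x) = lconst c *: Psi x,
      exists a : int, forall n x, filt e n x -> filt e (a + n) (Psi x),
      forall x, Psi (lvar ^+ m *: x) = lvar ^+ m *: Psi x + w *: nabla (Psi x) &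
      forall x, (m%:R * t) *: Psi (lvar ^+ m *: x) =
        Psi (nabla x + (A + s%:R / 2%:R + m%:R) *: x)].
Proof.
move=> e_span e_stable.
have [phi [sphi iphi phi1 phi_small phi_s]] := phase_symbol k_char0 m_gt0 s_gt0 wr.
have [H [Hb Hrem]] := phase_factor k_char0 m_gt0 s_gt0 wr sphi iphi phi1
  (symbol_phase_defect sphi) (intertwines_phase_defect iphi).
have Hlead := phase_leading sphi phi1 phi_small phi_s Hb Hrem.
(* By [phase_leading], [A + s/2 - H] is [r] plus terms of positive degree; [z^r] accounts for [r]
   and [power_symbol] for the rest. *)
have [g [g0 gE]] : exists g, has_order g r%:Z /\ theta g = (A + s%:R / 2%:R - H) * g.
  have [psi [[psib _] psi1 psiE]] := power_symbol k_char0 (vanish_belowN Hlead).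
  exists (lvar ^+ r * psi 1); split.
    rewrite -[r%:Z]addr0; apply: has_orderM; first by have := has_orderX r (has_order_lvar k); rewrite mul1r.
    by split; rewrite ?psi1 ?oner_eq0.
  have thetaX' : theta (lvar ^+ r : laurent k) = r%:R * lvar ^+ r by rewrite exprnP theta_varz.
  have two0 : (2%:R : laurent k) != 0 by rewrite -lconst_nat lconst_eq0 natr_eq0_char0.
  rewrite thetaM psiE thetaX' lconst1 natrD.
  move: (psi 1) => p; field; exact: two0.
have rD x y : rho e phi (x + y) = rho e phi x + rho e phi y.
  exact: (rhoDr k_char0 e_span e_stable _ _ sphi).
have rZ (c : k) x : rho e phi (lconst c *: x) = lconst c *: rho e phi x.
  exact: (rho_lconst k_char0 e_span e_stable _ _ sphi).
have rX x : rho e phi (lvar ^+ m *: x) = rho e (fun nu => lvar ^+ m * phi (nu + m%:R)) x.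
  exact: (rho_mulr k_char0 e_span e_stable m%:Z x sphi).
have Xb : vanish_below (lvar ^+ m : laurent k) m%:Z := @vanish_below_varz k m%:Z.
have sD := symbolD (symbol_nu sphi) (symbol_theta sphi).
have PX x : rho e phi (lvar ^+ m *: x) =
    lvar ^+ m *: rho e phi x + w *: nabla (rho e phi x).
  rewrite rX (rho_ext e x iphi).
  rewrite (rhoDl k_char0 e_span e_stable x (symbolM Xb sphi) (symbolM wr sD)).
  rewrite (rho_mull k_char0 e_span e_stable _ x sphi) (rho_mull k_char0 e_span e_stable _ x sD).
  by rewrite (nabla_rho k_char0 e_span e_stable _ sphi).
have mb : vanish_below (m%:R : laurent k) 0 by rewrite -lconst_nat; exact: vanish_below_const.
have mtb : vanish_below (m%:R * t) (0 + - r%:Z) by apply: lcoefM_below => //; case: tr.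
have Nb : vanish_below (-1 : laurent k) 0 by apply: vanish_belowN; exact: vanish_below_const.
have Nmb := vanish_belowN mb.
have defectE x : rho e (phase_defect phi) x =
    (m%:R * t) *: rho e phi (lvar ^+ m *: x) - rho e phi (nabla x) - m%:R *: rho e phi x.
  have sS := symbolM Xb (symbol_shift m%:R sphi).
  have sN := symbol_nu sphi.
  rewrite rX (rho_nabla k_char0 e_span e_stable _ sphi) -scaleN1r -[X in _ + X]scaleNr.
  rewrite -(rho_mull k_char0 e_span e_stable _ x sS) -(rho_mull k_char0 e_span e_stable _ x sN).
  rewrite -(rho_mull k_char0 e_span e_stable _ x sphi).
  have s1 := symbolM mtb sS; have s2 := symbolM Nb sN; have s3 := symbolM Nmb sphi.
  rewrite -(rhoDl k_char0 e_span e_stable x s1 s2).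
  have s12 : symbol (fun nu => m%:R * t * (lvar ^+ m * phi (nu + m%:R)) + -1 * (lconst nu * phi nu))
     (- r%:Z).
    by apply: symbolD => //; [apply: symbol_le s1 | apply: symbol_le s2]; lia.
  rewrite -(rhoDl k_char0 e_span e_stable x s12 s3); apply: rho_ext => nu.
  by rewrite /phase_defect; ring.
have sumE N x : symbol (phase_sum phi (- s%:Z) H N) (- s%:Z) /\
    rho e (phase_sum phi (- s%:Z) H N) x =
    rho e phi ((\sum_(i < N) lconst (H (- s%:Z + i%:Z)) * lvar ^ (- s%:Z + i%:Z)) *: x).
  have s0 : symbol (fun nu => 0 * phi nu) (- s%:Z).
    rewrite -[X in symbol _ X]addr0; apply: symbolM => //; exact: vanish_below0.
  elim: N => [|N [IH1 IH2]].
    have -> : phase_sum phi (- s%:Z) H 0 = (fun nu => 0 * phi nu).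
      by apply/funext => nu; rewrite /phase_sum big_ord0 mul0r.
    split=> //; rewrite (rho_mull k_char0 e_span e_stable _ x sphi) big_ord0 !scale0r.
    by apply: (addIr (rho e phi 0)); rewrite -rD !add0r.
  have -> : phase_sum phi (- s%:Z) H N.+1 = (fun nu => phase_sum phi (- s%:Z) H N nu +
      lconst (H (- s%:Z + N%:Z)) * (lvar ^ (- s%:Z + N%:Z) * phi (nu + (- s%:Z + N%:Z)%:~R))).
    by apply/funext => nu; rewrite /phase_sum big_ord_recr.
  set j := - s%:Z + N%:Z; have sM := symbol_mono sphi (H j) j.
  split; first by apply: symbolD => //; apply: symbol_le sM; rewrite /j; lia.
  rewrite (rhoDl k_char0 e_span e_stable x IH1 sM) IH2 big_ord_recr /= scalerDl rD.
  congr (_ + _); rewrite -scalerA rZ (rho_mulr k_char0 e_span e_stable j x sphi).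
  have vj := symbolM (@vanish_below_varz k j) (symbol_shift j%:~R sphi).
  by rewrite (rho_mull k_char0 e_span e_stable _ x vj).
have rfilt n x : filt e n x -> filt e n (rho e phi x).
  by move=> xn; rewrite -[n]add0r; apply: (rho_filt k_char0 e_span e_stable sphi xn).
(* Modulo [z^n L] both sides agree with [Phi] applied after a long truncation [Htr] of [H]. *)
have PH x : rho e (phase_defect phi) x = rho e phi (H *: x).
  apply/eqP; rewrite -subr_eq0; apply/eqP; apply: (filt_sep e_span) => n.
  have [d xd] := filt_ex x e_span; pose N := `|(n - d + s%:Z)%R|%N.
  have [sS sE] := sumE N x; have sR := Hrem N; set Htr := \sum_(i < N) _ in sE.
  have -> : rho e (phase_defect phi) x =
      rho e (fun nu => phase_defect phi nu - phase_sum phi (- s%:Z) H N nu) x + rho e phi (Htr *: x).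
    rewrite -sE -(rhoDl k_char0 e_span e_stable x sR sS); apply: rho_ext => nu.
    by rewrite subrK.
  have -> : rho e phi (Htr *: x) = rho e phi (H *: x) - rho e phi ((H - Htr) *: x).
    by apply/eqP; rewrite eq_sym subr_eq -rD -scalerDl addrC subrK.
  set u := rho e _ x; set v := rho e phi (H *: x); set z := rho e phi _.
  have -> : u + (v - z) - v = u - z by rewrite addrA addrAC addrK.
  have le_n : n <= - s%:Z + N%:Z + d by rewrite /N; lia.
  apply: filtB; apply: (filt_le le_n).
    exact: (rho_filt k_char0 e_span e_stable sR xd).
  by apply: rfilt; apply: filtZ xd; exact: vanish_below_trunc.
have [_ rinj _ rsurj] := rho_filt_iso k_char0 e_span e_stable sphi phi1.
have gz := has_order_neq0 g0; have [_ gb] := g0.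
exists (fun x => rho e phi (g *: x)); split.
- split=> [x y|]; first by rewrite scalerDr rD.
  have [inv invK] : exists inv, forall y, rho e phi (inv y) = y.
    have surj y : exists x, rho e phi x = y.
      by have [n yn] := filt_ex y e_span; have [x _ xE] := rsurj _ _ yn; exists x.
    by have [inv invK] := choice surj; exists inv.
  exists (fun y => g^-1 *: inv y) => x.
    by rewrite (rinj _ _ (invK _)) scalerA mulVf // scale1r.
  by rewrite scalerA mulfV // scale1r invK.
- by move=> c x; rewrite scalerA [g * _]mulrC -scalerA rZ.
- by exists r%:Z => n x xn; apply: rfilt; apply: filtZ.
- by move=> x; rewrite scalerA [g * _]mulrC -scalerA PX.
move=> x; have := PH (g *: x); rewrite defectE => /eqP.
rewrite subr_eq subr_eq => /eqP E.
have mZ y : m%:R *: rho e phi y = rho e phi (m%:R *: y) by rewrite -(lconst_nat k m) rZ.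
have -> : g *: (lvar ^+ m *: x) = lvar ^+ m *: (g *: x) by rewrite !scalerA mulrC.
rewrite E mZ -!rD; congr (rho e phi _); rewrite nabla_leibniz gE scalerDr !scalerA.
rewrite addrA -!scalerDl [RHS]addrC; congr (_ *: _ + _).
ring.
Qed.

End StationaryPhase.

(** * Dual actions and the local Fourier transform *)

Section TensorLine.
Variables (k : fieldType) (g : laurent k) (R : connection k).

Let ev (l : seq (line g * R)) : R := \sum_(p <- l) (p.1 : laurent k) *: p.2.

Let ev_rel l l' : tens_rel l l' -> ev l = ev l'.
Proof.
elim=> {l l'} [//|l l' _ -> //|l l' l'' _ -> _ -> //|l l1 l' l1' _ h1 _ h2|l l'|y|x x' y|x y y'|a x y].
- by rewrite /ev !big_cat; congr (_ + _).
- by rewrite /ev !big_cat /= addrC.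
- by rewrite /ev big_cons !big_nil addr0 scale0r.
- by rewrite /ev !big_cons !big_nil !addr0 /= scalerDl.
- by rewrite /ev !big_cons !big_nil !addr0 /= scalerDr.
- by rewrite /ev !big_cons !big_nil !addr0 /= scalerA mulrC.
Qed.

(** The inverse evaluates the tensor of [f] and [x] as [f x]. The basis vector of the line has
    derivative [g], which is what gets added to [D]. *)
Lemma tensor_line : exists U : R -> tensor (line g) R,
  [/\ {morph U : x y / x + y}, bijective U, forall f x, U (f *: x) = f *: U x &
      forall x, nabla (U x) = U (nabla x + g *: x)].
Proof.
pose one : line g := (1 : laurent k).
pose V (u : tensor (line g) R) : R := ev (repr (u : tens_space (line g) R)).
have VE l : V (tens_class l) = ev l by apply: ev_rel; apply: tens_repr.
have UD (x y : R) : tens one (x + y) = tens one x + tens one y by exact: tensDr.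
have UZ f (x : R) : tens one (f *: x) = f *: tens one x by exact: tensZr.
have U0 : tens one (0 : R) = 0 by rewrite -[X in tens _ X](scale0r 0) tensZr scale0r.
exists (tens one); split; [exact: UD | | exact: UZ | move=> x].
  exists V => [x|]; first by rewrite VE /ev big_cons big_nil addr0 scale1r.
  elim/tens_classW => l; rewrite VE /ev tens_class_sum (big_morph _ UD U0).
  apply: eq_bigr => -[f x] _ /=; rewrite UZ -tensZl; congr (tens _ x).
  exact: mulr1.
rewrite UD UZ; have -> : nabla (tens one x : tensor (line g) R) = tens (nabla one) x + tens one (nabla x).
  exact: tens_nabla_tens.
rewrite addrC -tensZl; congr (_ + tens _ x).
by rewrite /nabla /= /line_nabla theta1 add0r.
Qed.

End TensorLine.

Section Push.
Variables (k : fieldType) (k_char0 : [pchar k] =i pred0).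
Variables (r : nat) (r_gt0 : (0 < r)%N).
Variables (R N : connection k) (I : finType) (e : I -> R) (e_span : spanning e).
Variables (U : R -> N) (UD : {morph U : x y / x + y}) (UZ : forall f x, U (f *: x) = f *: U x).

(** The images of the [Z^j e_i] with [j < r] have bounded poles against the lattice. Clearing a pole
    of order [a] in [z = Z^r] costs [a r] in [Z]-adic order. *)
Lemma push_lattice_filt (L : set (pushforward k_char0 r_gt0 N)) : is_lattice L ->
  exists n, forall x, filt e n x -> L (U x).
Proof.
move=> [J [e' [se' ->]]].
have [d dE] := choice (fun ij : I * 'I_r =>
  se' (U (lvar ^+ ij.2 *: e ij.1) : pushforward k_char0 r_gt0 N)).
have [a da] := uniform_below (fun ijl : (I * 'I_r) * J => d ijl.1 ijl.2).
have U0 : U 0 = 0 by apply: (addIr (U 0)); rewrite -UD !add0r.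
exists (- a * r%:Z) => x [c [cb xE]].
exists (fun l => \sum_(ij : I * 'I_r) lsection r ij.2 (c ij.1) * d ij l); split => [l|].
  apply: vanish_below_sum => ij _; rewrite -(addNr a); apply: lcoefM_below; last exact: (da (ij, l)).
  move=> i ia; rewrite lsectionE //; apply: cb.
  by case: ij => i' [j jr] /=; nia.
have scaleE (f : laurent k) (y : pushforward k_char0 r_gt0 N) :
  f *: y = (inflate r f *: (y : N) : N) by [].
have -> : U x = \sum_(ij : I * 'I_r) (lsection r ij.2 (c ij.1) *: (U (lvar ^+ ij.2 *: e ij.1) : pushforward k_char0 r_gt0 N)).
  rewrite -(pair_bigA _ (fun i (j : 'I_r) => lsection r j (c i) *:
    (U (lvar ^+ j *: e i) : pushforward k_char0 r_gt0 N))) /= xE (big_morph _ UD U0).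
  apply: eq_bigr => i _; rewrite {1}(inflate_decomp r_gt0 (c i)) scaler_suml (big_morph _ UD U0).
  by apply: eq_bigr => j _; rewrite mulrC -scalerA UZ.
transitivity (\sum_(ij : I * 'I_r) \sum_l (lsection r ij.2 (c ij.1) * d ij l) *: e' l).
  apply: eq_bigr => ij _; rewrite dE scaler_sumr; apply: eq_bigr => l _.
  by rewrite scalerA.
by rewrite exchange_big; apply: eq_bigr => l _; rewrite scaler_suml.
Qed.

End Push.

Lemma inflate_lvar (k : fieldType) (m : nat) : (0 < m)%N ->
  inflate m lvar = lvar ^+ m :> laurent k.
Proof.
move=> m_gt0; apply: laurentP => n; rewrite exprnP lcoef_varX.
have [/dvdzP[q ->]|mn] := boolP (m%:Z %| n)%Z.
  by rewrite inflate_mulr // lvarE; congr (_%:R); nia.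
by rewrite inflate_ndvd //; case: eqP mn => // ->; rewrite dvdzz.
Qed.

Section DualAction.
Variables (k : fieldType) (k_char0 : [pchar k] =i pred0).
Variables (M : connection k).

(** [dact_var] fixes the powers of [t'], the negative ones as inverses; continuity extends this to
    all series. *)
Lemma dual_action_unique (A A' : dual_action M) f x : A f x = A' f x.
Proof.
have X0 := lvar_neq0 k.
have monoE (B : dual_action M) c (i : int) y :
    B (lconst c * lvar ^ i) y = lconst c *: B (lvar ^ i) y.
  by rewrite -dactA dact_const.
have varX (n : nat) y : A (lvar ^+ n) y = A' (lvar ^+ n) y.
  elim: n y => [|n IH] y; first by rewrite expr0 -lconst1 !dact_const.
  by rewrite exprS -!dactA !dact_var IH.
have varz (i : int) y : A (lvar ^ i) y = A' (lvar ^ i) y.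
  case: i => n; first exact: varX.
  rewrite NegzE -exprnN; move: (varX n.+1) (expf_neq0 n.+1 X0).
  move: (lvar ^+ n.+1) => p pE p0.
  rewrite -[A' _ y](dact1 A) -(mulVf p0) -dactA; congr (A _ _).
  by rewrite pE dactA mulfV // dact1.
apply/eqP; rewrite -subr_eq0; apply/eqP; move: f.
apply: (laurent_density (B := fun (L : {L : set M | is_lattice L}) y => sval L y)).
- by move=> y h; apply: lattice_sub0 => L latL; exact: (h (exist _ L latL)).
- by move=> f g; rewrite !dactDl opprD addrACA.
- by move=> c i; rewrite !monoE varz; exact: subrr.
move=> [L latL] /=; have [a ha] := dact_cont A x latL; have [b hb] := dact_cont A' x latL.
exists (Num.max a b) => f fab; apply: lattice_addr => //.
  by apply: ha; apply: below_le fab; lia.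
by apply: lattice_oppr => //; apply: hb; apply: below_le fab; lia.
Qed.

Variables (m : nat) (m_gt0 : (0 < m)%N).
Variables (R : connection k) (I : finType) (e : I -> R) (e_span : spanning e).
Variables (Xi : R -> M) (XiD : {morph Xi : x y / x + y}) (Xi_bij : bijective Xi).
Hypothesis Xi_const : forall c x, Xi (lconst c *: x) = lconst c *: Xi x.
Hypothesis Xi_var : forall x, Xi (lvar ^+ m *: x) = lvar *: nabla (Xi x).
Hypothesis Xi_cont : forall L : set M, is_lattice L -> exists n, forall x, filt e n x -> L (Xi x).

(** [Xi] carries over the multiplication by [f(z^m)] on [R]; finiteness is that of [R] over
    [k((z^m))]. *)
Lemma transported_dual_action :
  exists A : dual_action M, forall f x, A f (Xi x) = Xi (inflate m f *: x).
Proof.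
have [Yi XiK YiK] := Xi_bij.
have YiD y z : Yi (y + z) = Yi y + Yi z by apply: (can_inj XiK); rewrite XiD !YiK.
pose act (f : laurent k) (y : M) : M := Xi (inflate m f *: Yi y).
have aA f g y : act f (act g y) = act (f * g) y by rewrite /act XiK scalerA inflateM.
have aDl f g y : act (f + g) y = act f y + act g y.
  by rewrite /act (inflateD m_gt0) scalerDl XiD.
have aDr f y z : act f (y + z) = act f y + act f z by rewrite /act YiD scalerDr XiD.
have ac c y : act (lconst c) y = lconst c *: y by rewrite /act inflate_const // Xi_const YiK.
have av y : act lvar y = lvar *: nabla y by rewrite /act (inflate_lvar k m_gt0) Xi_var YiK.
have acont y (L : set M) : is_lattice L ->
    exists a : int, forall f : laurent k, vanish_below f a -> L (act f y).
  move=> latL; have [n hn] := Xi_cont latL; have [d yd] := filt_ex (Yi y) e_span.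
  exists `|(n - d)%R|%N%:Z => f fb; apply: hn; rewrite -[n](subrK d).
  apply: filtZ yd => i lt_i; rewrite inflateE //; case: ifP => // /dvdzP[q qE].
  by rewrite qE mulzK; [apply: fb; nia | lia].
have afin : exists (J : finType) (e' : J -> M),
    forall y, exists c : J -> laurent k, y = \sum_i act (c i) (e' i).
  have [J [e' se']] := cspace_findim (pushforward k_char0 m_gt0 R).
  exists J, (fun j => Xi (e' j)) => y; have [c cE] := se' (Yi y); exists c.
  have Xi0 : Xi 0 = 0 by apply: (addIr (Xi 0)); rewrite -XiD !add0r.
  rewrite -[y]YiK [Yi y]cE (big_morph Xi XiD Xi0).
  by apply: eq_bigr => j _; rewrite /act XiK.
by exists (DualAction aA aDl aDr ac av acont afin) => f x; rewrite /= /act XiK.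
Qed.

Variables (N : connection k) (b : laurent k).
Variables (U : R -> N) (UD : {morph U : x y / x + y}) (U_bij : bijective U).
Hypothesis UZ : forall f x, U (f *: x) = f *: U x.
Hypothesis U_nabla : forall x, nabla (U x) = U (nabla x + b *: x).
Hypothesis Xi_nabla : forall x,
  lconst m%:R *: (lvar^-1 *: Xi (lvar ^+ m *: x)) = Xi (nabla x + (b + m%:R) *: x).

(** By uniqueness [A] is the transported action, so [U] after the inverse of [Xi] is linear;
    [Xi_nabla] makes it compatible with the derivations. *)
Lemma local_fourier_iso (A : dual_action M) :
  conn_iso (local_fourier A) (pushforward k_char0 m_gt0 N).
Proof.
have [A0 A0E] := transported_dual_action.
have AE f x : A f (Xi x) = Xi (inflate m f *: x) by rewrite (dual_action_unique A A0) A0E.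
have [Yi XiK YiK] := Xi_bij; have [Vi UK VK] := U_bij.
have YiD y z : Yi (y + z) = Yi y + Yi z by apply: (can_inj XiK); rewrite XiD !YiK.
pose phi (y : local_fourier A) : pushforward k_char0 m_gt0 N := U (Yi (y : M)).
have phi_lin : linear phi.
  move=> f y z; rewrite /phi.
  have -> : (f *: y + z : local_fourier A) = (A f (y : M) + (z : M) : M) by [].
  have -> : A f (y : M) = Xi (inflate m f *: Yi (y : M)) by rewrite -AE YiK.
  by rewrite YiD UD XiK UZ.
pose phiL : {linear local_fourier A -> pushforward k_char0 m_gt0 N} :=
  HB.pack phi (GRing.isLinear.Build _ _ _ _ phi phi_lin).
exists phiL; split.
  exists (fun z => Xi (Vi z)) => z; rewrite /= /phi; first by rewrite UK YiK.
  by rewrite XiK VK.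
move=> y; have m0 : (m%:R : k) != 0 by rewrite natr_eq0_char0 // -lt0n.
have mL : (m%:R : laurent k) != 0 by rewrite -lconst_nat lconst_eq0.
change (U (Yi (A lvar (lvar^-1 *: (y : M)))) =
  ((m%:R : laurent k)^-1 *: nabla (U (Yi (y : M))) : N)).
rewrite U_nabla -UZ; congr (U _); apply: (can_inj XiK); rewrite YiK.
move: (Yi y) (YiK y) => x <- {y}.
have X0 : (lvar : laurent k) ^+ m != 0 by rewrite expf_neq0 // lvar_neq0.
(* [Xi_nabla] describes [z^-1] on images of multiples of [z^m], so [x] is put in this form; in the
   end [z^m (D + b + m) x' = (D + b) x]. *)
pose x' := (lvar ^+ m)^-1 *: x.
have xE : x = lvar ^+ m *: x' by rewrite scalerA mulfV // scale1r.
clearbody x'; have := Xi_nabla x'; rewrite -xE => E.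
have m1 : (m%:R : laurent k)^-1 = lconst m%:R^-1 by rewrite lconstV lconst_nat.
have -> : lvar^-1 *: Xi x = Xi (lconst m%:R^-1 *: (nabla x' + (b + m%:R) *: x')).
  by rewrite Xi_const -E scalerA -lconstM mulVf // lconst1 scale1r.
rewrite AE; congr (Xi _).
rewrite (inflate_lvar k m_gt0) m1 scalerA mulrC -scalerA; congr (_ *: _); rewrite xE nabla_leibniz.
have -> : theta (lvar ^+ m) = m%:R * lvar ^+ m :> laurent k by rewrite exprnP theta_varz.
rewrite scalerDr !scalerA [RHS]addrAC addrC -scalerDl; congr (_ + _).
by congr (_ *: _); ring.
Qed.

End DualAction.

Lemma thetaXV (k : fieldType) (f : laurent k) (n : nat) : f != 0 ->
  theta (f ^- n) = - (n%:R * f ^- n * (theta f / f)).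
Proof.
move=> f0; rewrite thetaV ?expf_neq0 // thetaX; case: n => [|n].
  by rewrite !mul0r oppr0.
rewrite (exprS f n) /=; move: (expf_neq0 n f0); move: (f ^+ n) (theta f) => p q p0.
by field; rewrite p0 f0.
Qed.

(** * Critical point and Legendre transform *)

Section LegendreTransform.
Variables (k : fieldType) (k_char0 : [pchar k] =i pred0) (k_split : monic_split k).
Variables (m s : nat) (m_gt0 : (0 < m)%N) (s_gt0 : (0 < s)%N).
Local Notation r := (m + s)%N.
Variables (alpha : laurent k) (alpha_order : has_order alpha (- s%:Z)).

Let natL_neq0 n : (0 < n)%N -> (n%:R : laurent k) != 0.
Proof. by move=> n0; rewrite -lconst_nat lconst_eq0 natr_eq0_char0 // -lt0n. Qed.

Let nat_neq0 n : (0 < n)%N -> (n%:R : k) != 0.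
Proof. by move=> n0; rewrite natr_eq0_char0 // -lt0n. Qed.

Let rV : (r%:R : laurent k)^-1 = lconst r%:R^-1.
Proof. by rewrite lconstV lconst_nat. Qed.

Let r_gt0 : (0 < r)%N. Proof. by rewrite addn_gt0 m_gt0. Qed.

Let theta_alpha_order : has_order (theta alpha) (- s%:Z).
Proof.
have [a0 ab] := alpha_order; split; last exact: theta_below.
by rewrite thetaE mulf_neq0 // intr_eq0_char0 //; lia.
Qed.

Lemma deriv_t_order : has_order (- deriv_t r alpha) m%:Z.
Proof.
rewrite /deriv_t opprK (_ : m%:Z = 0 + r%:Z - s%:Z); last lia.
apply: has_orderM => //; apply: has_orderM; last first.
  by have := has_orderX r (has_order_lvar k); rewrite mul1r.
rewrite rV; split; last exact: vanish_below_const.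
by rewrite lconstE eqxx invr_neq0 // nat_neq0.
Qed.

Lemma lcompN (f u : laurent k) : has_order u 1 -> lcomp (- f) u = - lcomp f u.
Proof.
move=> u1; have E : lcomp (-1) u = -1.
  by rewrite -lconst1 -lconstN lcomp_const.
by rewrite -mulN1r (lcompM k_char0 k_split) // E mulN1r.
Qed.

Lemma critical_point_ex : exists zeta : laurent k,
  has_order zeta 1 /\ lcomp (deriv_t r alpha) zeta + lvar ^+ m = 0.
Proof.
have [zeta [z1 zE]] := compositional_root k_char0 k_split m_gt0 deriv_t_order.
by exists zeta; split=> //; rewrite -zE lcompN // subrr.
Qed.

Variables (zeta : laurent k) (zeta1 : has_order zeta 1).
Hypothesis critical : lcomp (deriv_t r alpha) zeta + lvar ^+ m = 0.

Let zr_neq0 : zeta ^+ r != 0. Proof. by rewrite expf_neq0 // (has_order_neq0 zeta1). Qed.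

(** The critical equation solved for [theta alpha], through [d/dt = -(1/r) Z^r theta]. *)
Lemma critical_theta : lcomp (theta alpha) zeta = r%:R * zeta ^- r * lvar ^+ m.
Proof.
have lX : lcomp (lvar ^+ r) zeta = zeta ^+ r.
  by rewrite (lcompX k_char0 k_split) //; have := lcomp_varz 1 zeta1; rewrite !expr1z => ->.
have E : lcomp (deriv_t r alpha) zeta = - (r%:R^-1 * zeta ^+ r * lcomp (theta alpha) zeta).
  rewrite /deriv_t lcompN // rV; congr (- _).
  by rewrite (lcompM k_char0 k_split) // (lcompM k_char0 k_split) // lcomp_const // lX.
move: critical; rewrite E addrC => /eqP; rewrite subr_eq0 => /eqP ->.
move: (natL_neq0 r_gt0) zr_neq0 (lcomp (theta alpha) zeta).
move: (zeta ^+ r) (r%:R : laurent k) => p q q0 p0 Y; field.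
by rewrite p0 q0.
Qed.

Let t := zeta ^- r.

Let t_order : has_order t (- r%:Z).
Proof. by apply: has_orderV; have := has_orderX r zeta1; rewrite mul1r. Qed.

Let beta := lcomp alpha zeta + t * lvar ^+ m.

Lemma theta_t : theta t = - (r%:R * t * (theta zeta / zeta)).
Proof. exact: thetaXV (has_order_neq0 zeta1). Qed.

(** The terms with [theta zeta] cancel by the critical equation, which leaves [t theta(t')] with
    [t' = T^m]. *)
Lemma theta_beta : theta beta = m%:R * t * lvar ^+ m.
Proof.
rewrite /beta thetaD (theta_lcomp k_char0 k_split) // critical_theta thetaM theta_t.
have -> : theta (lvar ^+ m) = m%:R * lvar ^+ m :> laurent k by rewrite exprnP theta_varz.
rewrite -/t; ring.
Qed.

(** The lowest terms of the two summands might cancel, so the lowest coefficient is read off from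
    [theta beta]. *)
Lemma beta_order : has_order beta (- s%:Z).
Proof.
have b_below : vanish_below beta (- s%:Z).
  apply: vanish_belowD; first by have [] := lcomp_order zeta1 alpha_order.
  rewrite (_ : - s%:Z = - r%:Z + m%:Z); last lia.
  by apply: lcoefM_below; [case: t_order | exact: (@vanish_below_varz _ m%:Z)].
split=> //; have := congr1 (fun f : laurent k => f (- s%:Z)) theta_beta.
rewrite thetaE => E; apply/eqP => b0; move: E; rewrite b0 mulr0 => /esym/eqP.
rewrite mulrC (lcoef_varXM _ m) -lconst_nat lcoef_lconstM mulf_eq0 (negPf (nat_neq0 m_gt0)) /=.
rewrite (_ : - s%:Z - m%:Z = - r%:Z); last lia.
by have [/negPf->] := t_order.
Qed.

Section Isomorphism.
Variables (R : connection k) (I : finType) (e : I -> R) (e_span : spanning e).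
Hypothesis e_stable : forall i, filt e 0 (nabla (e i)).

(** [Theta = C^-1 Psi], with [C] the substitution by [zeta]: by [critical_theta] it carries
    [(z^r / r)(D + theta alpha)] to [T^m - (theta t)^-1 D]. *)
Lemma phase_operator : exists Theta : R -> R,
  [/\ {morph Theta : x y / x + y} /\ bijective Theta,
      forall (c : k) x, Theta (lconst c *: x) = lconst c *: Theta x,
      exists a : int, forall n x, filt e n x -> filt e (a + n) (Theta x),
      forall x, Theta (lvar ^+ m *: x) =
        lvar ^+ r *: (r%:R^-1 *: (nabla (Theta x) + theta alpha *: Theta x)) &
      forall x, lconst m%:R *: (lvar ^- r *: Theta (lvar ^+ m *: x)) =
        Theta (nabla x + (theta beta + s%:R / 2%:R + m%:R) *: x)].
Proof.
have [C [[CD Cinj _ Csurj] CM Cn]] := coordinate_change k_char0 k_split e_span e_stable zeta1.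
have [Psi [[PD [Psi' PK1 PK2]] Pc [a Pf] PX Pn]] :=
  stationary_phase k_char0 m_gt0 s_gt0 t_order e_span e_stable.
have surj y : exists x, C x = y.
  by have [n yn] := filt_ex y e_span; have [x _ xE] := Csurj _ _ yn; exists x.
have [C' C'K] := choice surj; have CK x : C' (C x) = x by apply: Cinj; rewrite C'K.
have Cc c x : C (lconst c *: x) = lconst c *: C x by rewrite CM lcomp_const.
exists (C' \o Psi); split=> /=.
- split=> [x y|]; first by apply: Cinj; rewrite CD !C'K PD.
  by exists (Psi' \o C) => x /=; rewrite ?C'K ?PK1 // PK2 CK.
- by move=> c x; apply: Cinj; rewrite Cc !C'K Pc.
- exists a => n x xn; have [y yn yE] := Csurj _ _ (Pf _ _ xn).
  by rewrite -yE CK.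
- move=> x; apply: Cinj; rewrite C'K PX; set y := C' (Psi x).
  have yE : C y = Psi x by rewrite C'K.
  have lX : lcomp (lvar ^+ r) zeta = zeta ^+ r.
    by rewrite (lcompX k_char0 k_split) //; have := lcomp_varz 1 zeta1; rewrite !expr1z => ->.
  rewrite CM lX rV Cc CD CM yE critical_theta -/t -yE Cn !scalerDr !scalerA addrC.
  have z0 := has_order_neq0 zeta1.
  have tz0 : theta zeta != 0.
    have [zc zb] := zeta1.
    by apply: contraNneq zc => tz; have := thetaE zeta 1; rewrite tz lcoef0 mul1r => <-.
  have tt : t * zeta ^+ r = 1 by rewrite mulVf.
  have t0 := has_order_neq0 t_order.
  have rz := natL_neq0 r_gt0; rewrite natrD in rz.
  rewrite -rV theta_t; congr (_ *: _ + _ *: _).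
    rewrite -[zeta ^+ r](mulKf t0) tt; field.
    by rewrite rz t0 z0 oppr_eq0 !mulf_neq0.
  rewrite -[zeta ^+ r](mulKf t0) tt; field.
  by rewrite t0 rz.
move=> x; apply: Cinj; rewrite Cc CM !C'K theta_beta -Pn scalerA lconst_nat.
congr (_ * _ *: _); have -> : lvar ^- r = lvar ^ (- r%:Z) :> laurent k by rewrite exprnN.
by rewrite lcomp_varz // -exprnN.
Qed.

End Isomorphism.
End LegendreTransform.

(** * Local Fourier transform of a twisted regular connection *)

Theorem theorem2 (k : closedFieldType) (k_char0 : [pchar k] =i pred0)
    (r s : nat) (r_gt0 : (0 < r)%N) (s_gt0 : (0 < s)%N) (s_lt_r : (s < r)%N)
    (alpha : laurent k) (alpha_order : has_order alpha (- s%:Z)) :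
  (exists zeta : laurent k,
     has_order zeta 1 /\
     lcomp (deriv_t r alpha) zeta + lvar ^+ (r - s) = 0) /\
  (forall zeta beta : laurent k,
     has_order zeta 1 ->
     lcomp (deriv_t r alpha) zeta + lvar ^+ (r - s) = 0 ->
     lcomp alpha zeta + zeta ^- r * lvar ^+ (r - s) = beta ->
     has_order beta (- s%:Z) /\
     forall R : connection k, is_regular R ->
       let M := pushforward k_char0 r_gt0 (tensor (line (theta alpha)) R) in
       inhabited (dual_action M) /\
       forall A : dual_action M,
         conn_iso (local_fourier A)
           (pushforward k_char0 (subn_pos s_lt_r)
              (tensor (line (theta beta + s%:R / 2%:R)) R))).
Proof.
have k_split : monic_split k.
  move=> p /monicP p1; have [l pE] := closed_field_poly_normal p.
  by exists l; rewrite pE p1 scale1r.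
move: (subn_pos s_lt_r) => m_gt0; have rE : r = (r - s + s)%N by rewrite subnK // ltnW.
set m := (r - s)%N in m_gt0 rE *; clearbody m; subst r.
split; first exact: critical_point_ex.
move=> zeta beta zeta1 crit betaE; split; first by rewrite -betaE; exact: beta_order.
move=> R [L [[I [e [e_span LE]]] Lstable]] M.
(* Each generator lies in the stable lattice [L], and [L] is [filt e 0]. *)
have e_stable i : filt e 0 (nabla (e i)).
  suff : L (nabla (e i)) by rewrite LE.
  apply: Lstable; rewrite LE; exists (fun j => if j == i then 1 else 0); split => [j|].
    by case: eqP => _; [exact: vanish_below_const | exact: vanish_below0].
  by rewrite (bigD1 i) //= eqxx scale1r big1 ?addr0 // => j /negPf->; rewrite scale0r.
have [Theta [[TD Tbij] Tc [a Tf] TX Tn]] :=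
  phase_operator k_char0 k_split m_gt0 s_gt0 zeta1 crit e_span e_stable.
rewrite betaE in Tn.
have [U [UD Ubij UZ Un]] := tensor_line (theta alpha) R.
have [U' [U'D U'bij U'Z U'n]] := tensor_line (theta beta + s%:R / 2%:R) R.
(* [U] identifies [R] with the twisted connection, so [Xi] is [Theta] seen with values in the
   pushforward, where a scalar [f] acts as [f(Z^r)]. *)
pose Xi (x : R) : M := U (Theta x).
have XiD : {morph Xi : x y / x + y} by move=> x y; rewrite /Xi TD UD.
have Xi_bij : bijective Xi by exact: bij_comp.
have MZ f (x : M) : f *: x = (inflate (m + s) f *: (x : tensor (line (theta alpha)) R) :
  tensor (line (theta alpha)) R) by [].
have Xi_const c x : Xi (lconst c *: x) = lconst c *: Xi x.
  by rewrite MZ inflate_const // /Xi Tc UZ.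
have Xi_var x : Xi (lvar ^+ m *: x) = lvar *: nabla (Xi x).
  rewrite MZ inflate_lvar //.
  change (nabla (Xi x)) with ((m + s)%:R^-1 *: nabla (U (Theta x)) : tensor (line (theta alpha)) R).
  by rewrite Un -!UZ /Xi TX.
have Xi_cont (L' : set M) : is_lattice L' -> exists n, forall x, filt e n x -> L' (Xi x).
  move=> /(push_lattice_filt e UD UZ) [n hn].
  by exists (n - a) => x xn; apply: hn; have := Tf _ _ xn; rewrite addrC subrK.
have Xi_nabla x : lconst m%:R *: (lvar^-1 *: Xi (lvar ^+ m *: x)) =
    Xi (nabla x + (theta beta + s%:R / 2%:R + m%:R) *: x).
  have iV : inflate (m + s) lvar^-1 = lvar ^- (m + s) :> laurent k.
    have X0 : (lvar : laurent k) ^+ (m + s) != 0 by rewrite expf_neq0 // lvar_neq0.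
    apply: (mulfI X0); rewrite mulfV // -{1}(inflate_lvar k r_gt0) -inflateM //.
    by rewrite mulfV ?lvar_neq0 // -lconst1 inflate_const.
  have E1 y : (lvar^-1 *: Xi y : M) = U (lvar ^- (m + s) *: Theta y).
    by change (inflate (m + s) lvar^-1 *: U (Theta y) = U (lvar ^- (m + s) *: Theta y)); rewrite iV UZ.
  have E2 c z : (lconst c *: (U z : M) : M) = U (lconst c *: z).
    by change (inflate (m + s) (lconst c) *: U z = U (lconst c *: z)); rewrite inflate_const // UZ.
  by rewrite E1 E2 Tn.
split; last first.
  by move=> A; exact: (local_fourier_iso k_char0 m_gt0 e_span XiD Xi_bij Xi_const Xi_var Xi_cont
       U'D U'bij U'Z U'n Xi_nabla A).
by have [A _] := transported_dual_action k_char0 m_gt0 e_span XiD Xi_bij Xi_const Xi_var Xi_cont.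
Qed.
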